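(* Let $\mathcal{D},\mathcal{C}$ be topological stacks and let $F\colon\mathcal{D}\to\mathcal{C}$ be a gerbe over the topological stack $\mathcal{C}$. Assume further that the diagonal morphism $\Delta_F\colon\mathcal{D}\to\mathcal{D}\times_{\mathcal{C}}\mathcal{D}$ is a representable map of local sections. Then there exists a topological groupoid extension $\mathcal{G}\to\mathcal{H}$ inducing the morphism $F\colon\mathcal{D}\to\mathcal{C}$; that is, there are isomorphisms of stacks $B\mathcal{G}\cong\mathcal{D}$ and $B\mathcal{H}\cong\mathcal{C}$ under which the morphism $B\mathcal{G}\to B\mathcal{H}$ associated to the extension corresponds, up to $2$-isomorphism, to $F$. Further, this topological groupoid extension is unique up to Morita equivalence of topological groupoid extensions.
   Context: $\mathrm{Top}$ is the category of topological spaces with the open-cover Grothendieck topology. A stack over $\mathrm{Top}$ is a category fibered in groupoids over $\mathrm{Top}$ satisfying descent for open covers; morphisms of stacks are morphisms of fibered categories, and ''isomorphic'' stacks means equivalent as fibered categories. For a space $U$, $\underline{U}$ denotes the stack represented by $U$ (the fibered category $\mathrm{Top}/U\to\mathrm{Top}$). A continuous map $f\colon X\to Y$ admits local sections (is a map of local sections) if there is an open cover $\{U_\alpha\}$ of $Y$ and a continuous section $U_\alpha\to X$ of $f$ for each $\alpha$. A topological groupoid $\mathcal{G}=[\mathcal{G}_1\rightrightarrows\mathcal{G}_0]$ is a groupoid internal to $\mathrm{Top}$, with source $s$ and target $t$; $\gamma\circ\gamma'$ is defined when $s(\gamma)=t(\gamma')$. A morphism of topological groupoids is a continuous functor. A topological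 groupoid extension of $[\mathcal{H}_1\rightrightarrows M]$ is a morphism of topological groupoids $(\phi,1_M)\colon[\mathcal{G}_1\rightrightarrows M]\to[\mathcal{H}_1\rightrightarrows M]$, the identity on objects, such that $\phi\colon\mathcal{G}_1\to\mathcal{H}_1$ admits local sections; it is written $\phi\colon\mathcal{G}_1\to\mathcal{H}_1\rightrightarrows M$. Given a topological groupoid $[\Gamma_1\rightrightarrows\Gamma_0]$ and a map of local sections $J\colon P_0\to\Gamma_0$, the pullback groupoid along $J$ is $[P_1\rightrightarrows P_0]$ with $P_1=P_0\times_{J,\Gamma_0,s}\Gamma_1\times_{t,\Gamma_0,J}P_0$, source $\mathrm{pr}_1$, target $\mathrm{pr}_3$. A morphism $[\Delta_1\rightrightarrows\Delta_0]\to[\Gamma_1\rightrightarrows\Gamma_0]$ is a Morita morphism of topological groupoids if $\Delta_0\to\Gamma_0$ is a map of local sections and $[\Delta_1\rightrightarrows\Delta_0]$ is isomorphic to the pullback groupoid of $[\Gamma_1\rightrightarrows\Gamma_0]$ along $\Delta_0\to\Gamma_0$. A Morita morphism of topological groupoid extensions from $\phi'\colon X_1'\to Y_1'\rightrightarrows M'$ to $\phi\colon X_1\to Y_1\rightrightarrows M$ is a pair of Morita morphisms of topological groupoids $(\psi_X,f)\colon[X_1'\rightrightarrows M']\to[X_1\rightrightarrows M]$ and $(\psi_Y,f)\colon[Y_1'\rightrightarrows M']\to[Y_1\rightrightarrows M]$ (same $f\colon M'\to M$) with $\phi\circ\psi_X=\psi_Y\circ\phi'$. Two topological groupoid extensions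 are Morita equivalent if there is a third one with Morita morphisms of extensions to both of them. A right action of $\mathcal{G}$ on a space $P$ consists of continuous maps $a\colon P\to\mathcal{G}_0$ and $P\times_{a,\mathcal{G}_0,t}\mathcal{G}_1\to P$, $(p,\gamma)\mapsto p\cdot\gamma$, with $a(p\cdot\gamma)=s(\gamma)$, $p\cdot 1_{a(p)}=p$, $(p\cdot\gamma)\cdot\gamma'=p\cdot(\gamma\circ\gamma')$. A principal $\mathcal{G}$-bundle over a space $N$ is a space $P$ with a right $\mathcal{G}$-action and a continuous map $\pi\colon P\to N$ admitting local sections, such that $\pi(p\cdot\gamma)=\pi(p)$ and $P\times_{\mathcal{G}_0}\mathcal{G}_1\to P\times_N P$, $(p,\gamma)\mapsto(p,p\cdot\gamma)$, is a homeomorphism. A morphism from $(P,\pi,N)$ to $(P',\pi',N')$ is a pair of continuous maps $(\Phi\colon P\to P',f\colon N\to N')$ with $\pi'\circ \Phi=f\circ\pi$, $a'\circ \Phi=a$, $\Phi(p\cdot\gamma)=\Phi(p)\cdot\gamma$. $B\mathcal{G}$ is the stack over $\mathrm{Top}$ of principal $\mathcal{G}$-bundles (with $(P,\pi,N)\mapsto N$). A topological stack is a stack over $\mathrm{Top}$ isomorphic to $B\mathcal{G}$ for some topological groupoid $\mathcal{G}$. The morphism of stacks $B\mathcal{G}\to B\mathcal{H}$ associated to a morphism of topological groupoids $(\phi_1,\phi_0)\colon\mathcal{G}\to\mathcal{H}$ is defined as follows. Let $Q=\mathcal{G}_0\times_{\phi_0,\mathcal{H}_0,t}\mathcal{H}_1$,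 with left $\mathcal{G}$-action $\gamma\cdot(a,\delta)=(t(\gamma),\phi_1(\gamma)\circ\delta)$ along $\mathrm{pr}_1\colon Q\to\mathcal{G}_0$ and right $\mathcal{H}$-action $(a,\delta)\cdot\delta'=(a,\delta\circ\delta')$ along $s\circ\mathrm{pr}_2\colon Q\to\mathcal{H}_0$. A principal $\mathcal{G}$-bundle $P\to N$ is sent to the principal $\mathcal{H}$-bundle $(P\times_{\mathcal{G}_0}Q)/\mathcal{G}_1\to N$, the quotient by the action $\gamma\cdot(p,q)=(p\cdot\gamma,\gamma^{-1}\cdot q)$, with the induced right $\mathcal{H}$-action; similarly on morphisms. The $2$-fiber product $\mathcal{Y}\times_{\mathcal{X}}\mathcal{Z}$ of morphisms $f\colon\mathcal{Y}\to\mathcal{X}$, $g\colon\mathcal{Z}\to\mathcal{X}$ has objects triples $(y,z,\alpha)$ with $y,z$ over the same space and $\alpha\colon f(y)\to g(z)$ an arrow of $\mathcal{X}$ (over the identity), and morphisms the pairs $(u,v)$ over the same base map with $\alpha'\circ f(u)=g(v)\circ\alpha$. A morphism of stacks $F\colon\mathcal{D}\to\mathcal{C}$ is an epimorphism if for every space $U$ and every morphism $q\colon\underline{U}\to\mathcal{C}$ there are an open cover $\{\sigma_\alpha\colon U_\alpha\to U\}$ and morphisms $q_\alpha\colon\underline{U_\alpha}\to\mathcal{D}$ with $2$-isomorphisms $F\circ q_\alpha\Rightarrow q\circ\sigma_\alpha$ for each $\alpha$. It is representable if for every space $U$ and every morphism $\underline{U}\to\mathcal{C}$ the $2$-fiber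 product $\mathcal{D}\times_{\mathcal{C}}\underline{U}$ is isomorphic to $\underline{W}$ for some space $W$. It is a representable map of local sections if it is representable and, for every such $\underline{U}\to\mathcal{C}$, the continuous map $W\to U$ corresponding to the projection $\mathcal{D}\times_{\mathcal{C}}\underline{U}\to\underline{U}$ is a map of local sections. A morphism of topological stacks $F\colon\mathcal{D}\to\mathcal{C}$ is a gerbe over $\mathcal{C}$ if both $F$ and the diagonal morphism $\Delta_F\colon\mathcal{D}\to\mathcal{D}\times_{\mathcal{C}}\mathcal{D}$, $d\mapsto(d,d,1_{F(d)})$, are epimorphisms of stacks. *)

(* Defs.v *)
From HB Require Import structures.
From mathcomp Require Import all_boot all_classical.
From mathcomp Require Import topology.

Set Implicit Arguments.
Unset Strict Implicit.
Unset Printing Implicit Defensive.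

Local Open Scope classical_set_scope.

Definition fprod {A B : topologicalType} {C : Type} (f : A -> C) (g : B -> C) :
  topologicalType := set_type [set p : A * B | f p.1 = g p.2].

Section FiberProduct.
Context {A B : topologicalType} {C : Type} {f : A -> C} {g : B -> C}.

Definition fp1 (x : fprod f g) : A := (\val x).1.
Definition fp2 (x : fprod f g) : B := (\val x).2.

Lemma fpE (x : fprod f g) : f (fp1 x) = g (fp2 x).
Proof. by case: x => -[a b] /= h; have := set_mem h. Qed.

Definition fpair {a : A} {b : B} (e : f a = g b) : fprod f g :=
  exist _ (a, b) (mem_set e).

Lemma fprod_eq (x y : fprod f g) : fp1 x = fp1 y -> fp2 x = fp2 y -> x = y.
Proof.
by case: x y => [[a b] h] [[c d] k]; rewrite /fp1/fp2/= => ac bd; apply: val_inj; rewrite /= ac bd.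
Qed.

Lemma fp1_pair a b (e : f a = g b) : fp1 (fpair e) = a. Proof. by []. Qed.
Lemma fp2_pair a b (e : f a = g b) : fp2 (fpair e) = b. Proof. by []. Qed.

Lemma fpair_eta (x : fprod f g) (e : f (fp1 x) = g (fp2 x)) : fpair e = x.
Proof. exact: fprod_eq. Qed.

End FiberProduct.

Definition fpairE := (@fp1_pair, @fp2_pair).

Lemma cont_comp (X Y Z : topologicalType) (f : X -> Y) (g : Y -> Z) :
  continuous f -> continuous g -> continuous (g \o f).
Proof. by move=> cf cg x; apply: continuous_comp; [exact: cf|exact: cg]. Qed.

Lemma cont_id (X : topologicalType) : continuous (@id X).
Proof. by move=> x. Qed.

Lemma cont_val (X : topologicalType) (A : set X) :
  continuous (fun x : set_type A => \val x).
Proof. exact: initial_continuous. Qed.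

Lemma cont_into_sub (X Y : topologicalType) (A : set Y) (f : X -> set_type A) :
  continuous (fun x => \val (f x)) -> continuous f.
Proof.
move=> /continuousP cf; apply/continuousP => _ [U oU <-].
exact: (cf U oU).
Qed.

Lemma cont_pair (X Y Z : topologicalType) (f : X -> Y) (g : X -> Z) :
  continuous f -> continuous g -> continuous (fun x => (f x, g x)).
Proof. by move=> cf cg x; apply: cvg_pair; [exact: cf|exact: cg]. Qed.

Lemma cont_fst (X Y : topologicalType) : continuous (@fst X Y).
Proof. by move=> x; exact: cvg_fst. Qed.
Lemma cont_snd (X Y : topologicalType) : continuous (@snd X Y).
Proof. by move=> x; exact: cvg_snd. Qed.

Lemma cont_fp1 (A B : topologicalType) C (f : A -> C) (g : B -> C) :
  continuous (@fp1 A B C f g).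
Proof. exact: (cont_comp (@cont_val _ _) (@cont_fst _ _)). Qed.
Lemma cont_fp2 (A B : topologicalType) C (f : A -> C) (g : B -> C) :
  continuous (@fp2 A B C f g).
Proof. exact: (cont_comp (@cont_val _ _) (@cont_snd _ _)). Qed.

Lemma cont_fpair (X A B : topologicalType) C (f : A -> C) (g : B -> C)
    (u : X -> A) (v : X -> B) (e : forall x, f (u x) = g (v x)) :
  continuous u -> continuous v -> continuous (fun x => fpair (e x)).
Proof. by move=> cu cv; apply: cont_into_sub => /=; exact: cont_pair. Qed.
Lemma cont_into_fprod (X A B : topologicalType) C (f : A -> C) (g : B -> C)
    (u : X -> fprod f g) :
  continuous (fp1 \o u) -> continuous (fp2 \o u) -> continuous u.
Proof.
move=> c1 c2.
have -> : u = (fun x => fpair (fpE (u x))).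
  by apply/funext => x; rewrite fpair_eta.
exact: cont_fpair.
Qed.

Lemma sval_eq (T : Type) (P : T -> Prop) (x y : {t | P t}) :
  sval x = sval y -> x = y.
Proof. by apply: eq_sig_hprop => t; exact: Prop_irrelevance. Qed.

Definition homeomorphism (X Y : topologicalType) (f : X -> Y) : Prop :=
  continuous f /\
  exists g : Y -> X, [/\ continuous g, cancel f g & cancel g f].

Record open_cover (Y : topologicalType) := OpenCover {
  idx : Type;
  piece_set : idx -> set Y;
  piece_open : forall i, open (piece_set i);
  piece_cover : forall y, exists i, piece_set i y
}.

Definition piece (Y : topologicalType) (c : open_cover Y) (i : idx c) :
  topologicalType := set_type (piece_set i).

Definition incl (Y : topologicalType) (c : open_cover Y) (i : idx c) :
  piece i -> Y := fun y => \val y.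

Definition local_sections (X Y : topologicalType) (f : X -> Y) : Prop :=
  continuous f /\
  exists c : open_cover Y, forall i : idx c,
    exists s : piece i -> X, continuous s /\ f \o s = incl (i := i).

(* Local sections can be recognised and used pointwise. *)
Lemma local_sectionsP (X Y : topologicalType) (f : X -> Y) :
  continuous f ->
  (forall y, exists2 V : set Y, open V /\ V y &
    exists s : set_type V -> X, continuous s /\ forall v, f (s v) = \val v) ->
  local_sections f.
Proof.
move=> cf H; split=> //.
have H' y := cid2 (H y).
have cov y : exists i, s2val (H' i) y by exists y; have [] := s2valP (H' y).
exists (@OpenCover Y Y (fun y => s2val (H' y)) (fun y => proj1 (s2valP (H' y)))
  cov) => y /=.
have [s [cs es]] := s2valP' (H' y).
by exists s; split=> //; apply/funext => v /=; rewrite es.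
Qed.

Lemma local_sections_at (X Y : topologicalType) (f : X -> Y) (y : Y) :
  local_sections f ->
  exists2 V : set Y, open V /\ V y &
    exists s : set_type V -> X, continuous s /\ forall v, f (s v) = \val v.
Proof.
move=> [cf [c H]]; have [i iy] := piece_cover c y.
exists (piece_set i); first by split=> //; exact: piece_open.
by have [s [cs es]] := H i; exists s; split=> // v; rewrite -[f _]/((f \o s) v) es.
Qed.

(* A map of local sections is a topological quotient map. *)
Lemma local_sections_descend (X Y Z : topologicalType) (q : X -> Y)
    (g : Y -> Z) :
  local_sections q -> continuous (g \o q) -> continuous g.
Proof.
move=> qs cgq y; have [V [oV Vy] [s [cs es]]] := local_sections_at y qs.
move=> A nA.
have cgs : continuous ((g \o q) \o s) by exact: cont_comp.
have e : (g \o q) \o s = fun v => g (\val v).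
  by apply/funext => v /=; rewrite es.
rewrite e in cgs.
have {cgs} := cgs (exist _ y (mem_set Vy)) A nA.
rewrite nbhsE => -[W [[U oU <-] Uy] WA].
rewrite nbhsE; exists (U `&` V); first by split; [exact: openI|split].
move=> z [Uz Vz].
exact: (WA (exist _ z (mem_set Vz)) Uz).
Qed.

(* A topological groupoid with object space [M]; [mul (g, h)] is the composite
   of [h] followed by [g], defined when [src g = tgt h]. *)
Record groupoid (M : topologicalType) := Groupoid {
  arr : topologicalType;
  src : arr -> M;
  tgt : arr -> M;
  one : M -> arr;
  inv : arr -> arr;
  mul : fprod src tgt -> arr;
  src_cont : continuous src;
  tgt_cont : continuous tgt;
  one_cont : continuous one;
  inv_cont : continuous inv;
  mul_cont : continuous mul;
  src_one : forall m, src (one m) = m;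
  tgt_one : forall m, tgt (one m) = m;
  src_inv : forall g, src (inv g) = tgt g;
  tgt_inv : forall g, tgt (inv g) = src g;
  src_mul : forall x, src (mul x) = src (fp2 x);
  tgt_mul : forall x, tgt (mul x) = tgt (fp1 x);
  mulA : forall g h k (e1 : src g = tgt h) (e2 : src h = tgt k)
    (e3 : src g = tgt (mul (fpair e2))) (e4 : src (mul (fpair e1)) = tgt k),
    mul (fpair e3) = mul (fpair e4);
  mul1g : forall g (e : src (one (tgt g)) = tgt g), mul (fpair e) = g;
  mulg1 : forall g (e : src g = tgt (one (src g))), mul (fpair e) = g;
  mulVg : forall g (e : src (inv g) = tgt g), mul (fpair e) = one (src g);
  mulgV : forall g (e : src g = tgt (inv g)), mul (fpair e) = one (tgt g)
}.

(* [gm] extends the multiplication by a junk value to all pairs of arrows; it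
   is only used to carry out computations. *)
Section GroupoidTheory.
Context {M : topologicalType} {G : groupoid M}.
Local Notation src := (@src M G).
Local Notation tgt := (@tgt M G).
Implicit Types g h k : arr G.

Definition gm g h : arr G :=
  if pselect (src g = tgt h) is left e then mul (fpair e) else g.

Lemma gmE g h (e : src g = tgt h) : mul (fpair e) = gm g h.
Proof.
by rewrite /gm; case: pselect => // e'; congr mul; apply: fprod_eq.
Qed.
Lemma gmE' x : mul x = gm (fp1 x) (fp2 x).
Proof. by rewrite -(gmE (fpE x)) fpair_eta. Qed.
Lemma src_gm g h : src g = tgt h -> src (gm g h) = src h.
Proof. by move=> e; rewrite -(gmE e) src_mul. Qed.
Lemma tgt_gm g h : src g = tgt h -> tgt (gm g h) = tgt g.
Proof. by move=> e; rewrite -(gmE e) tgt_mul. Qed.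
Lemma gmA g h k : src g = tgt h -> src h = tgt k ->
  gm g (gm h k) = gm (gm g h) k.
Proof.
move=> e1 e2.
have e3 : src g = tgt (mul (fpair e2)) by rewrite tgt_mul.
have e4 : src (mul (fpair e1)) = tgt k by rewrite src_mul.
by rewrite -(gmE e1) -(gmE e2) -(gmE e3) -(gmE e4); exact: mulA.
Qed.
Lemma gm1g g m : m = tgt g -> gm (one G m) g = g.
Proof.
by move=> ->; have e := src_one G (tgt g); rewrite -(gmE e) mul1g.
Qed.
Lemma gmg1 g m : m = src g -> gm g (one G m) = g.
Proof.
by move=> ->; have e := esym (tgt_one G (src g)); rewrite -(gmE e) mulg1.
Qed.
Lemma gmVg g : gm (inv g) g = one G (src g).
Proof. by rewrite -(gmE (src_inv g)) mulVg. Qed.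
Lemma gmgV g : gm g (inv g) = one G (tgt g).
Proof. by rewrite -(gmE (esym (tgt_inv g))) mulgV. Qed.
Lemma gmKV g h : tgt g = tgt h -> gm g (gm (inv g) h) = h.
Proof.
by move=> e; rewrite gmA ?tgt_inv ?src_inv// gmgV gm1g.
Qed.
Lemma gmK g h : src g = tgt h -> gm (inv g) (gm g h) = h.
Proof.
by move=> e; rewrite gmA ?src_inv// gmVg gm1g.
Qed.
Lemma cont_gm (X : topologicalType) (u v : X -> arr G) :
  (forall x, src (u x) = tgt (v x)) -> continuous u -> continuous v ->
  continuous (fun x => gm (u x) (v x)).
Proof.
move=> e cu cv.
have -> : (fun x => gm (u x) (v x)) = @mul _ G \o (fun x => fpair (e x)).
  by apply/funext => x /=; rewrite gmE.
by apply: cont_comp; [exact: cont_fpair|exact: mul_cont].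
Qed.

End GroupoidTheory.

Record gmor (M N : topologicalType) (G : groupoid M) (H : groupoid N) := GMor {
  gm0 : M -> N;
  gm1 : arr G -> arr H;
  gm0_cont : continuous gm0;
  gm1_cont : continuous gm1;
  gm_src : forall g, src (gm1 g) = gm0 (src g);
  gm_tgt : forall g, tgt (gm1 g) = gm0 (tgt g);
  gm_one : forall m, gm1 (one G m) = one H (gm0 m);
  gm_mul : forall x (e : src (gm1 (fp1 x)) = tgt (gm1 (fp2 x))),
    gm1 (mul x) = mul (fpair e)
}.

Section GMorTheory.
Context {M N : topologicalType} {G : groupoid M} {H : groupoid N}.
Variable phi : gmor G H.

Lemma gm1_gm g h : src g = tgt h -> gm1 phi (gm g h) = gm (gm1 phi g) (gm1 phi h).
Proof.
move=> e; rewrite -(gmE e).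
have e' : src (gm1 phi g) = tgt (gm1 phi h) by rewrite gm_src gm_tgt e.
by rewrite -(gmE e') (gm_mul (x := fpair e) e').
Qed.

End GMorTheory.

Record extension := Extension {
  ext_obj : topologicalType;
  ext_dom : groupoid ext_obj;
  ext_cod : groupoid ext_obj;
  ext_mor : gmor ext_dom ext_cod;
  ext_mor0 : gm0 ext_mor = id;
  ext_mor1 : local_sections (gm1 ext_mor)
}.

Section Pullback.
Context {P0 M : topologicalType}.
Variables (J : P0 -> M) (cJ : continuous J) (G : groupoid M).

Definition pb_arr : topologicalType :=
  set_type [set x : P0 * arr G * P0 | J x.1.1 = src x.1.2 /\ tgt x.1.2 = J x.2].

Definition pb1 (x : pb_arr) : P0 := (\val x).1.1.
Definition pb2 (x : pb_arr) : arr G := (\val x).1.2.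
Definition pb3 (x : pb_arr) : P0 := (\val x).2.

Lemma pb_src x : J (pb1 x) = src (pb2 x).
Proof. by case: x => -[[a b] c] /= h; have [] := set_mem h. Qed.
Lemma pb_tgt x : tgt (pb2 x) = J (pb3 x).
Proof. by case: x => -[[a b] c] /= h; have [] := set_mem h. Qed.

Definition pb_mk p g q (e : J p = src g) (e' : tgt g = J q) : pb_arr :=
  exist _ (p, g, q) (mem_set (conj e e')).

Lemma pb_eq x y : pb1 x = pb1 y -> pb2 x = pb2 y -> pb3 x = pb3 y -> x = y.
Proof.
case: x y => [[[a b] c] h] [[[a' b'] c'] h'].
rewrite /pb1 /pb2 /pb3 /= => e1 e2 e3.
by apply: val_inj; rewrite /= e1 e2 e3.
Qed.

Lemma cont_pb1 : continuous pb1.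
Proof.
exact: (cont_comp (cont_comp (@cont_val _ _) (@cont_fst _ _)) (@cont_fst _ _)).
Qed.
Lemma cont_pb2 : continuous pb2.
Proof.
exact: (cont_comp (cont_comp (@cont_val _ _) (@cont_fst _ _)) (@cont_snd _ _)).
Qed.
Lemma cont_pb3 : continuous pb3.
Proof. exact: (cont_comp (@cont_val _ _) (@cont_snd _ _)). Qed.

Lemma cont_pb_mk (X : topologicalType) (p q : X -> P0) (g : X -> arr G)
  (e : forall x, J (p x) = src (g x)) (e' : forall x, tgt (g x) = J (q x)) :
  continuous p -> continuous g -> continuous q ->
  continuous (fun x => pb_mk (e x) (e' x)).
Proof.
by move=> cp cg cq; apply: cont_into_sub => /=; apply: cont_pair => //; exact: cont_pair.
Qed.

Lemma pb_one_src m : J m = src (one G (J m)). Proof. by rewrite src_one. Qed.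
Lemma pb_one_tgt m : tgt (one G (J m)) = J m. Proof. by rewrite tgt_one. Qed.
Definition pb_one m : pb_arr := pb_mk (pb_one_src m) (pb_one_tgt m).

Lemma pb_inv_src x : J (pb3 x) = src (inv (pb2 x)).
Proof. by rewrite src_inv pb_tgt. Qed.
Lemma pb_inv_tgt x : tgt (inv (pb2 x)) = J (pb1 x).
Proof. by rewrite tgt_inv pb_src. Qed.
Definition pb_inv x : pb_arr := pb_mk (pb_inv_src x) (pb_inv_tgt x).

Lemma pb_mul_comp (x : fprod pb1 pb3) : src (pb2 (fp1 x)) = tgt (pb2 (fp2 x)).
Proof. by rewrite -pb_src pb_tgt fpE. Qed.
Lemma pb_mul_src (x : fprod pb1 pb3) :
  J (pb1 (fp2 x)) = src (mul (fpair (pb_mul_comp x))).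
Proof. by rewrite src_mul -pb_src. Qed.
Lemma pb_mul_tgt (x : fprod pb1 pb3) :
  tgt (mul (fpair (pb_mul_comp x))) = J (pb3 (fp1 x)).
Proof. by rewrite tgt_mul -pb_tgt. Qed.
Definition pb_mul (x : fprod pb1 pb3) : pb_arr :=
  pb_mk (pb_mul_src x) (pb_mul_tgt x).

Lemma pb2_mul x : pb2 (pb_mul x) = gm (pb2 (fp1 x)) (pb2 (fp2 x)).
Proof. by rewrite /pb_mul {1}/pb2 /= gmE. Qed.

Definition pullback_groupoid : groupoid P0.
Proof.
refine (@Groupoid P0 pb_arr pb1 pb3 pb_one pb_inv pb_mul cont_pb1 cont_pb3
  _ _ _ _ _ _ _ _ _ _ _ _ _ _).
- apply: cont_pb_mk; [exact: cont_id| |exact: cont_id].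
  exact: (cont_comp cJ (@one_cont _ G)).
- apply: cont_pb_mk; [exact: cont_pb3| |exact: cont_pb1].
  exact: (cont_comp cont_pb2 (@inv_cont _ G)).
- apply: cont_pb_mk.
  + exact: (cont_comp (@cont_fp2 _ _ _ _ _) cont_pb1).
  + apply: (cont_comp _ (@mul_cont _ G)); apply: cont_fpair.
      exact: (cont_comp (@cont_fp1 _ _ _ _ _) cont_pb2).
    exact: (cont_comp (@cont_fp2 _ _ _ _ _) cont_pb2).
  + exact: (cont_comp (@cont_fp1 _ _ _ _ _) cont_pb3).
- by [].
- by [].
- by [].
- by [].
- by [].
- by [].
- move=> g h k e1 e2 e3 e4; apply: pb_eq => //; rewrite !(pb2_mul, fpairE).
  by rewrite gmA// -pb_src pb_tgt ?e1 ?e2.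
- move=> g e; apply: pb_eq => //; rewrite ?(pb2_mul, fpairE).
  by rewrite gm1g// pb_tgt.
- move=> g e; apply: pb_eq => //; rewrite ?(pb2_mul, fpairE).
  by rewrite gmg1// pb_src.
- move=> g e; apply: pb_eq => //; rewrite ?(pb2_mul, fpairE).
  by rewrite gmVg -pb_src.
- move=> g e; apply: pb_eq => //; rewrite ?(pb2_mul, fpairE).
  by rewrite gmgV pb_tgt.
Defined.

End Pullback.

(* The isomorphism with the pullback groupoid is required to be the identity on
   objects and to be compatible with the maps to [G]; it is then the canonical
   comparison morphism. *)
Definition morita_morphism (M' M : topologicalType) (D : groupoid M')
    (G : groupoid M) (psi : gmor D G) : Prop :=
  local_sections (gm0 psi) /\
  exists i : gmor D (pullback_groupoid (@gm0_cont _ _ _ _ psi) G),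
    [/\ gm0 i = id, homeomorphism (gm1 i) &
        forall d, pb2 (gm1 i d) = gm1 psi d].

Definition ext_morita_morphism (E' E : extension) : Prop :=
  exists (psiX : gmor (ext_dom E') (ext_dom E))
         (psiY : gmor (ext_cod E') (ext_cod E)),
    [/\ morita_morphism psiX, morita_morphism psiY, gm0 psiX = gm0 psiY &
        gm1 (ext_mor E) \o gm1 psiX = gm1 psiY \o gm1 (ext_mor E')].

Definition ext_morita_equivalent (E1 E2 : extension) : Prop :=
  exists E, ext_morita_morphism E E1 /\ ext_morita_morphism E E2.

(* A category [D] with a functor to Top, presented by its fibres: [Ob D X] is
   the class of objects lying over [X], and [base u] is the image of an arrow
   [u] in Top. *)
Record over_top := OverTop {
  Ob : topologicalType -> Type;
  Hom : forall X Y : topologicalType, Ob X -> Ob Y -> Type;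
  base : forall (X Y : topologicalType) (x : Ob X) (y : Ob Y),
    Hom x y -> X -> Y;
  idm : forall (X : topologicalType) (x : Ob X), Hom x x;
  comp : forall (X Y Z : topologicalType) (x : Ob X) (y : Ob Y) (z : Ob Z),
    Hom y z -> Hom x y -> Hom x z;
  base_cont : forall (X Y : topologicalType) (x : Ob X) (y : Ob Y)
    (u : Hom x y), continuous (base u);
  base_id : forall (X : topologicalType) (x : Ob X), base (idm x) = id;
  base_comp : forall (X Y Z : topologicalType) (x : Ob X) (y : Ob Y) (z : Ob Z)
    (v : Hom y z) (u : Hom x y), base (comp v u) = base v \o base u;
  comp1m : forall (X Y : topologicalType) (x : Ob X) (y : Ob Y) (u : Hom x y),
    comp (idm y) u = u;
  compm1 : forall (X Y : topologicalType) (x : Ob X) (y : Ob Y) (u : Hom x y),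
    comp u (idm x) = u;
  compA : forall (X Y Z W : topologicalType)
    (x : Ob X) (y : Ob Y) (z : Ob Z) (w : Ob W)
    (h : Hom z w) (v : Hom y z) (u : Hom x y),
    comp h (comp v u) = comp (comp h v) u
}.
Arguments Hom {o X Y} x y.
Arguments base {o X Y x y} u.
Arguments idm {o X} x.
Arguments comp {o X Y Z x y z} v u.

Definition fibered_in_groupoids (D : over_top) : Prop :=
  (forall (X Y : topologicalType) (f : X -> Y) (y : Ob D Y), continuous f ->
     exists (x : Ob D X) (u : Hom x y), base u = f) /\
  (forall (X Y Z : topologicalType) (x : Ob D X) (y : Ob D Y) (z : Ob D Z)
     (v : Hom y z) (w : Hom x z) (f : X -> Y),
     continuous f -> base v \o f = base w ->
     exists! u : Hom x y, base u = f /\ comp v u = w).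

(* The descent conditions are written without choosing a cleavage: the
   restriction of [x] to an open subset is an arbitrary arrow to [x] lying over
   the inclusion. *)
Section Descent.
Variable D : over_top.

Definition overlap (X : topologicalType) (c : open_cover X) (i j : idx c) :
  topologicalType := set_type (piece_set i `&` piece_set j).

Definition overlap3 (X : topologicalType) (c : open_cover X) (i j k : idx c) :
  topologicalType := set_type (piece_set i `&` piece_set j `&` piece_set k).

(* [u] lies over the inclusion between two subspaces of [X]. *)
Definition over_incl (X : topologicalType) (A B : set X)
    (a : Ob D (set_type A)) (b : Ob D (set_type B)) (u : Hom a b) : Prop :=
  forall y, \val (base u y) = \val y.

Definition arrows_glue : Prop :=
  forall (X : topologicalType) (c : open_cover X) (x y : Ob D X)
    (xr : forall i : idx c, Ob D (piece i))
    (r : forall i, Hom (xr i) x) (f : forall i, Hom (xr i) y),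
    (forall i, base (r i) = incl (i := i)) ->
    (forall i, base (f i) = incl (i := i)) ->
    (forall i j (w : Ob D (overlap i j)) (a : Hom w (xr i)) (b : Hom w (xr j)),
       over_incl a -> over_incl b ->
       comp (r i) a = comp (r j) b -> comp (f i) a = comp (f j) b) ->
    exists! u : Hom x y, base u = id /\ forall i, comp u (r i) = f i.

(* A descent datum consists of objects [x i] over the pieces and, for all [i]
   and [j], an object [xx i j] over the overlap that is a restriction both of
   [x i] (through [a i j]) and of [x j] (through [b i j]). This amounts to an
   isomorphism between the two restrictions; the fifth hypothesis is the
   cocycle condition. *)
Definition objects_glue : Prop :=
  forall (X : topologicalType) (c : open_cover X)
    (x : forall i : idx c, Ob D (piece i))
    (xx : forall i j : idx c, Ob D (overlap i j))
    (a : forall i j, Hom (xx i j) (x i)) (b : forall i j, Hom (xx i j) (x j)),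
    (forall i j, over_incl (a i j)) ->
    (forall i j, over_incl (b i j)) ->
    (forall i j k (w : Ob D (overlap3 i j k))
       (u : Hom w (xx i j)) (v : Hom w (xx j k)) (t : Hom w (xx i k)),
       over_incl u -> over_incl v -> over_incl t ->
       comp (b i j) u = comp (a j k) v ->
       comp (a i j) u = comp (a i k) t ->
       comp (b j k) v = comp (b i k) t) ->
    exists (y : Ob D X) (r : forall i, Hom (x i) y),
      (forall i, base (r i) = incl (i := i)) /\
      (forall i j, comp (r i) (a i j) = comp (r j) (b i j)).

Definition is_stack : Prop :=
  [/\ fibered_in_groupoids D, arrows_glue & objects_glue].

End Descent.

(* When [C] is fibered in groupoids all its arrows are cartesian, so a functor
   over Top is already a morphism of fibered categories. *)
Record functor (D C : over_top) := Functor {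
  fob : forall X : topologicalType, Ob D X -> Ob C X;
  fhom : forall (X Y : topologicalType) (x : Ob D X) (y : Ob D Y),
    Hom x y -> Hom (fob x) (fob y);
  fhom_base : forall (X Y : topologicalType) (x : Ob D X) (y : Ob D Y)
    (u : Hom x y), base (fhom u) = base u;
  fhom_id : forall (X : topologicalType) (x : Ob D X),
    fhom (idm x) = idm (fob x);
  fhom_comp : forall (X Y Z : topologicalType)
    (x : Ob D X) (y : Ob D Y) (z : Ob D Z) (v : Hom y z) (u : Hom x y),
    fhom (comp v u) = comp (fhom v) (fhom u)
}.
Arguments fob {D C} f {X} x : rename.
Arguments fhom {D C} f {X Y x y} u : rename.

Definition fid (D : over_top) : functor D D.
Proof. exact: (@Functor D D (fun _ x => x) (fun _ _ _ _ u => u)). Defined.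

Definition fcomp (D C B : over_top) (G : functor C B) (F : functor D C) :
  functor D B.
Proof.
refine (@Functor D B (fun _ x => fob G (fob F x))
  (fun _ _ _ _ u => fhom G (fhom F u)) _ _ _).
- by move=> *; rewrite !fhom_base.
- by move=> *; rewrite !fhom_id.
- by move=> *; rewrite !fhom_comp.
Defined.

Definition iso2 (D C : over_top) (F G : functor D C) : Prop :=
  exists eta : forall (X : topologicalType) (x : Ob D X), Hom (fob F x) (fob G x),
    [/\ forall X (x : Ob D X), base (eta X x) = id,
        forall X Y (x : Ob D X) (y : Ob D Y) (u : Hom x y),
          comp (eta Y y) (fhom F u) = comp (fhom G u) (eta X x) &
        forall X (x : Ob D X), exists theta : Hom (fob G x) (fob F x),
          comp theta (eta X x) = idm _ /\ comp (eta X x) theta = idm _].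

Definition equivalence (D C : over_top) (F : functor D C) : Prop :=
  exists G : functor C D, iso2 (fcomp G F) (fid D) /\ iso2 (fcomp F G) (fid C).

Definition equivalent (D C : over_top) : Prop :=
  exists F : functor D C, equivalence F.

Section Represented.
Variable U : topologicalType.

Definition rep_ob (X : topologicalType) := {f : X -> U | continuous f}.
Definition rep_hom (X Y : topologicalType) (f : rep_ob X) (g : rep_ob Y) :=
  {h : X -> Y | continuous h /\ sval g \o h = sval f}.

Definition rep_id (X : topologicalType) (f : rep_ob X) : rep_hom f f :=
  exist _ id (conj (@cont_id X) erefl).

Definition rep_comp (X Y Z : topologicalType)
  (f : rep_ob X) (g : rep_ob Y) (h : rep_ob Z)
  (v : rep_hom g h) (u : rep_hom f g) : rep_hom f h.
Proof.
exists (sval v \o sval u); case: v u => v [cv ev] [u [cu eu]] /=.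
by split; [exact: cont_comp|rewrite -eu -ev].
Defined.

Definition rep : over_top.
Proof.
refine (@OverTop rep_ob rep_hom (fun _ _ _ _ u => sval u) rep_id rep_comp
  _ _ _ _ _ _) => //; try by move=> *; exact: sval_eq.
by move=> X Y x y [u []].
Defined.

End Represented.

Section RepresentedMap.
Variables (U V : topologicalType) (s : U -> V) (cs : continuous s).

Definition rep_map_ob (X : topologicalType) (f : rep_ob U X) : rep_ob V X :=
  exist _ (s \o sval f) (cont_comp (svalP f) cs).

Definition rep_map_hom (X Y : topologicalType) (f : rep_ob U X) (g : rep_ob U Y)
  (h : rep_hom f g) : rep_hom (rep_map_ob f) (rep_map_ob g).
Proof.
exists (sval h); case: h => h [ch eh] /=; split => //.
by apply/funext => x /=; rewrite -eh.
Defined.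

Definition rep_map : functor (rep U) (rep V).
Proof.
refine (@Functor (rep U) (rep V) rep_map_ob rep_map_hom _ _ _) => //.
- by move=> *; exact: sval_eq.
- by move=> *; exact: sval_eq.
Defined.

End RepresentedMap.

Lemma incl_cont (Y : topologicalType) (c : open_cover Y) (i : idx c) :
  continuous (incl (i := i)).
Proof. exact: cont_val. Qed.

Section FiberProductStack.
Variables (Y Z X : over_top) (f : functor Y X) (g : functor Z X).

Record fib_ob (T : topologicalType) := FibOb {
  fib1 : Ob Y T;
  fib2 : Ob Z T;
  fib_arr : Hom (fob f fib1) (fob g fib2);
  fib_arr_base : base fib_arr = id
}.

Record fib_hom (S T : topologicalType) (x : fib_ob S) (y : fib_ob T) := FibHom {
  fibm1 : Hom (fib1 x) (fib1 y);
  fibm2 : Hom (fib2 x) (fib2 y);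
  fibm_base : base fibm1 = base fibm2;
  fibm_comm : comp (fib_arr y) (fhom f fibm1) = comp (fhom g fibm2) (fib_arr x)
}.

Lemma fib_hom_eq (S T : topologicalType) (x : fib_ob S) (y : fib_ob T)
  (u v : fib_hom x y) : fibm1 u = fibm1 v -> fibm2 u = fibm2 v -> u = v.
Proof.
case: u v => [u1 u2 ub uc] [v1 v2 vb vc] /= e1 e2.
by move: ub uc vb vc; rewrite e1 e2 => *; congr FibHom; exact: Prop_irrelevance.
Qed.

Definition fib_id (T : topologicalType) (x : fib_ob T) : fib_hom x x.
Proof.
apply: (@FibHom _ _ x x (idm _) (idm _)); first by rewrite !base_id.
by rewrite !fhom_id compm1 comp1m.
Defined.

Definition fib_comp (R S T : topologicalType) (x : fib_ob R) (y : fib_ob S)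
  (z : fib_ob T) (v : fib_hom y z) (u : fib_hom x y) : fib_hom x z.
Proof.
apply: (@FibHom _ _ x z (comp (fibm1 v) (fibm1 u)) (comp (fibm2 v) (fibm2 u))).
  by rewrite !base_comp !fibm_base.
by rewrite !fhom_comp compA fibm_comm -compA fibm_comm compA.
Defined.

Definition fibprod : over_top.
Proof.
refine (@OverTop fib_ob fib_hom (fun _ _ _ _ u => base (fibm1 u)) fib_id
  fib_comp _ _ _ _ _ _) => /=.
- by move=> *; exact: base_cont.
- by move=> *; rewrite base_id.
- by move=> *; rewrite base_comp.
- by move=> *; apply: fib_hom_eq => /=; rewrite comp1m.
- by move=> *; apply: fib_hom_eq => /=; rewrite compm1.
- by move=> *; apply: fib_hom_eq => /=; rewrite compA.
Defined.

Definition fib_pr2 : functor fibprod Z.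
Proof.
refine (@Functor fibprod Z fib2 (fun _ _ _ _ u => fibm2 u) _ _ _) => //=.
by move=> *; rewrite fibm_base.
Defined.

End FiberProductStack.

Section Diagonal.
Variables (D C : over_top) (F : functor D C).

Definition diag_ob (X : topologicalType) (d : Ob D X) : fib_ob F F X :=
  @FibOb D D C F F X d d (idm (fob F d)) (base_id _).

Lemma diag_comm (X Y : topologicalType) (d : Ob D X) (d' : Ob D Y)
  (u : Hom d d') :
  comp (idm (fob F d')) (fhom F u) = comp (fhom F u) (idm (fob F d)).
Proof. by rewrite comp1m compm1. Qed.

Definition diag_hom (X Y : topologicalType) (d : Ob D X) (d' : Ob D Y)
    (u : Hom d d') : fib_hom (diag_ob d) (diag_ob d') :=
  @FibHom D D C F F X Y (diag_ob d) (diag_ob d') u u erefl (diag_comm u).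

Definition diagonal : functor D (fibprod F F).
Proof.
refine (@Functor D (fibprod F F) diag_ob diag_hom _ _ _) => //.
- by move=> *; exact: fib_hom_eq.
- by move=> *; exact: fib_hom_eq.
Defined.

End Diagonal.

Definition epimorphism (D C : over_top) (F : functor D C) : Prop :=
  forall (U : topologicalType) (q : functor (rep U) C),
    exists c : open_cover U, forall i : idx c,
      exists qi : functor (rep (piece i)) D,
        iso2 (fcomp F qi) (fcomp q (rep_map (@incl_cont U c i))).

Definition representable (D C : over_top) (F : functor D C) : Prop :=
  forall (U : topologicalType) (q : functor (rep U) C),
    exists W : topologicalType, equivalent (rep W) (fibprod F q).

Definition rep_self (W : topologicalType) : Ob (rep W) W :=
  exist _ id (@cont_id W).

(* The continuous map [W -> U] corresponding to a morphism of stacks from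
   [rep W] to [rep U] is the image of the identity of [W]. *)
Definition map_of (W U : topologicalType) (p : functor (rep W) (rep U)) :
  W -> U := sval (fob p (rep_self W)).

Definition representable_local_sections (D C : over_top) (F : functor D C) :
    Prop :=
  representable F /\
  forall (U : topologicalType) (q : functor (rep U) C) (W : topologicalType)
    (e : functor (rep W) (fibprod F q)),
    equivalence e -> local_sections (map_of (fcomp (fib_pr2 F q) e)).

Definition gerbe (D C : over_top) (F : functor D C) : Prop :=
  epimorphism F /\ epimorphism (diagonal F).

Record principal_bundle (M : topologicalType) (G : groupoid M)
    (N : topologicalType) := PrincipalBundle {
  tot : topologicalType;
  anchor : tot -> M;
  act : fprod anchor (@tgt M G) -> tot;
  proj : tot -> N;
  anchor_cont : continuous anchor;
  act_cont : continuous act;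
  anchor_act : forall x, anchor (act x) = src (fp2 x);
  act_one : forall p (e : anchor p = tgt (one G (anchor p))), act (fpair e) = p;
  act_mul : forall p g h (e1 : anchor p = tgt g) (e2 : src g = tgt h)
    (e3 : anchor (act (fpair e1)) = tgt h) (e4 : anchor p = tgt (mul (fpair e2))),
    act (fpair e3) = act (fpair e4);
  proj_sections : local_sections proj;
  proj_act : forall x, proj (fp1 x) = proj (act x);
  shear_homeo : homeomorphism (fun x => fpair (proj_act x))
}.
Arguments tot {M G N} P : rename.
Arguments anchor {M G N} P _ : rename.
Arguments act {M G N} P _ : rename.
Arguments proj {M G N} P _ : rename.

Record bundle_mor (M : topologicalType) (G : groupoid M) (N N' : topologicalType)
    (P : principal_bundle G N) (P' : principal_bundle G N') := BundleMor {
  bm_tot : tot P -> tot P';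
  bm_base : N -> N';
  bm_tot_cont : continuous bm_tot;
  bm_base_cont : continuous bm_base;
  bm_proj : forall p, proj P' (bm_tot p) = bm_base (proj P p);
  bm_anchor : forall p, anchor P' (bm_tot p) = anchor P p;
  bm_act : forall x (e : anchor P' (bm_tot (fp1 x)) = tgt (fp2 x)),
    bm_tot (act P x) = act P' (fpair e)
}.

Lemma bundle_mor_eq (M : topologicalType) (G : groupoid M)
  (N N' : topologicalType) (P : principal_bundle G N)
  (P' : principal_bundle G N') (u v : bundle_mor P P') :
  bm_tot u =1 bm_tot v -> bm_base u = bm_base v -> u = v.
Proof.
case: u v => [u1 u2 a1 a2 a3 a4 a5] [v1 v2 b1 b2 b3 b4 b5] /= /funext e1 e2.
move: a1 a2 a3 a4 a5 b1 b2 b3 b4 b5; rewrite e1 e2 => *.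
by congr BundleMor; exact: Prop_irrelevance.
Qed.

Section ClassifyingStack.
Variables (M : topologicalType) (G : groupoid M).

Definition bundle_id (N : topologicalType) (P : principal_bundle G N) :
  bundle_mor P P.
Proof.
refine (@BundleMor M G N N P P id id (@cont_id _) (@cont_id _) _ _ _) => //.
by move=> x e; rewrite fpair_eta.
Defined.

Definition bundle_comp (N1 N2 N3 : topologicalType)
  (P1 : principal_bundle G N1) (P2 : principal_bundle G N2)
  (P3 : principal_bundle G N3) (v : bundle_mor P2 P3) (u : bundle_mor P1 P2) :
  bundle_mor P1 P3.
Proof.
refine (@BundleMor M G N1 N3 P1 P3 (bm_tot v \o bm_tot u)
  (bm_base v \o bm_base u) _ _ _ _ _).
- by apply: cont_comp; exact: bm_tot_cont.
- by apply: cont_comp; exact: bm_base_cont.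
- by move=> p /=; rewrite !bm_proj.
- by move=> p /=; rewrite !bm_anchor.
- move=> x /= e.
  have e' : anchor P2 (bm_tot u (fp1 x)) = tgt (fp2 x) by rewrite bm_anchor fpE.
  by rewrite (bm_act e') (bm_act (x := fpair e') e).
Defined.

Definition B : over_top.
Proof.
refine (@OverTop (principal_bundle G) (@bundle_mor M G)
  (fun _ _ _ _ u => bm_base u) bundle_id bundle_comp _ _ _ _ _ _) => //.
- by move=> *; exact: bm_base_cont.
- by move=> *; exact: bundle_mor_eq.
- by move=> *; exact: bundle_mor_eq.
- by move=> *; exact: bundle_mor_eq.
Defined.

End ClassifyingStack.

Lemma local_sections_id (X : topologicalType) : local_sections (@id X).
Proof.
apply: local_sectionsP; first exact: cont_id.
by move=> y; exists setT; [split=> //; exact: openT|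
  exists (fun x => \val x); split=> //; exact: cont_val].
Qed.

Section FprodMap.
Variables (X Y X' Y' : topologicalType) (C : Type).
Variables (q : X -> Y) (q' : X' -> Y') (f : Y -> C) (f' : Y' -> C).

Definition fprod_map (z : fprod (f \o q) (f' \o q')) : fprod f f' :=
  @fpair _ _ _ f f' (q (fp1 z)) (q' (fp2 z)) (fpE z).

Lemma fprod_map_sections :
  local_sections q -> local_sections q' -> local_sections fprod_map.
Proof.
move=> lq lq'; apply: local_sectionsP.
  apply: cont_fpair.
    by apply: cont_comp; [exact: cont_fp1|exact: lq.1].
  by apply: cont_comp; [exact: cont_fp2|exact: lq'.1].
move=> z; have [V [oV Vz] [s [cs es]]] := local_sections_at (fp1 z) lq.
have [V' [oV' Vz'] [s' [cs' es']]] := local_sections_at (fp2 z) lq'.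
pose W : set (fprod f f') := fp1 @^-1` V `&` fp2 @^-1` V'.
exists W.
  split=> //; apply: openI.
    by move/continuousP : (@cont_fp1 _ _ _ f f') => /(_ _ oV).
  by move/continuousP : (@cont_fp2 _ _ _ f f') => /(_ _ oV').
pose w1 (w : set_type W) : set_type V :=
  exist _ (fp1 (\val w)) (mem_set (set_mem (valP w)).1).
pose w2 (w : set_type W) : set_type V' :=
  exist _ (fp2 (\val w)) (mem_set (set_mem (valP w)).2).
have e w : (f \o q) (s (w1 w)) = (f' \o q') (s' (w2 w)).
  by rewrite /= es es' /=; exact: fpE.
exists (fun w => fpair (e w)); split.
  apply: cont_fpair; apply: cont_comp => //; apply: cont_into_sub => /=.
    exact: (cont_comp (@cont_val _ _) (@cont_fp1 _ _ _ _ _)).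
  exact: (cont_comp (@cont_val _ _) (@cont_fp2 _ _ _ _ _)).
by move=> w; apply: fprod_eq; rewrite /fprod_map fpairE /= ?es ?es'.
Qed.

End FprodMap.

Lemma quotient_restrict (X Y Z : topologicalType) (q : X -> Y) (V : set Y)
    (s : set_type V -> Z) :
  (forall U : set Y, open (q @^-1` U) -> open U) -> open (q @^-1` V) ->
  continuous (fun x : set_type (q @^-1` V) =>
    s (exist _ (q (\val x)) (mem_set (set_mem (valP x))))) ->
  continuous s.
Proof.
move=> hq oV /continuousP cs; apply/continuousP => W oW.
have [O oO eO] := cs W oW.
pose U := [set y | exists h : y \in V, W (s (exist _ y h))].
have eU : q @^-1` U = O `&` q @^-1` V.
  apply/seteqP; split => x /=.
    move=> [h Ws]; split; last exact: set_mem h.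
    have hx : x \in q @^-1` V by apply/mem_set; exact: set_mem h.
    rewrite -[O x]/((set_val @^-1` O) (exist _ x hx : set_type _)) eO /=.
    by rewrite (_ : exist _ _ _ = exist _ (q x) h)//; exact: val_inj.
  move=> [Ox Vx]; exists (mem_set Vx).
  have : (set_val @^-1` O) (exist _ x (mem_set Vx) : set_type (q @^-1` V)) by [].
  rewrite eO /=.
  by rewrite (_ : exist _ _ _ = exist _ (q x) (mem_set Vx))//; exact: val_inj.
exists U; first by apply: hq; rewrite eU; exact: openI.
apply/seteqP; split => -[y h] /=.
  move=> [h' Ws]; rewrite (_ : exist _ _ _ = exist _ y h')//; exact: val_inj.
by move=> Ws; exists h.
Qed.

(* [ac] extends the action by a junk value; only used in computations. *)
Section BundleTheory.
Context {M : topologicalType} {G : groupoid M} {N : topologicalType}.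
Variable P : principal_bundle G N.

Definition ac (p : tot P) (g : arr G) : tot P :=
  if pselect (anchor P p = tgt g) is left e then act P (fpair e) else p.

Lemma acE p g (e : anchor P p = tgt g) : act P (fpair e) = ac p g.
Proof.
by rewrite /ac; case: pselect => // e'; congr (act P); exact: fprod_eq.
Qed.
Lemma acE' x : act P x = ac (fp1 x) (fp2 x).
Proof. by rewrite -(acE (fpE x)) fpair_eta. Qed.
Lemma anchor_ac p g : anchor P p = tgt g -> anchor P (ac p g) = src g.
Proof. by move=> e; rewrite -(acE e) anchor_act. Qed.
Lemma proj_ac p g : anchor P p = tgt g -> proj P (ac p g) = proj P p.
Proof. by move=> e; rewrite -(acE e) -proj_act. Qed.
Lemma ac1 p m : m = anchor P p -> ac p (one G m) = p.
Proof.
by move=> ->; have e := esym (tgt_one G (anchor P p)); rewrite -(acE e) act_one.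
Qed.
Lemma acM p g h : anchor P p = tgt g -> src g = tgt h ->
  ac (ac p g) h = ac p (gm g h).
Proof.
move=> e1 e2.
have e3 : anchor P (act P (fpair e1)) = tgt h by rewrite anchor_act.
have e4 : anchor P p = tgt (mul (fpair e2)) by rewrite tgt_mul.
rewrite -(acE e1) -(gmE e2) -(acE e3) -(acE e4); exact: act_mul.
Qed.
Lemma acK p g : anchor P p = tgt g -> ac (ac p g) (inv g) = p.
Proof. by move=> e; rewrite acM ?tgt_inv// gmgV ac1. Qed.
Lemma cont_ac (X : topologicalType) (u : X -> tot P) (v : X -> arr G) :
  (forall x, anchor P (u x) = tgt (v x)) -> continuous u -> continuous v ->
  continuous (fun x => ac (u x) (v x)).
Proof.
move=> e cu cv.
have -> : (fun x => ac (u x) (v x)) = act P \o (fun x => fpair (e x)).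
  by apply/funext => x /=; rewrite acE.
by apply: cont_comp; [exact: cont_fpair|exact: act_cont].
Qed.
Lemma ac_inj p g h : anchor P p = tgt g -> anchor P p = tgt h ->
  ac p g = ac p h -> g = h.
Proof.
move=> e1 e2 e; have [_ [k [_ K _]]] := shear_homeo P.
have := can_inj K (x1 := fpair e1) (x2 := fpair e2).
move=> /(_ _)/(congr1 (@fp2 _ _ _ _ _)); apply.
by apply: fprod_eq => //=; rewrite !fpairE !acE.
Qed.
Lemma division : exists dv : fprod (proj P) (proj P) -> arr G,
  [/\ continuous dv, forall z, anchor P (fp1 z) = tgt (dv z) &
      forall z, ac (fp1 z) (dv z) = fp2 z].
Proof.
have [_ [k [ck _ K]]] := shear_homeo P.
have K1 z : fp1 (k z) = fp1 z by rewrite -{2}(K z).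
have K2 z : act P (k z) = fp2 z by rewrite -{2}(K z).
exists (@fp2 _ _ _ _ _ \o k); split.
- by apply: cont_comp => //; exact: cont_fp2.
- by move=> z /=; rewrite -K1 fpE.
- by move=> z /=; rewrite -K2 acE' K1.
Qed.

End BundleTheory.

Section Bibundle.
Context {M M' : topologicalType} {G : groupoid M} {H : groupoid M'}.
Variable phi : gmor G H.

Definition bib : topologicalType := fprod (gm0 phi) (@tgt M' H).

Lemma lact_comp g (q : bib) :
  src g = fp1 q -> src (gm1 phi g) = tgt (fp2 q).
Proof. by move=> e; rewrite gm_src e fpE. Qed.

Lemma lact_mem g (q : bib) (e : src g = fp1 q) :
  gm0 phi (tgt g) = tgt (mul (fpair (lact_comp e))).
Proof. by rewrite tgt_mul gm_tgt. Qed.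

Definition lact g (q : bib) (e : src g = fp1 q) : bib := fpair (lact_mem e).

Lemma ract_mem (q : bib) (d : arr H) (e : src (fp2 q) = tgt d) :
  gm0 phi (fp1 q) = tgt (mul (fpair e)).
Proof. by rewrite tgt_mul fpE. Qed.

Definition ract (q : bib) (d : arr H) (e : src (fp2 q) = tgt d) : bib :=
  fpair (ract_mem e).

Section Associated.
Context {N : topologicalType}.
Variable P : principal_bundle G N.

Definition assoc_pre : topologicalType := fprod (anchor P) (@fp1 _ _ _ _ _ : bib -> M).

(* [x] and [y] are in the same orbit of the action
   [g . (p, q) = (p . g, g^-1 . q)]. *)
Definition assoc_rel (x y : assoc_pre) : Prop :=
  exists g (e1 : anchor P (fp1 x) = tgt g) (e2 : src (inv g) = fp1 (fp2 x)),
    fp1 y = act P (fpair e1) /\ fp2 y = lact e2.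

Implicit Types x : assoc_pre.
Definition dl x : arr H := fp2 (fp2 x).

Lemma pre_eq x y : fp1 x = fp1 y -> dl x = dl y -> x = y.
Proof.
move=> e1 e2; apply: fprod_eq => //; apply: fprod_eq => //.
by rewrite -!fpE e1.
Qed.

Lemma tgt_dl x : tgt (dl x) = gm0 phi (anchor P (fp1 x)).
Proof. by rewrite (fpE x) (fpE (fp2 x)). Qed.

Definition pre_mk p d (e : tgt d = gm0 phi (anchor P p)) : assoc_pre :=
  @fpair _ _ _ (anchor P) (@fp1 _ _ _ _ _ : bib -> M) p
    (@fpair _ _ _ (gm0 phi) (@tgt M' H) (anchor P p) d (esym e)) erefl.

Lemma pre_mk1 p d (e : tgt d = gm0 phi (anchor P p)) : fp1 (pre_mk e) = p.
Proof. by []. Qed.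
Lemma pre_mk2 p d (e : tgt d = gm0 phi (anchor P p)) : dl (pre_mk e) = d.
Proof. by []. Qed.

Lemma cont_dl : continuous dl.
Proof. exact: (cont_comp (@cont_fp2 _ _ _ _ _) (@cont_fp2 _ _ _ _ _)). Qed.

Lemma cont_pre_mk (X : topologicalType) (p : X -> tot P) (d : X -> arr H)
  (e : forall w, tgt (d w) = gm0 phi (anchor P (p w))) :
  continuous p -> continuous d -> continuous (fun w => pre_mk (e w)).
Proof.
move=> cp cd; apply: cont_fpair => //; apply: cont_fpair => //.
by apply: (cont_comp cp); exact: anchor_cont.
Qed.

Lemma gm1K g (d : arr H) : tgt d = gm0 phi (src g) ->
  gm (gm1 phi (inv g)) (gm (gm1 phi g) d) = d.
Proof.
move=> e.
have e1 : src (gm1 phi (inv g)) = tgt (gm1 phi g) by rewrite gm_src gm_tgt src_inv.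
have e2 : src (gm1 phi g) = tgt d by rewrite gm_src e.
rewrite gmA//.
by rewrite -gm1_gm ?src_inv// gmVg gm_one gm1g.
Qed.
Lemma gm1KV g (d : arr H) : tgt d = gm0 phi (tgt g) ->
  gm (gm1 phi g) (gm (gm1 phi (inv g)) d) = d.
Proof.
move=> e.
have e1 : src (gm1 phi g) = tgt (gm1 phi (inv g)) by rewrite gm_src gm_tgt tgt_inv.
have e2 : src (gm1 phi (inv g)) = tgt d by rewrite gm_src e src_inv.
rewrite gmA//.
by rewrite -gm1_gm ?tgt_inv// gmgV gm_one gm1g.
Qed.

Lemma relP x y : assoc_rel x y <-> exists g, [/\ anchor P (fp1 x) = tgt g,
  fp1 y = ac (fp1 x) g & dl x = gm (gm1 phi g) (dl y)].
Proof.
split=> [[g [e1 [e2 [ey1 ey2]]]]|[g [e1 ey1 ed]]]; exists g.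
  split=> //; first by rewrite ey1 acE.
  rewrite /dl ey2 fpairE gmE gm1KV//.
  by rewrite -[fp2 _]/(dl x) tgt_dl e1.
have e2 : src (inv g) = fp1 (fp2 x) by rewrite src_inv -e1 fpE.
exists e1, e2; rewrite acE; split => //; apply: fprod_eq; rewrite fpairE.
  by rewrite -fpE ey1 anchor_ac// tgt_inv.
by rewrite gmE -[fp2 (fp2 y)]/(dl y) -[fp2 (fp2 x)]/(dl x) ed gm1K// tgt_dl ey1 anchor_ac.
Qed.

Lemma rel_refl x : assoc_rel x x.
Proof.
apply/relP; exists (one G (anchor P (fp1 x))); split.
- by rewrite tgt_one.
- by rewrite ac1.
- by rewrite gm_one gm1g// tgt_dl.
Qed.
Lemma rel_sym x y : assoc_rel x y -> assoc_rel y x.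
Proof.
move=> /relP[g [e1 e2 e3]]; apply/relP; exists (inv g); split.
- by rewrite tgt_inv e2 anchor_ac.
- by rewrite e2 acK.
- by rewrite e3 gm1K// tgt_dl e2 anchor_ac.
Qed.
Lemma rel_trans x y z : assoc_rel x y -> assoc_rel y z -> assoc_rel x z.
Proof.
move=> /relP[g [e1 e2 e3]] /relP[h [f1 f2 f3]]; apply/relP.
have gh : src g = tgt h by rewrite -f1 e2 anchor_ac.
exists (gm g h); split.
- by rewrite tgt_gm.
- by rewrite f2 e2 acM.
- rewrite e3 f3 gm1_gm// gmA// gm_src ?gm_tgt ?gh//.
  by rewrite tgt_dl f2 anchor_ac.
Qed.

Definition assoc_relb x y : bool := `[< assoc_rel x y >].
Definition assoc_equiv_rel := EquivRel assoc_relb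
  (fun x => asboolT (rel_refl x))
  (fun x y => asbool_equiv_eq (conj (@rel_sym x y) (@rel_sym y x)))
  (fun y x z (e : assoc_relb x y) (e' : assoc_relb y z) =>
     asboolT (rel_trans (asboolW e) (asboolW e'))).

Definition assoc_tot : topologicalType :=
  quotient_topology {eq_quot assoc_equiv_rel}%qT.
Definition assoc_pi : assoc_pre -> assoc_tot :=
  \pi_(quotient_topology {eq_quot assoc_equiv_rel})%qT.
Definition assoc_repr : assoc_tot -> assoc_pre :=
  fun w => repr (w : {eq_quot assoc_equiv_rel}%qT).

Lemma assoc_reprK (w : assoc_tot) : assoc_pi (assoc_repr w) = w.
Proof. exact: reprK. Qed.
Lemma assoc_piP x y : assoc_pi x = assoc_pi y <-> assoc_rel x y.
Proof.
have := @eqmodP _ assoc_equiv_rel x y.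
by move=> h; split => [/h/asboolP//|/asboolP/h].
Qed.
Lemma cont_pi : continuous assoc_pi.
Proof. exact: pi_continuous. Qed.
Lemma pi_quotient (U : set assoc_tot) : open (assoc_pi @^-1` U) -> open U.
Proof. by []. Qed.

Lemma lift_pi (Z : Type) (f : assoc_pre -> Z) :
  (forall x y, assoc_rel x y -> f x = f y) ->
  (f \o assoc_repr) \o assoc_pi = f.
Proof.
by move=> h; apply/funext => x /=; apply/h/assoc_piP; rewrite assoc_reprK.
Qed.
Lemma lift_cont (Z : topologicalType) (f : assoc_pre -> Z) :
  (forall x y, assoc_rel x y -> f x = f y) -> continuous f ->
  continuous (f \o assoc_repr).
Proof. by move=> h cf; apply/quotient_continuous; rewrite [X in continuous X](lift_pi h). Qed.

Definition assoc_anchor : assoc_tot -> M' :=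
  (fun x => src (dl x)) \o assoc_repr.
Definition assoc_proj : assoc_tot -> N :=
  (fun x => proj P (fp1 x)) \o assoc_repr.

Lemma anchor_rel x y : assoc_rel x y -> src (dl x) = src (dl y).
Proof.
move=> /relP[g [e1 e2 ->]]; rewrite src_gm// gm_src tgt_dl e2 anchor_ac//.
Qed.
Lemma proj_rel x y : assoc_rel x y -> proj P (fp1 x) = proj P (fp1 y).
Proof. by move=> /relP[g [e1 -> _]]; rewrite proj_ac. Qed.

Lemma assoc_anchor_pi x : assoc_anchor (assoc_pi x) = src (dl x).
Proof. by rewrite -[LHS]/((assoc_anchor \o assoc_pi) x) (lift_pi anchor_rel). Qed.
Lemma assoc_proj_pi x : assoc_proj (assoc_pi x) = proj P (fp1 x).
Proof. by rewrite -[LHS]/((assoc_proj \o assoc_pi) x) (lift_pi proj_rel). Qed.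
Lemma assoc_anchor_cont : continuous assoc_anchor.
Proof.
by apply: lift_cont; [exact: anchor_rel|exact: (cont_comp cont_dl (@src_cont _ H))].
Qed.
Lemma assoc_proj_cont : continuous assoc_proj.
Proof.
apply: lift_cont; first exact: proj_rel.
exact: (cont_comp (@cont_fp1 _ _ _ _ _) (proj_sections P).1).
Qed.

Lemma pre_act_comp x d (e : src (dl x) = tgt d) :
  anchor P (fp1 x) = fp1 (ract e).
Proof. by rewrite fpE. Qed.
Definition pre_act x d (e : src (dl x) = tgt d) : assoc_pre :=
  fpair (pre_act_comp e).

Lemma pre_act1 x d (e : src (dl x) = tgt d) : fp1 (pre_act e) = fp1 x.
Proof. by []. Qed.
Lemma pre_act2 x d (e : src (dl x) = tgt d) : dl (pre_act e) = gm (dl x) d.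
Proof. by rewrite /dl !fpairE gmE. Qed.

Lemma pre_act_rel x y d (e : src (dl x) = tgt d) (e' : src (dl y) = tgt d) :
  assoc_rel x y -> assoc_rel (pre_act e) (pre_act e').
Proof.
move=> /relP[g [e1 e2 e3]]; apply/relP; exists g; split=> //.
rewrite !pre_act2 e3 gmA// gm_src tgt_dl e2 anchor_ac//.
Qed.

Definition assoc_act (z : fprod assoc_anchor (@tgt M' H)) : assoc_tot :=
  assoc_pi (@pre_act (assoc_repr (fp1 z)) (fp2 z) (fpE z)).

Lemma assoc_act_pi x d (e : assoc_anchor (assoc_pi x) = tgt d)
  (e' : src (dl x) = tgt d) : assoc_act (fpair e) = assoc_pi (pre_act e').
Proof.
by apply/assoc_piP/pre_act_rel/assoc_piP; rewrite assoc_reprK.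
Qed.

Lemma pi_sections : local_sections assoc_pi.
Proof.
apply: local_sectionsP; first exact: cont_pi.
move=> w0; have [V [oV Vy] [s [cs es]]] :=
  local_sections_at (assoc_proj w0) (proj_sections P).
have [dv [cdv dv1 dv2]] := division P.
have oV' : open (assoc_proj @^-1` V).
  by have /continuousP := assoc_proj_cont; exact.
exists (assoc_proj @^-1` V); first by split.
(* normal form of a point of [assoc_pre] over [V] *)
have vP x (h : x \in (assoc_pi @^-1` (assoc_proj @^-1` V))) :
    proj P (fp1 x) \in V.
  by rewrite -assoc_proj_pi; apply/mem_set; exact: set_mem h.
pose v x h : set_type V := exist _ (proj P (fp1 x)) (@vP x h).
have ev x h : proj P (s (@v x h)) = proj P (fp1 x) by rewrite es.
pose g x h : arr G := dv (fpair (@ev x h)).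
have g1 x h : anchor P (s (@v x h)) = tgt (g x h).
  by rewrite /g -dv1 fpairE.
have g2 x h : ac (s (@v x h)) (g x h) = fp1 x.
  by rewrite /g -[in RHS](@fp2_pair _ _ _ _ _ _ _ (@ev x h)) -dv2 fpairE.
have g3 x h : src (g x h) = anchor P (fp1 x).
  by rewrite -(g2 x h) anchor_ac.
have g4 x h : src (gm1 phi (g x h)) = tgt (dl x) by rewrite gm_src g3 tgt_dl.
have g5 x h : tgt (gm (gm1 phi (g x h)) (dl x)) = gm0 phi (anchor P (s (@v x h))).
  by rewrite tgt_gm// gm_tgt g1.
pose nf x h : assoc_pre := pre_mk (@g5 x h).
have nfE x h : assoc_rel (nf x h) x.
  by apply/relP; exists (g x h); split; rewrite ?pre_mk1 ?pre_mk2 ?g2.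
have nf_rel x x' h h' : assoc_rel x x' -> nf x h = nf x' h'.
  move=> r.
  have vv : v x h = v x' h' by apply: val_inj => /=; exact: proj_rel.
  have : assoc_rel (nf x h) (nf x' h').
    by apply: rel_trans (nfE x h) (rel_trans r _); exact: rel_sym.
  move=> /relP[k []]; rewrite !pre_mk1 !pre_mk2 -vv => k1 k2 k3.
  have ek : k = one G (anchor P (s (v x h))).
    by apply: (@ac_inj _ _ _ P (s (v x h))); rewrite ?tgt_one// ac1.
  apply: pre_eq; rewrite ?pre_mk1 ?pre_mk2 ?vv// k3 ek gm_one gm1g//.
  by rewrite g5 vv.
have hr (w : set_type (assoc_proj @^-1` V)) :
    assoc_repr (\val w) \in assoc_pi @^-1` (assoc_proj @^-1` V).
  by apply/mem_set => /=; rewrite assoc_reprK; exact: set_mem (valP w).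
exists (fun w => nf (assoc_repr (\val w)) (hr w)); split; last first.
  by move=> w; rewrite -[RHS]assoc_reprK; apply/assoc_piP.
apply: (@quotient_restrict _ _ _ assoc_pi).
- exact: pi_quotient.
- by have /continuousP := cont_pi; exact.
have -> : (fun w : set_type (assoc_pi @^-1` (assoc_proj @^-1` V)) =>
    nf _ (hr (exist _ (assoc_pi (\val w)) (mem_set (set_mem (valP w)))))) =
    fun w => nf (\val w) (valP w).
  by apply/funext => w; apply: nf_rel; apply/assoc_piP; rewrite assoc_reprK.
have cv : continuous
    (fun w : set_type (assoc_pi @^-1` (assoc_proj @^-1` V)) => v (\val w) (valP w)).
  apply: cont_into_sub => /=.
  exact: (cont_comp (@cont_val _ _) (cont_comp (@cont_fp1 _ _ _ _ _) (proj_sections P).1)).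
apply: cont_pre_mk; first exact: cont_comp cv cs.
apply: cont_gm => //; last exact: cont_comp (@cont_val _ _) cont_dl.
apply: cont_comp (@gm1_cont _ _ _ _ phi).
apply: cont_comp cdv; apply: cont_fpair; first exact: cont_comp cv cs.
exact: cont_comp (@cont_val _ _) (@cont_fp1 _ _ _ _ _).
Qed.

Lemma cont_pre_act (X : topologicalType) (u : X -> assoc_pre) (d : X -> arr H)
  (e : forall w, src (dl (u w)) = tgt (d w)) :
  continuous u -> continuous d -> continuous (fun w => pre_act (e w)).
Proof.
move=> cu cd; apply: cont_fpair; first exact: (cont_comp cu (@cont_fp1 _ _ _ _ _)).
apply: cont_fpair.
  exact: (cont_comp (cont_comp cu (@cont_fp2 _ _ _ _ _)) (@cont_fp1 _ _ _ _ _)).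
apply: (cont_comp _ (@mul_cont _ H)); apply: cont_fpair => //.
exact: (cont_comp cu cont_dl).
Qed.

Lemma assoc_piW (w : assoc_tot) : exists x, w = assoc_pi x.
Proof. by exists (assoc_repr w); rewrite assoc_reprK. Qed.

Lemma assoc_act_cont : continuous assoc_act.
Proof.
apply: (local_sections_descend
  (q := @fprod_map _ _ _ _ _ assoc_pi id assoc_anchor (@tgt M' H))).
  by apply: fprod_map_sections; [exact: pi_sections|exact: local_sections_id].
have e (z : fprod (assoc_anchor \o assoc_pi) (@tgt M' H \o id)) :
    src (dl (fp1 z)) = tgt (fp2 z).
  by rewrite -assoc_anchor_pi; exact: (fpE z).
have -> : assoc_act \o
    @fprod_map _ _ _ _ _ assoc_pi id assoc_anchor (@tgt M' H) =
    fun z => assoc_pi (pre_act (e z)).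
  by apply/funext => z; exact: assoc_act_pi.
apply: cont_comp cont_pi; apply: cont_pre_act; first exact: cont_fp1.
exact: cont_fp2.
Qed.

Lemma assoc_anchor_act z' : assoc_anchor (assoc_act z') = src (fp2 z').
Proof.
rewrite assoc_anchor_pi pre_act2 src_gm//.
exact: (fpE z').
Qed.

Lemma assoc_act_one p (e : assoc_anchor p = tgt (one H (assoc_anchor p))) :
  assoc_act (fpair e) = p.
Proof.
have [x ep] := assoc_piW p; move: e; rewrite ep => e.
have e' : src (dl x) = tgt (one H (assoc_anchor (assoc_pi x))).
  by rewrite tgt_one assoc_anchor_pi.
rewrite (assoc_act_pi e e'); congr assoc_pi; apply: pre_eq => //.
by rewrite pre_act2 gmg1// assoc_anchor_pi.
Qed.

Lemma assoc_act_mul p g h (e1 : assoc_anchor p = tgt g) (e2 : src g = tgt h)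
  (e3 : assoc_anchor (assoc_act (fpair e1)) = tgt h)
  (e4 : assoc_anchor p = tgt (mul (fpair e2))) :
  assoc_act (fpair e3) = assoc_act (fpair e4).
Proof.
have [x ep] := assoc_piW p; move: e1 e3 e4; rewrite ep => e1.
have f1 : src (dl x) = tgt g by rewrite -assoc_anchor_pi.
rewrite (assoc_act_pi e1 f1) => e3 e4.
have f3 : src (dl (pre_act f1)) = tgt h by rewrite -assoc_anchor_pi.
have f4 : src (dl x) = tgt (mul (fpair e2)) by rewrite -assoc_anchor_pi.
rewrite (assoc_act_pi e3 f3) (assoc_act_pi e4 f4); congr assoc_pi.
by apply: pre_eq => //; rewrite !pre_act2 gmE gmA.
Qed.

Lemma assoc_proj_act z' : assoc_proj (fp1 z') = assoc_proj (assoc_act z').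
Proof. by rewrite assoc_proj_pi. Qed.

Lemma assoc_proj_sections : local_sections assoc_proj.
Proof.
apply: local_sectionsP; first exact: assoc_proj_cont.
move=> n; have [V oV [s [cs es]]] := local_sections_at n (proj_sections P).
exists V => //.
have e w : tgt (one H (gm0 phi (anchor P (s w)))) = gm0 phi (anchor P (s w)).
  by rewrite tgt_one.
exists (fun w => assoc_pi (pre_mk (e w))); split; last first.
  by move=> w; rewrite assoc_proj_pi pre_mk1.
apply: cont_comp cont_pi; apply: cont_pre_mk => //.
apply: (cont_comp _ (@one_cont _ H)).
apply: (cont_comp _ (@gm0_cont _ _ _ _ phi)).
by apply: cont_comp cs _; exact: anchor_cont.
Qed.

Lemma assoc_free x d d' (e : src (dl x) = tgt d) (e' : src (dl x) = tgt d') :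
  assoc_pi (pre_act e) = assoc_pi (pre_act e') -> d = d'.
Proof.
move=> /assoc_piP/relP[k []]; rewrite !pre_act1 !pre_act2 => k1 k2.
have -> : k = one G (anchor P (fp1 x)).
  by apply: (@ac_inj _ _ _ P (fp1 x)); rewrite ?tgt_one// ac1.
rewrite gm_one gm1g; last by rewrite tgt_gm// tgt_dl.
by move=> /(congr1 (gm (inv (dl x)))); rewrite !gmK.
Qed.

Lemma assoc_shear : homeomorphism (fun z' => fpair (assoc_proj_act z')).
Proof.
split.
  by apply: cont_fpair; [exact: cont_fp1|exact: assoc_act_cont].
have [dv [cdv dv1 dv2]] := division P.
pose Z := fprod (assoc_proj \o assoc_pi) (assoc_proj \o assoc_pi).
have ez (z : Z) : proj P (fp1 (fp1 z)) = proj P (fp1 (fp2 z)).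
  by rewrite -!assoc_proj_pi; exact: (fpE z).
pose g (z : Z) : arr G := dv (fpair (ez z)).
have g1 (z : Z) : anchor P (fp1 (fp1 z)) = tgt (g z) by rewrite /g -dv1 fpairE.
have g2 (z : Z) : ac (fp1 (fp1 z)) (g z) = fp1 (fp2 z).
  by rewrite /g -[RHS](@fp2_pair _ _ _ _ _ _ _ (ez z)) -dv2 fpairE.
have h1 (z : Z) : src (gm1 phi (g z)) = tgt (dl (fp2 z)).
  by rewrite gm_src tgt_dl -g2 anchor_ac.
have h2 (z : Z) : tgt (dl (fp1 z)) = tgt (gm (gm1 phi (g z)) (dl (fp2 z))).
  by rewrite tgt_gm// gm_tgt -g1 tgt_dl.
pose d (z : Z) := gm (inv (dl (fp1 z))) (gm (gm1 phi (g z)) (dl (fp2 z))).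
have d1 (z : Z) : src (dl (fp1 z)) = tgt (d z).
  by rewrite /d tgt_gm ?tgt_inv// src_inv.
have d2 (z : Z) : assoc_pi (pre_act (d1 z)) = assoc_pi (fp2 z).
  apply/assoc_piP/relP; exists (g z); split; rewrite ?pre_act1//.
  by rewrite pre_act2 /d gmKV.
have d3 (z : Z) : assoc_anchor (assoc_pi (fp1 z)) = tgt (d z).
  by rewrite assoc_anchor_pi.
have cd : continuous d.
  have c1 : continuous (fun z : Z => dl (fp1 z)).
    exact: cont_comp (@cont_fp1 _ _ _ _ _) cont_dl.
  have c2 : continuous (fun z : Z => dl (fp2 z)).
    exact: cont_comp (@cont_fp2 _ _ _ _ _) cont_dl.
  apply: cont_gm.
  - by move=> z; rewrite src_inv h2.
  - exact: cont_comp c1 (@inv_cont _ H).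
  apply: cont_gm => //.
  apply: cont_comp (@gm1_cont _ _ _ _ phi).
  apply: cont_comp cdv; apply: cont_fpair.
  - exact: cont_comp (@cont_fp1 _ _ _ _ _) (@cont_fp1 _ _ _ _ _).
  - exact: cont_comp (@cont_fp2 _ _ _ _ _) (@cont_fp1 _ _ _ _ _).
pose sh := fun z' => fpair (assoc_proj_act z').
pose q := @fprod_map _ _ _ _ _ assoc_pi assoc_pi assoc_proj assoc_proj.
have shd (z : Z) : sh (fpair (d3 z)) = q z.
  by apply: fprod_eq; rewrite /sh/q/fprod_map fpairE// (assoc_act_pi _ (d1 z)) d2.
have sh_inj : injective sh.
  move=> a b ab.
  have e1 : fp1 a = fp1 b by have := congr1 (@fp1 _ _ _ _ _) ab.
  have e2 : assoc_act a = assoc_act b by have := congr1 (@fp2 _ _ _ _ _) ab.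
  apply: fprod_eq => //.
  move: e2; rewrite -(fpair_eta (fpE a)) -(fpair_eta (fpE b)) !fpairE.
  move: (fpE a) (fpE b); rewrite e1; have [x ->] := assoc_piW (fp1 b) => ea eb.
  have ea' : src (dl x) = tgt (fp2 a) by rewrite -assoc_anchor_pi.
  have eb' : src (dl x) = tgt (fp2 b) by rewrite -assoc_anchor_pi.
  by rewrite (assoc_act_pi _ ea') (assoc_act_pi _ eb') => /assoc_free.
have q_surj y : exists z, q z = y.
  have [x1 e1] := assoc_piW (fp1 y); have [x2 e2] := assoc_piW (fp2 y).
  have e : (assoc_proj \o assoc_pi) x1 = (assoc_proj \o assoc_pi) x2.
    by rewrite /= -e1 -e2 fpE.
  by exists (fpair e); apply: fprod_eq.
have sh_surj y : exists a, sh a = y.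
  by have [z <-] := q_surj y; exists (fpair (d3 z)).
pose k y := sval (cid (sh_surj y)).
have shk : cancel k sh by move=> y; exact: svalP (cid (sh_surj y)).
exists k; split => //; last by apply: inj_can_sym.
apply: (local_sections_descend (q := q)).
  by apply: fprod_map_sections; exact: pi_sections.
have -> : k \o q = fun z => fpair (d3 z).
  by apply/funext => z; apply: sh_inj; rewrite /= shk shd.
apply: cont_fpair => //.
exact: cont_comp (@cont_fp1 _ _ _ _ _) cont_pi.
Qed.

Definition assoc_bundle : principal_bundle H N :=
  @PrincipalBundle M' H N assoc_tot assoc_anchor assoc_act assoc_proj
    assoc_anchor_cont assoc_act_cont assoc_anchor_act assoc_act_one
    assoc_act_mul assoc_proj_sections assoc_proj_act assoc_shear.

End Associated.

Section AssociatedMor.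
Context {N N' : topologicalType}.
Variables (P : principal_bundle G N) (P' : principal_bundle G N').
Variable u : bundle_mor P P'.

Lemma pre_mor_mem (x : assoc_pre P) :
  anchor P' (bm_tot u (fp1 x)) = fp1 (fp2 x).
Proof. by rewrite bm_anchor fpE. Qed.

Definition pre_mor (x : assoc_pre P) : assoc_pre P' := fpair (pre_mor_mem x).

Lemma bm_ac p g : anchor P p = tgt g -> bm_tot u (ac p g) = ac (bm_tot u p) g.
Proof.
move=> e; have e' : anchor P' (bm_tot u p) = tgt g by rewrite bm_anchor.
by rewrite -(acE e) -(acE e') (bm_act (x := fpair e) e').
Qed.

Lemma pre_mor_rel x y : assoc_rel x y -> assoc_rel (pre_mor x) (pre_mor y).
Proof.
move=> /relP[g [e1 e2 e3]]; apply/relP; exists g; split => //=.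
- by rewrite fpairE bm_anchor.
- by rewrite /pre_mor !fpairE e2 bm_ac.
Qed.

Definition assoc_mor_tot : assoc_tot P -> assoc_tot P' :=
  (fun x => assoc_pi (pre_mor x)) \o @assoc_repr N P.

Lemma assoc_mor_pi x : assoc_mor_tot (assoc_pi x) = assoc_pi (pre_mor x).
Proof.
apply/assoc_piP/pre_mor_rel/assoc_piP; exact: assoc_reprK.
Qed.

Lemma assoc_mor_act (z : fprod (@assoc_anchor _ P) (@tgt M' H))
  (e : assoc_anchor (assoc_mor_tot (fp1 z)) = tgt (fp2 z)) :
  assoc_mor_tot (assoc_act z) = assoc_act (fpair e).
Proof.
rewrite -[in LHS](fpair_eta (fpE z)).
move: (fpE z) e; have [x ->] := assoc_piW (fp1 z) => ez.
rewrite assoc_mor_pi => e.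
have e1 : src (dl x) = tgt (fp2 z) by rewrite -assoc_anchor_pi.
have e2 : src (dl (pre_mor x)) = tgt (fp2 z) by rewrite -assoc_anchor_pi.
rewrite (assoc_act_pi _ e1) (assoc_act_pi _ e2) assoc_mor_pi.
congr assoc_pi; apply: pre_eq => //.
by rewrite pre_act2 -[LHS]/(dl (pre_act e1)) pre_act2.
Qed.

Definition assoc_mor : bundle_mor (assoc_bundle P) (assoc_bundle P').
Proof.
refine (@BundleMor M' H N N' (assoc_bundle P) (assoc_bundle P') assoc_mor_tot
  (bm_base u) _ (@bm_base_cont _ _ _ _ _ _ u) _ _ _).
- apply: lift_cont; first by move=> x y r; apply/assoc_piP; exact: pre_mor_rel.
  apply: cont_comp (@cont_pi _ _); apply: cont_fpair; last exact: cont_fp2.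
  exact: cont_comp (@cont_fp1 _ _ _ _ _) (@bm_tot_cont _ _ _ _ _ _ u).
- move=> p; have [x ->] := assoc_piW p.
  by rewrite assoc_mor_pi /= !assoc_proj_pi /pre_mor fpairE bm_proj.
- move=> p; have [x ->] := assoc_piW p.
  by rewrite assoc_mor_pi /= !assoc_anchor_pi.
- move=> z e; exact: assoc_mor_act.
Defined.

End AssociatedMor.

Definition assoc_functor : functor (B G) (B H).
Proof.
refine (@Functor (B G) (B H) (@assoc_bundle) (@assoc_mor) _ _ _) => //.
- move=> X P; apply: bundle_mor_eq => // p /=.
  have [x ->] := assoc_piW p; rewrite assoc_mor_pi.
  by congr assoc_pi; apply: pre_eq.
- move=> X Y Z P1 P2 P3 v u; apply: bundle_mor_eq => // p /=.
  have [x ->] := assoc_piW p; rewrite !assoc_mor_pi.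
  by congr assoc_pi; apply: pre_eq.
Defined.

End Bibundle.

Definition topological_stack (D : over_top) : Prop :=
  is_stack D /\ exists (M : topologicalType) (G : groupoid M), equivalent (B G) D.

Definition induces (E : extension) (D C : over_top) (F : functor D C) : Prop :=
  exists (eD : functor (B (ext_dom E)) D) (eC : functor (B (ext_cod E)) C),
    [/\ equivalence eD, equivalence eC &
        iso2 (fcomp F eD) (fcomp eC (assoc_functor (ext_mor E)))].

(* Main.v *)
From mathcomp Require Import all_boot all_classical.
From mathcomp Require Import topology.
Require Import Defs.

Set Implicit Arguments.
Unset Strict Implicit.
Unset Printing Implicit Defensive.

Local Open Scope classical_set_scope.

(** The proof takes place in the total category of a stack [C], whose arrows
    lie over arbitrary continuous maps. There a categorical product of [x] and
    [y] ([product]) lies over the space of isomorphisms between the pullbacks of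
    [x] and [y], that is, over the 2-fiber product of the two bases over [C].
    Groupoids, bundles and maps between them are all built from such products;
    their structure maps are bases of arrows, hence continuous, and identities
    between points are checked on arrows over a one-point space.

    The classifying stack of [G] has products: the fiber product of two bundles
    over the objects of [G], as a bundle over its orbit space
    ([bundle_product]). Since products transport along equivalences, all
    topological stacks have them. For an object [c] to which every object maps
    locally (an [atlas]), the automorphisms of [c] form a topological groupoid
    [aut], and [y |-> iso c y] is an equivalence from [C] to its classifying
    stack: it is fully faithful because arrows descend along maps of local
    sections ([descend_arrow], [classify_ff]), and essentially surjective because
    objects do ([descend_object], [classify_es]).

    Existence: let [d] be an atlas of [D]. As [F] is an epimorphism, [F d] is an
    atlas of [C]. The functor [F] maps automorphisms of [d] to automorphisms
    of [F d], and this map has local sections because lifting an automorphism of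
    [F d] amounts to lifting an object along the diagonal of [F]
    ([gerbe_sections]). Under the two equivalences [F] becomes the morphism
    associated with this extension: a point of the associated bundle is a class
    of pairs [(p, h)], which corresponds to [F p . h] ([compare_iso2]).

    Uniqueness: an extension inducing [F] is that of the automorphisms of [d]
    and [F d], where [d] is the image of the universal bundle
    ([induces_presents]). For two such objects [d] and [d'], the product of [d]
    and [d'] has arrows to both, over maps of local sections. An arrow over a
    map of local sections yields a Morita morphism between automorphism groupoids
    ([pmor_id_morita]), so the extension attached to the product maps to both. *)

(** * Continuity and open covers *)

Lemma cont_local (X Y : topologicalType) (c : open_cover X) (f : X -> Y) :
  (forall i : idx c, continuous (f \o incl (i := i))) -> continuous f.
Proof.
move=> cf x; have [i ix] := piece_cover c x.
move=> A nA; have := cf i (exist _ x (mem_set ix)) A nA.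
rewrite nbhsE => -[W [[U oU <-] Ux] WA].
rewrite nbhsE; exists (U `&` piece_set i).
  by split; [exact: openI oU (piece_open i)|split].
by move=> z [Uz iz]; exact: (WA (exist _ z (mem_set iz)) Uz).
Qed.

Section PullCover.
Variables (X Y : topologicalType) (f : X -> Y) (cf : continuous f).
Variable c : open_cover Y.

Definition pull_cover : open_cover X.
Proof.
refine (@OpenCover X (idx c) (fun i => f @^-1` piece_set i) _ _).
- by move=> i; move/continuousP: cf; apply; exact: piece_open.
- by move=> x; exact: piece_cover.
Defined.

Definition pull_piece (i : idx pull_cover) : @piece X pull_cover i -> @piece Y c i :=
  fun x => exist _ (f (\val x)) (mem_set (set_mem (valP x))).

Lemma pull_piece_cont i : continuous (pull_piece (i := i)).
Proof. by apply: cont_into_sub; exact: cont_comp (@cont_val _ _) cf. Qed.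

End PullCover.

(** Points of spaces are named by arrows over a one-point space; taking the
    singleton of [a] for that space makes its inclusion a restriction map. *)
Definition one_point (X : topologicalType) (a : X) : topologicalType := set_type [set a].

Definition the_point (X : topologicalType) (a : X) : one_point a :=
  exist _ a (mem_set (erefl a)).

Lemma point_val (X : topologicalType) (a : X) :
  (fun t : one_point a => \val t) = cst a.
Proof. by apply/funext => t; exact: (set_mem (valP t)). Qed.

Lemma cont_cst (X Y : topologicalType) (a : Y) : continuous (cst a : X -> Y).
Proof. by move=> x; exact: cvg_cst. Qed.

(** * Categories fibered in groupoids *)

Definition invertible (C : over_top) (X Y : topologicalType) (x : Ob C X)
    (y : Ob C Y) (u : Hom x y) : Prop :=
  exists v : Hom y x, comp v u = idm x /\ comp u v = idm y.

Section Fibered.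
Variable C : over_top.
Hypothesis fC : fibered_in_groupoids C.

Lemma cart (X Y Z : topologicalType) (x : Ob C X) (y : Ob C Y) (z : Ob C Z)
    (v : Hom y z) (w : Hom x z) (f : X -> Y) :
  continuous f -> base v \o f = base w ->
  exists u : Hom x y, base u = f /\ comp v u = w.
Proof. by move=> cf e; have [u []] := fC.2 _ _ _ _ _ _ v w f cf e; exists u. Qed.

Lemma cart_uniq (X Y Z : topologicalType) (x : Ob C X) (y : Ob C Y)
    (z : Ob C Z) (v : Hom y z) (u u' : Hom x y) :
  base u = base u' -> comp v u = comp v u' -> u = u'.
Proof.
move=> eb ec.
have [|w [_ uw]] := fC.2 _ _ _ _ _ _ v (comp v u) _ (base_cont (u := u)).
  by rewrite base_comp.
by rewrite -(uw u) // -(uw u') // eb ec.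
Qed.

Lemma lift_point (X : topologicalType) (x : Ob C X) (a : X) :
  exists (t : Ob C (one_point a)) (u : Hom t x), base u = cst a.
Proof.
have [t [u eu]] := fC.1 _ _ (fun t : one_point a => \val t) x (@cont_val _ _).
by exists t, u; rewrite eu point_val.
Qed.

End Fibered.

Lemma stack_fibered (C : over_top) : is_stack C -> fibered_in_groupoids C.
Proof. by case. Qed.

(** * Descent along maps of local sections *)

Section Descent.
Variable C : over_top.
Hypothesis sC : is_stack C.
Let fC := stack_fibered sC.

(** The glued base map is read off pointwise; pulling the target back along it
    reduces to arrows over the identity, to which [arrows_glue] applies. *)
Lemma glue_arrows (X Y : topologicalType) (c : open_cover X) (y : Ob C X)
    (z : Ob C Y) (x : forall i : idx c, Ob C (piece i))
    (r : forall i, Hom (x i) y) (f : forall i, Hom (x i) z) :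
  (forall i, base (r i) = incl (i := i)) ->
  (forall i j T (t : Ob C T) (a : Hom t (x i)) (b : Hom t (x j)),
    comp (r i) a = comp (r j) b -> comp (f i) a = comp (f j) b) ->
  exists! u : Hom y z, forall i, comp u (r i) = f i.
Proof.
move=> er compat.
have pc n := cid (piece_cover c n).
pose at_ (i : idx c) n (h : piece_set i n) : piece i := exist _ n (mem_set h).
pose g n : Y := base (f (sval (pc n))) (at_ _ n (svalP (pc n))).
have gE i (n : piece i) : g (\val n) = base (f i) n.
  rewrite /g; set j := sval _; set m := at_ _ _ _.
  have [t [a ea]] := lift_point fC (x i) n.
  have [|b [eb rb]] := cart fC (v := r j) (w := comp (r i) a) (@cont_cst (one_point n) _ m).
    by rewrite base_comp !er ea; apply/funext => ?.
  have := compat _ _ _ _ _ _ rb.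
  by move=> /(congr1 base); rewrite !base_comp ea eb => /(congr1 (@^~ (the_point n))).
have cg : continuous g.
  apply: (@cont_local _ _ c) => i.
  by rewrite (_ : _ \o _ = base (f i)); [exact: base_cont|apply/funext => n; exact: gE].
have [z' [h eh]] := fC.1 _ _ g z cg.
have hf i : exists f' : Hom (x i) z', base f' = incl (i := i) /\ comp h f' = f i.
  by apply: cart => //; [exact: incl_cont|rewrite eh; apply/funext => n; exact: gE].
pose f' i := sval (cid (hf i)).
have f'b i : base (f' i) = incl (i := i) by case: (svalP (cid (hf i))).
have f'h i : comp h (f' i) = f i by case: (svalP (cid (hf i))).
have [_ ga _] := sC.
have [|u [[ub ur] uu]] := ga _ c y z' x r f' er f'b.
  move=> i j w a b _ _ rab; apply: (cart_uniq fC (v := h)); last first.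
    by rewrite !compA !f'h; exact: compat.
  by rewrite !base_comp !f'b -(er i) -(er j) -!base_comp rab.
exists (comp h u); split; first by move=> i; rewrite -compA ur f'h.
move=> v vr.
have vb : base v = g.
  apply/funext => n; have [i ni] := piece_cover c n.
  rewrite -[n]/(\val (at_ i n ni)) gE -vr base_comp er.
  by [].
have [|v' [v'b hv']] := cart fC (v := h) (w := v) (@cont_id X); first by rewrite eh vb.
rewrite (uu v') //; split=> // i.
apply: (cart_uniq fC (v := h)); first by rewrite base_comp v'b er f'b.
by rewrite compA hv' vr f'h.
Qed.

Lemma glue_uniq (X Y : topologicalType) (c : open_cover X) (y : Ob C X)
    (z : Ob C Y) (u v : Hom y z) :
  (forall i : idx c, exists (x : Ob C (piece i)) (r : Hom x y),
    base r = incl (i := i) /\ comp u r = comp v r) -> u = v.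
Proof.
move=> H; pose x i := sval (cid (H i)).
have H' i : exists r : Hom (x i) y, base r = incl (i := i) /\ comp u r = comp v r.
  exact: svalP (cid (H i)).
pose r i := sval (cid (H' i)).
have er i : base (r i) = incl (i := i) by case: (svalP (cid (H' i))).
have euv i : comp u (r i) = comp v (r i) by case: (svalP (cid (H' i))).
have [i j T t a b e|w [_ uw]] := glue_arrows (f := fun i => comp v (r i)) er.
  by rewrite -!compA e.
by rewrite -(uw u) // -(uw v).
Qed.

Section AlongLocalSections.
Variables (S N : topologicalType) (w : Ob C S) (y : Ob C N) (p : Hom w y).
Hypothesis lp : local_sections (base p).

Lemma descend_uniq (Y : topologicalType) (z : Ob C Y) (u v : Hom y z) :
  comp u p = comp v p -> u = v.
Proof.
move=> e; have [_ [c sec]] := lp.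
apply: (@glue_uniq _ _ c) => i; have [s [cs es]] := sec i.
have [x [k ek]] := fC.1 _ _ s w cs.
exists x, (comp p k); split; first by rewrite base_comp ek.
by rewrite !compA e.
Qed.

(** The local sections [s] of [p] turn [f] into arrows [f s] on a cover of [N];
    they agree on overlaps because [f] identifies what [p] identifies. *)
Lemma descend_arrow (Y : topologicalType) (z : Ob C Y) (f : Hom w z) :
  (forall T (t : Ob C T) (a b : Hom t w),
    comp p a = comp p b -> comp f a = comp f b) ->
  exists u : Hom y z, comp u p = f.
Proof.
move=> compat; have [cp [c sec]] := lp.
have H (i : idx c) : exists (x : Ob C (piece i)) (k : Hom x w),
    base p \o base k = incl (i := i).
  have [s [cs es]] := sec i; have [x [k ek]] := fC.1 _ _ s w cs.
  by exists x, k; rewrite ek.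
pose x i := sval (cid (H i)).
have H' i : exists k : Hom (x i) w, base p \o base k = incl (i := i).
  exact: svalP (cid (H i)).
pose k i := sval (cid (H' i)).
have ek i : base (comp p (k i)) = incl (i := i).
  by rewrite base_comp; exact: svalP (cid (H' i)).
have [i j T t a b|u [ur _]] := glue_arrows (f := fun i => comp f (k i)) ek.
  by rewrite -!compA; exact: compat.
exists u; apply: (@glue_uniq _ _ (pull_cover cp c)) => i.
have [wi [j ej]] := fC.1 _ _ _ w (@incl_cont _ (pull_cover cp c) i).
exists wi, j; split => //.
have [|a [ea ra]] := cart fC (v := comp p (k i)) (w := comp p j)
    (pull_piece_cont (f := base p) (cf := cp) (c := c) (i := i)).
  by rewrite ek base_comp ej.
rewrite -compA -ra compA ur -compA; apply: compat.
by rewrite compA.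
Qed.

End AlongLocalSections.

(** Objects descend along a map of local sections [p : Q -> N]. The descent
    datum on [z] is the equivalence relation [R] on arrows into [z] that
    says which pairs are to become equal over [N]. The pullbacks of [z] along
    local sections of [p] are glued by arrows related by [R], and the cocycle
    condition is the transitivity of [R]. *)
Lemma descend_object (Q N : topologicalType) (p : Q -> N) (z : Ob C Q)
    (R : forall (T : topologicalType) (t : Ob C T), Hom t z -> Hom t z -> Prop) :
  local_sections p ->
  (forall T (t : Ob C T) (a b : Hom t z), R T t a b -> R T t b a) ->
  (forall T (t : Ob C T) (a b d : Hom t z),
    R T t a b -> R T t b d -> R T t a d) ->
  (forall T T' (t : Ob C T) (t' : Ob C T') (k : Hom t' t) (a b : Hom t z),
    R T t a b -> R T' t' (comp a k) (comp b k)) ->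
  (forall T (t : Ob C T) (a b : Hom t z), R T t a b ->
    p \o base a = p \o base b) ->
  (forall T (t : Ob C T) (a b : Hom t z), R T t a b -> base a = base b ->
    a = b) ->
  (forall T (t : Ob C T) (a : Hom t z) (f : T -> Q), continuous f ->
    p \o f = p \o base a -> exists b : Hom t z, base b = f /\ R T t a b) ->
  exists (y : Ob C N) (q : Hom z y), base q = p /\
    forall T (t : Ob C T) (a b : Hom t z), R T t a b -> comp q a = comp q b.
Proof.
move=> [cp [c sec]] Rsym Rtrans Rcomp Rbase Runiq Rlift.
have Rinj T (t : Ob C T) (a b d : Hom t z) :
    R T t a b -> R T t a d -> base b = base d -> b = d.
  by move=> ab ad; apply: Runiq; apply: Rtrans ad; exact: Rsym.
pose s i := sval (cid (sec i)).
have cs i : continuous (s i) by case: (svalP (cid (sec i))).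
have es (i : idx c) n : p (s i n) = \val n.
  by case: (svalP (cid (sec i))) => _ /(congr1 (@^~ n)).
pose x i := sval (cid (fC.1 _ _ (s i) z (@cs i))).
have H i : exists k : Hom (x i) z, base k = s i.
  exact: svalP (cid (fC.1 _ _ (s i) z (@cs i))).
pose k i := sval (cid (H i)).
have ek i : base (k i) = s i by exact: svalP (cid (H i)).
pose o1 (i j : idx c) : overlap i j -> piece i :=
  fun n => exist _ (\val n) (mem_set (set_mem (valP n)).1).
pose o2 (i j : idx c) : overlap i j -> piece j :=
  fun n => exist _ (\val n) (mem_set (set_mem (valP n)).2).
have co1 i j : continuous (@o1 i j) by apply: cont_into_sub; exact: cont_val.
have co2 i j : continuous (@o2 i j) by apply: cont_into_sub; exact: cont_val.
pose xx i j := sval (cid (fC.1 _ _ _ (x i) (@co1 i j))).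
have Ha i j : exists a : Hom (xx i j) (x i), base a = @o1 i j.
  exact: svalP (cid (fC.1 _ _ _ (x i) (@co1 i j))).
pose a i j := sval (cid (Ha i j)).
have ea i j : base (a i j) = @o1 i j by exact: svalP (cid (Ha i j)).
have Hb i j : exists b : Hom (xx i j) (x j), base b = @o2 i j /\
    R _ _ (comp (k i) (a i j)) (comp (k j) b).
  have [||b' [eb' Rb']] := Rlift _ _ (comp (k i) (a i j)) (s j \o @o2 i j).
  - exact: cont_comp.
  - by rewrite base_comp ek ea; apply/funext => n /=; rewrite !es.
  have [|b [eb kb]] := cart fC (v := k j) (w := b') (@co2 i j); first by rewrite ek eb'.
  by exists b; rewrite kb.
pose b i j := sval (cid (Hb i j)).
have eb i j : base (b i j) = @o2 i j by case: (svalP (cid (Hb i j))).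
have Rab i j : R _ _ (comp (k i) (a i j)) (comp (k j) (b i j)).
  by case: (svalP (cid (Hb i j))).
have [_ _ go] := sC.
have [|||y [r [er rab]]] := go _ c x xx a b.
- by move=> i j n; rewrite ea.
- by move=> i j n; rewrite eb.
- move=> i j l t u v w iu iv iw buav auaw.
  have bb : base (comp (b j l) v) = base (comp (b i l) w).
    rewrite !base_comp !eb; apply/funext => n; apply: val_inj => /=.
    by rewrite iv iw.
  apply: (cart_uniq fC (v := k l)) => //.
  apply: (@Rinj _ _ (comp (k i) (comp (a i j) u))).
  + apply: (@Rtrans _ _ _ (comp (k j) (comp (b i j) u))).
      by rewrite !compA; exact: Rcomp.
    by rewrite buav !compA; exact: Rcomp.
  + by rewrite auaw !compA; exact: Rcomp.
  + by rewrite (base_comp (k l)) (base_comp (k l)) bb.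
(* arrows to [x i] are arrows to [z] through the section [s i] *)
have toxi i T (t : Ob C T) (e : Hom t z) (f : T -> piece i) : continuous f ->
    p \o base e = incl (i := i) \o f ->
    exists l : Hom t (x i), base l = f /\ R _ _ e (comp (k i) l).
  move=> cf ef; have [||e' [ee' Re']] := Rlift _ _ e (s i \o f).
  - exact: cont_comp.
  - by rewrite ef; apply/funext => n /=; rewrite es.
  have [|l [el kl]] := cart fC (v := k i) (w := e') cf; first by rewrite ek ee'.
  by exists l; rewrite kl.
have inxi i j T (t : Ob C T) (e : Hom t z) (l : Hom t (x i)) (l' : Hom t (x j)) :
    R _ _ e (comp (k i) l) -> R _ _ e (comp (k j) l') -> comp (r i) l = comp (r j) l'.
  move=> Rl Rl'.
  have bl n : \val (base l n) = \val (base l' n).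
    have := Rbase _ _ _ _ (Rtrans _ _ _ _ _ (Rsym _ _ _ _ Rl) Rl').
    by move=> /(congr1 (@^~ n)); rewrite !base_comp !ek /= !es.
  have hn n : piece_set i (\val (base l n)) /\ piece_set j (\val (base l n)).
    by split; [|rewrite bl]; exact: set_mem (valP _).
  pose f n : overlap i j := exist _ (\val (base l n)) (mem_set (hn n)).
  have cf : continuous f.
    by apply: cont_into_sub; exact: cont_comp (base_cont (u := l)) (@cont_val _ _).
  have [|m [em am]] := cart fC (v := a i j) (w := l) cf.
    by rewrite ea; apply/funext => n; exact: val_inj.
  have bm : comp (b i j) m = l'.
    have ebm : base (comp (b i j) m) = base l'.
      by rewrite base_comp eb em; apply/funext => n; apply: val_inj; rewrite /= bl.
    apply: (cart_uniq fC (v := k j)) => //.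
    apply: (@Rinj _ _ e) => //; last by rewrite base_comp ebm -base_comp.
    by apply: Rtrans Rl _; rewrite -am !compA; exact: Rcomp.
  by rewrite -am -bm !compA rab.
pose pc := pull_cover cp c.
pose zz i := sval (cid (fC.1 _ _ _ z (@incl_cont _ pc i))).
have Hj i : exists j : Hom (zz i) z, base j = @incl _ pc i.
  exact: svalP (cid (fC.1 _ _ _ z (@incl_cont _ pc i))).
pose jj i := sval (cid (Hj i)).
have ej i : base (jj i) = @incl _ pc i by exact: svalP (cid (Hj i)).
have Hl i : exists l : Hom (zz i) (x i), base l = @pull_piece _ _ p cp c i /\
    R _ _ (jj i) (comp (k i) l).
  by apply: toxi; [exact: pull_piece_cont|rewrite ej].
pose l i := sval (cid (Hl i)).
have el i : base (l i) = @pull_piece _ _ p cp c i by case: (svalP (cid (Hl i))).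
have Rl i : R _ _ (jj i) (comp (k i) (l i)) by case: (svalP (cid (Hl i))).
have [i j T t a' b' e|q [qr _]] := glue_arrows (c := pc) (f := fun i => comp (r i) (l i)) ej.
  rewrite -!compA; apply: (@inxi _ _ _ _ (comp (jj i) a')).
    by rewrite compA; exact: Rcomp.
  by rewrite e compA; exact: Rcomp.
exists y, q; split.
  apply/funext => n; have [i ni] := piece_cover pc n.
  have := congr1 base (qr i); rewrite !base_comp ej er el.
  by move=> /(congr1 (@^~ (exist _ n (mem_set ni)))).
move=> T t a' b' Rab'.
have cpa : continuous (p \o base a') by exact: cont_comp (base_cont (u := a')) cp.
apply: (@glue_uniq _ _ (pull_cover cpa c)) => i.
have [t' [e ee]] := fC.1 _ _ _ t (@incl_cont _ (pull_cover cpa c) i).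
exists t', e; split=> //; rewrite -!compA.
have fac (d : Hom t z) : p \o base d = p \o base a' ->
    exists d' : Hom t' (zz i), comp d e = comp (jj i) d'.
  move=> pd.
  have hn (n : @piece _ (pull_cover cpa c) i) : (p @^-1` @piece_set _ c i) (base d (\val n)).
    by rewrite /= -[p _]/((p \o base d) (\val n)) pd; exact: set_mem (valP n).
  pose f (n : @piece _ (pull_cover cpa c) i) : @piece _ pc i := exist _ (base d (\val n)) (mem_set (hn n)).
  have cf : continuous f.
    apply: cont_into_sub.
    exact: (@cont_comp _ _ _ _ (base d) (@cont_val _ _) (base_cont (u := d))).
  have [|d' [_ e']] := cart fC (v := jj i) (w := comp d e) cf.
    by rewrite ej base_comp ee.
  by exists d'.
have [a1 ea1] := fac a' erefl.
have [b1 eb1] := fac b' (esym (Rbase _ _ _ _ Rab')).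
rewrite ea1 eb1 !compA !qr -!compA; apply: (@inxi _ _ _ _ (comp (jj i) a1)).
  by rewrite compA; exact: Rcomp.
rewrite -ea1; apply: (@Rtrans _ _ _ (comp b' e)); first exact: Rcomp.
by rewrite eb1 compA; exact: Rcomp.
Qed.

End Descent.

(** * Products in the total category *)

(** A categorical product of [x] and [y] in the total category of [C] (base
    maps are arbitrary) that lies over the space [I]. When [C] is fibered in
    groupoids, maps [T -> I] are the triples of two maps from [T] to the bases
    and an isomorphism between the pullbacks of [x] and [y]: the space [I] is
    the 2-fiber product of the two bases over [C]. *)
Record product (C : over_top) (S S' : topologicalType) (x : Ob C S)
    (y : Ob C S') (I : topologicalType) := Product {
  pr_ob : Ob C I;
  pr1 : Hom pr_ob x;
  pr2 : Hom pr_ob y;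
  pr_pair : forall (T : topologicalType) (t : Ob C T),
    Hom t x -> Hom t y -> Hom t pr_ob;
  pr1_pair : forall (T : topologicalType) (t : Ob C T) (u : Hom t x)
    (v : Hom t y), comp pr1 (pr_pair u v) = u;
  pr2_pair : forall (T : topologicalType) (t : Ob C T) (u : Hom t x)
    (v : Hom t y), comp pr2 (pr_pair u v) = v;
  pr_uniq : forall (T : topologicalType) (t : Ob C T) (k k' : Hom t pr_ob),
    comp pr1 k = comp pr1 k' -> comp pr2 k = comp pr2 k' -> k = k'
}.

Section Product.
Context {C : over_top} {S S' : topologicalType} {x : Ob C S} {y : Ob C S'}
  {I : topologicalType}.
Variable P : product x y I.

(** The map to [I] classifying the isomorphism [v . u^-1]. *)
Definition dlt (T : topologicalType) (t : Ob C T) (u : Hom t x) (v : Hom t y) :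
  T -> I := base (pr_pair P u v).
Definition isrc : I -> S := base (pr1 P).
Definition itgt : I -> S' := base (pr2 P).

Lemma dlt_cont T (t : Ob C T) (u : Hom t x) (v : Hom t y) : continuous (dlt u v).
Proof. exact: base_cont. Qed.
Lemma isrc_cont : continuous isrc. Proof. exact: base_cont. Qed.
Lemma itgt_cont : continuous itgt. Proof. exact: base_cont. Qed.

Lemma isrc_dlt T (t : Ob C T) (u : Hom t x) (v : Hom t y) :
  isrc \o dlt u v = base u.
Proof. by rewrite -base_comp pr1_pair. Qed.
Lemma itgt_dlt T (t : Ob C T) (u : Hom t x) (v : Hom t y) :
  itgt \o dlt u v = base v.
Proof. by rewrite -base_comp pr2_pair. Qed.

Lemma dlt_comp T T' (t : Ob C T) (t' : Ob C T') (u : Hom t x) (v : Hom t y)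
  (k : Hom t' t) : dlt (comp u k) (comp v k) = dlt u v \o base k.
Proof.
rewrite -base_comp; congr base.
by apply: (pr_uniq (p := P)); rewrite compA ?pr1_pair ?pr2_pair.
Qed.

Lemma dlt_pr : dlt (pr1 P) (pr2 P) = id.
Proof.
rewrite -(base_id (pr_ob P)); congr base.
by apply: (pr_uniq (p := P)); rewrite ?pr1_pair ?pr2_pair compm1.
Qed.

Hypothesis fC : fibered_in_groupoids C.

Lemma dlt_injl T (t : Ob C T) (u u' : Hom t x) (v : Hom t y) :
  dlt u v = dlt u' v -> u = u'.
Proof.
move=> e; rewrite -(pr1_pair P u v) -(pr1_pair P u' v); congr comp.
by apply: (cart_uniq fC (v := pr2 P) e); rewrite !pr2_pair.
Qed.
Lemma dlt_injr T (t : Ob C T) (u : Hom t x) (v v' : Hom t y) :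
  dlt u v = dlt u v' -> v = v'.
Proof.
move=> e; rewrite -(pr2_pair P u v) -(pr2_pair P u v'); congr comp.
by apply: (cart_uniq fC (v := pr1 P) e); rewrite !pr1_pair.
Qed.

Lemma dlt_surjl T (t : Ob C T) (v : Hom t y) (f : T -> I) : continuous f ->
  itgt \o f = base v -> exists u, dlt u v = f.
Proof.
move=> cf e; have [k [ek kv]] := cart fC cf e.
exists (comp (pr1 P) k); rewrite -ek -kv.
by rewrite dlt_comp dlt_pr.
Qed.
(** Identities between points of [I] are proved on pairs of arrows over a
    one-point space. *)
Lemma dlt_point (g : I) : exists (T : topologicalType) (tau : T) (t : Ob C T) (u : Hom t x)
  (v : Hom t y), dlt u v = cst g.
Proof.
have [t [k ek]] := lift_point fC (pr_ob P) g.
exists _, (the_point g), t, (comp (pr1 P) k), (comp (pr2 P) k).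
by rewrite dlt_comp dlt_pr ek.
Qed.

Lemma dlt_cst_src T (t : Ob C T) (u : Hom t x) (v : Hom t y) g :
  dlt u v = cst g -> base u = cst (isrc g).
Proof. by move=> e; rewrite -(isrc_dlt u v) e. Qed.
Lemma dlt_cst_tgt T (t : Ob C T) (u : Hom t x) (v : Hom t y) g :
  dlt u v = cst g -> base v = cst (itgt g).
Proof. by move=> e; rewrite -(itgt_dlt u v) e. Qed.

Lemma point_surjl T (t : Ob C T) (v : Hom t y) (g : I) :
  base v = cst (itgt g) -> exists u, dlt u v = cst g.
Proof. by move=> e; apply: dlt_surjl; [exact: cont_cst|rewrite e]. Qed.
End Product.

Lemma cst_eq (T : Type) (A : Type) (t : T) (a b : A) :
  cst a = cst b :> (T -> A) -> a = b.
Proof. by move=> /(congr1 (@^~ t)). Qed.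

Section ProductMap.
Context {C C' : over_top} (F : functor C C').
Context {S1 S2 I : topologicalType} {x : Ob C S1} {y : Ob C S2}.
Context {S1' S2' I' : topologicalType} {x' : Ob C' S1'} {y' : Ob C' S2'}.
Variables (P : product x y I) (P' : product x' y' I').
Variables (f : Hom (fob F x) x') (g : Hom (fob F y) y').

Definition imap : I -> I' :=
  dlt P' (comp f (fhom F (pr1 P))) (comp g (fhom F (pr2 P))).

Lemma imap_cont : continuous imap. Proof. exact: dlt_cont. Qed.

Lemma imap_dlt T (t : Ob C T) (u : Hom t x) (v : Hom t y) :
  imap \o dlt P u v = dlt P' (comp f (fhom F u)) (comp g (fhom F v)).
Proof.
rewrite /dlt -(fhom_base F) -dlt_comp -!compA -!fhom_comp.
by rewrite pr1_pair pr2_pair.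
Qed.

Lemma imap_cst T (t : Ob C T) (u : Hom t x) (v : Hom t y) a :
  dlt P u v = cst a ->
  dlt P' (comp f (fhom F u)) (comp g (fhom F v)) = cst (imap a).
Proof. by move=> e; rewrite -imap_dlt e. Qed.

Lemma isrc_imap a : isrc P' (imap a) = base f (isrc P a).
Proof.
have := isrc_dlt P' (comp f (fhom F (pr1 P))) (comp g (fhom F (pr2 P))).
by move=> /(congr1 (@^~ a)); rewrite base_comp fhom_base.
Qed.
Lemma itgt_imap a : itgt P' (imap a) = base g (itgt P a).
Proof.
have := itgt_dlt P' (comp f (fhom F (pr1 P))) (comp g (fhom F (pr2 P))).
by move=> /(congr1 (@^~ a)); rewrite base_comp fhom_base.
Qed.

End ProductMap.
Arguments imap {C C'} F {S1 S2 I x y S1' S2' I' x' y'} P P' f g.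
Arguments imap_cont {C C'} F {S1 S2 I x y S1' S2' I' x' y'} P P' f g.
Arguments imap_dlt {C C'} F {S1 S2 I x y S1' S2' I' x' y'} P P' f g {T t} u v.
Arguments imap_cst {C C'} F {S1 S2 I x y S1' S2' I' x' y'} P P' f g {T t u v a} e.

(** * Groupoids of automorphisms *)

(** [G] is the groupoid of automorphisms of [d], that is, the 2-fiber product of
    [M] with itself over [C]. *)
Record presents (C : over_top) (M : topologicalType) (G : groupoid M)
    (d : Ob C M) := Presents {
  ps_prod :> product d d (arr G);
  ps_src : isrc ps_prod = @src M G;
  ps_tgt : itgt ps_prod = @tgt M G;
  ps_mul : forall (T : topologicalType) (t : Ob C T) (u v w : Hom t d) (n : T),
    dlt ps_prod u w n = gm (dlt ps_prod v w n) (dlt ps_prod u v n)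
}.

Arguments ps_src {C M G d} p.
Arguments ps_tgt {C M G d} p.

Section Presents.
Context {C : over_top} {M : topologicalType} {G : groupoid M} {d : Ob C M}.
Variable P : presents G d.

Lemma src_dlt T (t : Ob C T) (u v : Hom t d) n : src (dlt P u v n) = base u n.
Proof. by rewrite -(ps_src P) -(isrc_dlt P u v). Qed.
Lemma tgt_dlt T (t : Ob C T) (u v : Hom t d) n : tgt (dlt P u v n) = base v n.
Proof. by rewrite -(ps_tgt P) -(itgt_dlt P u v). Qed.

(** An idempotent arrow of a groupoid is a unit. *)
Lemma dlt_one T (t : Ob C T) (u : Hom t d) n : dlt P u u n = one G (base u n).
Proof.
have := ps_mul P u u u n; set g := dlt _ _ _ _ => e.
have eg : src g = tgt g by rewrite src_dlt tgt_dlt.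
have : gm (inv g) g = gm (inv g) (gm g g) by rewrite -e.
by rewrite gmK // gmVg src_dlt => ->.
Qed.

Lemma dlt_cst_mul T (t : Ob C T) (u v w : Hom t d) g h :
  dlt P v w = cst g -> dlt P u v = cst h -> dlt P u w = cst (gm g h).
Proof. by move=> eg eh; apply/funext => n; rewrite (ps_mul P u v w) eg eh. Qed.

End Presents.

Section PresentsMor.
Context {C C' : over_top} (F : functor C C').
Hypothesis fC : fibered_in_groupoids C.
Context {M M' : topologicalType} {G : groupoid M} {G' : groupoid M'}.
Context {d : Ob C M} {d' : Ob C' M'}.
Variables (P : presents G d) (P' : presents G' d') (f : Hom (fob F d) d').

(** The action of [F] on automorphisms, followed by composition with [f] at both
    ends. *)
Definition pmor : gmor G G'.
Proof.
refine (@GMor M M' G G' (base f) (imap F P P' f f) (base_cont (u := f))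
  (imap_cont F P P' f f) _ _ _ _).
- by move=> g; rewrite -(ps_src P') isrc_imap (ps_src P).
- by move=> g; rewrite -(ps_tgt P') itgt_imap (ps_tgt P).
- move=> m; have [t [u eu]] := lift_point fC d m.
  have e : dlt P u u = cst (one G m).
    by apply/funext => n; rewrite dlt_one eu.
  apply: (cst_eq (the_point m)); rewrite -(imap_cst F P P' f f e).
  by apply/funext => n; rewrite dlt_one base_comp fhom_base eu.
- move=> z e.
  have [T [tau [t [v [w evw]]]]] := dlt_point P fC (fp1 z).
  have [|u euv] := @point_surjl _ _ _ _ _ _ P fC _ _ v (fp2 z).
    by rewrite (dlt_cst_src evw) ps_src ps_tgt fpE.
  have euw := dlt_cst_mul evw euv.
  apply: (@cst_eq T _ tau); rewrite gmE' -(imap_cst F P P' f f euw).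
  rewrite gmE.
  exact: dlt_cst_mul (imap_cst F P P' f f evw) (imap_cst F P P' f f euv).
Defined.

End PresentsMor.

Section Pullback.
Context {C : over_top}.
Hypothesis fC : fibered_in_groupoids C.
Context {M M' : topologicalType} {G : groupoid M} {G' : groupoid M'}.
Context {d : Ob C M} {d' : Ob C M'}.
Variables (P : presents G d) (P' : presents G' d') (f : Hom d d').

Definition pmor_id : gmor G G' := @pmor C C (fid C) fC _ _ _ _ _ _ P P' f.

(** Arrows being cartesian, an isomorphism between pullbacks of [d'] along maps
    through [base f] is the same as one between pullbacks of [d]: so the
    automorphisms of [d] form the pullback of those of [d']. *)
Lemma pmor_id_morita : local_sections (base f) -> morita_morphism pmor_id.
Proof.
move=> lf; split => //.
pose J := @gm0_cont _ _ _ _ pmor_id.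
have e1 g : base f (src g) = src (gm1 pmor_id g) by rewrite gm_src.
have e2 g : tgt (gm1 pmor_id g) = base f (tgt g) by rewrite gm_tgt.
pose i1 (g : arr G) : pb_arr (base f) G' := pb_mk (e1 g) (e2 g).
unshelve eexists.
  refine (@GMor M M G (pullback_groupoid J G') id i1 (@cont_id _) _ _ _ _ _).
  - by apply: cont_pb_mk; [exact: src_cont|exact: gm1_cont|exact: tgt_cont].
  - by [].
  - by [].
  - move=> m; apply: pb_eq; rewrite /i1 /pb1 /pb2 /pb3 /=.
    + by rewrite src_one.
    + exact: (gm_one pmor_id).
    + by rewrite tgt_one.
  - move=> z e; apply: pb_eq.
    + by rewrite /i1 /pb1 /= src_mul.
    + rewrite [RHS]pb2_mul /= -[LHS]/(gm1 pmor_id (mul z)) gmE' gm1_gm ?fpE//.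
    + by rewrite /i1 /pb3 /= tgt_mul.
split=> //; split.
  by apply: cont_pb_mk; [exact: src_cont|exact: gm1_cont|exact: tgt_cont].
(* the inverse homeomorphism is the base of an arrow: over the arrows of the
   pullback groupoid, lift both ends of the universal automorphism along [f] *)
have [wK [kK ekK]] := fC.1 _ _ _ (pr_ob P') (@cont_pb2 _ _ (base f) G').
have [|u [eu fu]] := cart fC (v := f) (w := comp (pr1 P') kK)
    (@cont_pb1 _ _ (base f) G').
  by rewrite base_comp ekK [base (pr1 P')](ps_src P'); apply/funext => z; exact: pb_src.
have [|v [ev fv]] := cart fC (v := f) (w := comp (pr2 P') kK)
    (@cont_pb3 _ _ (base f) G').
  by rewrite base_comp ekK [base (pr2 P')](ps_tgt P'); apply/funext => z; rewrite /= pb_tgt.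
have imE : imap (fid C) P P' f f \o dlt P u v = @pb2 _ _ (base f) G'.
  by rewrite imap_dlt /= fu fv dlt_comp dlt_pr ekK.
exists (dlt P u v); split; first exact: dlt_cont.
- move=> g /=.
  have [T [tau [t [a [b eab]]]]] := dlt_point P fC g.
  have [||k [ek uk]] := @cart _ fC _ _ _ t wK _ u a (cst (i1 g)).
  + exact: cont_cst.
  + rewrite eu; apply/funext => n.
    by rewrite (dlt_cst_src eab) ps_src.
  have vk : comp v k = b.
    apply: (cart_uniq fC (v := f)).
      rewrite base_comp ev ek (dlt_cst_tgt eab) ps_tgt.
      by apply/funext.
    apply: (dlt_injr (P := P') fC (u := comp f a)).
    rewrite -[dlt P' (comp f a) (comp f b)](imap_dlt (fid C) P P' f f) eab.
    rewrite -uk compA fu !compA fv.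
    by rewrite dlt_comp dlt_comp dlt_pr ek ekK.
  apply: (@cst_eq T _ tau).
  by rewrite -[RHS]eab -uk -vk dlt_comp ek.
- move=> z; apply: pb_eq.
  + by rewrite /i1 {1}/pb1 /= src_dlt eu.
  + by rewrite /i1 {1}/pb2 /= -imE.
  + by rewrite /i1 {1}/pb3 /= tgt_dlt ev.
Qed.

End Pullback.

(** * The bundle of isomorphisms from a fixed object *)

Definition products (C : over_top) :=
  forall (S S' : topologicalType) (x : Ob C S) (y : Ob C S'),
    {I : topologicalType & product x y I}.

Section Isos.
Context {C : over_top}.
Hypothesis fC : fibered_in_groupoids C.
Variable hp : products C.

Section Iso.
Context {S S' : topologicalType} (x : Ob C S) (y : Ob C S').
Definition iso : topologicalType := projT1 (hp x y).
Definition iso_prod : product x y iso := projT2 (hp x y).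
End Iso.

Section Composition.
Context {S1 S2 S3 : topologicalType}.
Variables (x : Ob C S1) (y : Ob C S2) (z : Ob C S3).
Let Pyz := iso_prod y z.
Let Pxy := iso_prod x y.
Let Pxz := iso_prod x z.

Lemma dlt_match T (t : Ob C T) (u : Hom t x) (v : Hom t y) (w : Hom t z) n :
  isrc Pyz (dlt Pyz v w n) = itgt Pxy (dlt Pxy u v n).
Proof.
rewrite -[LHS]/((isrc Pyz \o dlt Pyz v w) n) isrc_dlt.
by rewrite -[RHS]/((itgt Pxy \o dlt Pxy u v) n) itgt_dlt.
Qed.

(** The composite is read off the pullback of the two universal isomorphisms
    to the fiber product; its continuity comes for free, being the base of
    an arrow. *)
Lemma icomp_ex : exists m : fprod (isrc Pyz) (itgt Pxy) -> iso x z,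
  continuous m /\
  forall T (t : Ob C T) (u : Hom t x) (v : Hom t y) (w : Hom t z) n
    (e : isrc Pyz (dlt Pyz v w n) = itgt Pxy (dlt Pxy u v n)),
    m (fpair e) = dlt Pxz u w n.
Proof.
have [q [k1 ek1]] := fC.1 _ _ _ (pr_ob Pyz) (@cont_fp1 _ _ _ (isrc Pyz) (itgt Pxy)).
have [|k2 [ek2 k2v]] := cart fC (v := pr2 Pxy) (w := comp (pr1 Pyz) k1)
    (@cont_fp2 _ _ _ (isrc Pyz) (itgt Pxy)).
  by rewrite base_comp ek1; apply/funext => n; exact: esym (fpE n).
exists (dlt Pxz (comp (pr1 Pxy) k2) (comp (pr2 Pyz) k1)); split; first exact: dlt_cont.
move=> T t u v w n e.
have e' := dlt_match u v w.
have cg : continuous (fun m => fpair (e' m)).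
  by apply: cont_fpair; exact: dlt_cont.
have [|k [ek kk]] := cart fC (v := k1) (w := pr_pair Pyz v w) cg; first by rewrite ek1.
have kk2 : comp k2 k = pr_pair Pxy u v.
  apply: (cart_uniq fC (v := pr2 Pxy)); first by rewrite base_comp ek2 ek.
  by rewrite compA k2v -compA kk pr1_pair pr2_pair.
have <- : fpair (e' n) = fpair e by exact: fprod_eq.
rewrite -[LHS]/((dlt Pxz (comp (pr1 Pxy) k2) (comp (pr2 Pyz) k1) \o
  (fun m => fpair (e' m))) n) -ek -dlt_comp -!compA kk kk2.
by rewrite pr1_pair pr2_pair.
Qed.

Definition icomp : fprod (isrc Pyz) (itgt Pxy) -> iso x z := sval (cid icomp_ex).

Lemma icomp_cont : continuous icomp.
Proof. by case: (svalP (cid icomp_ex)). Qed.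

Lemma icomp_dlt T (t : Ob C T) (u : Hom t x) (v : Hom t y) (w : Hom t z) n
    (e : isrc Pyz (dlt Pyz v w n) = itgt Pxy (dlt Pxy u v n)) :
  icomp (fpair e) = dlt Pxz u w n.
Proof. exact: (svalP (cid icomp_ex)).2. Qed.

Lemma icompE T (t : Ob C T) (u : Hom t x) (v : Hom t y) (w : Hom t z) g h
    (e : isrc Pyz g = itgt Pxy h) :
  dlt Pyz v w = cst g -> dlt Pxy u v = cst h ->
  dlt Pxz u w = cst (icomp (fpair e)).
Proof.
move=> eg eh; apply/funext => n.
have e' : isrc Pyz (dlt Pyz v w n) = itgt Pxy (dlt Pxy u v n) by rewrite eg eh.
rewrite -(icomp_dlt e') /=.
by congr (icomp _); apply: fprod_eq; rewrite !fpairE ?eg ?eh.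
Qed.

End Composition.

Section Inverse.
Context {S1 S2 : topologicalType} (x : Ob C S1) (y : Ob C S2).
Let P := iso_prod x y.
Definition iinv : iso x y -> iso y x := dlt (iso_prod y x) (pr2 P) (pr1 P).

Lemma iinv_cont : continuous iinv. Proof. exact: dlt_cont. Qed.

Lemma iinvE T (t : Ob C T) (u : Hom t x) (v : Hom t y) g :
  dlt P u v = cst g -> dlt (iso_prod y x) v u = cst (iinv g).
Proof.
move=> e; have <- : iinv \o dlt P u v = dlt (iso_prod y x) v u.
  by rewrite -dlt_comp pr1_pair pr2_pair.
by rewrite e.
Qed.

Lemma isrc_iinv g : isrc (iso_prod y x) (iinv g) = itgt P g.
Proof. by rewrite -[LHS]/((_ \o iinv) g) isrc_dlt. Qed.
Lemma itgt_iinv g : itgt (iso_prod y x) (iinv g) = isrc P g.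
Proof. by rewrite -[LHS]/((_ \o iinv) g) itgt_dlt. Qed.

End Inverse.

Section Laws.
Context {S1 S2 S3 S4 : topologicalType}.
Variables (x : Ob C S1) (y : Ob C S2) (z : Ob C S3) (w : Ob C S4).

Lemma isrc_icomp (p : fprod (isrc (iso_prod y z)) (itgt (iso_prod x y))) :
  isrc (iso_prod x z) (icomp p) = isrc (iso_prod x y) (fp2 p).
Proof.
have [T [n [t [v [a eva]]]]] := dlt_point (iso_prod y z) fC (fp1 p).
have [|u euv] := @point_surjl _ _ _ _ _ _ (iso_prod x y) fC _ _ v (fp2 p).
  by rewrite (dlt_cst_src eva) fpE.
apply: (cst_eq n); rewrite -(dlt_cst_src euv) -(fpair_eta (fpE p)).
by rewrite (dlt_cst_src (icompE (fpE p) eva euv)).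
Qed.

Lemma itgt_icomp (p : fprod (isrc (iso_prod y z)) (itgt (iso_prod x y))) :
  itgt (iso_prod x z) (icomp p) = itgt (iso_prod y z) (fp1 p).
Proof.
have [T [n [t [v [a eva]]]]] := dlt_point (iso_prod y z) fC (fp1 p).
have [|u euv] := @point_surjl _ _ _ _ _ _ (iso_prod x y) fC _ _ v (fp2 p).
  by rewrite (dlt_cst_src eva) fpE.
apply: (cst_eq n); rewrite -(dlt_cst_tgt eva) -(fpair_eta (fpE p)).
by rewrite (dlt_cst_tgt (icompE (fpE p) eva euv)).
Qed.

Lemma icompA g h k (e1 : isrc (iso_prod z w) g = itgt (iso_prod y z) h)
    (e2 : isrc (iso_prod y z) h = itgt (iso_prod x y) k)
    (e3 : isrc (iso_prod z w) g = itgt (iso_prod x z) (icomp (fpair e2)))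
    (e4 : isrc (iso_prod y w) (icomp (fpair e1)) = itgt (iso_prod x y) k) :
  icomp (fpair e3) = icomp (fpair e4).
Proof.
have [T [n [t [c [d ecd]]]]] := dlt_point (iso_prod z w) fC g.
have [|b ebc] := @point_surjl _ _ _ _ _ _ (iso_prod y z) fC _ _ c h.
  by rewrite (dlt_cst_src ecd) e1.
have [|a eab] := @point_surjl _ _ _ _ _ _ (iso_prod x y) fC _ _ b k.
  by rewrite (dlt_cst_src ebc) e2.
apply: (cst_eq n).
rewrite -(icompE e3 ecd (icompE e2 ebc eab)).
by rewrite -(icompE e4 (icompE e1 ecd ebc) eab).
Qed.

End Laws.

(** ** The groupoid of automorphisms of an object *)
Section Aut.
Context {M : topologicalType} (c : Ob C M).
Let P := iso_prod c c.

Definition ione : M -> iso c c := dlt P (idm c) (idm c).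

Lemma ioneE T (t : Ob C T) (u : Hom t c) m :
  base u = cst m -> dlt P u u = cst (ione m).
Proof. by move=> e; rewrite -[u](comp1m u) dlt_comp e. Qed.

Lemma isrc_ione m : isrc P (ione m) = m.
Proof. by rewrite -[LHS]/((_ \o ione) m) isrc_dlt base_id. Qed.
Lemma itgt_ione m : itgt P (ione m) = m.
Proof. by rewrite -[LHS]/((_ \o ione) m) itgt_dlt base_id. Qed.

Definition aut : groupoid M.
Proof.
refine (@Groupoid M (iso c c) (isrc P) (itgt P) ione (@iinv _ _ c c)
  (@icomp _ _ _ c c c) (@isrc_cont _ _ _ _ _ _ P) (@itgt_cont _ _ _ _ _ _ P)
  _ (@iinv_cont _ _ _ _) (@icomp_cont _ _ _ _ _ _) isrc_ione itgt_ione
  (@isrc_iinv _ _ _ _) (@itgt_iinv _ _ _ _)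
  (@isrc_icomp _ _ _ _ _ _) (@itgt_icomp _ _ _ _ _ _) _ _ _ _ _).
- exact: dlt_cont.
- by move=> g h k e1 e2 e3 e4; exact: icompA.
- move=> g e; have [T [n [t [u [v euv]]]]] := dlt_point P fC g.
  apply: (cst_eq n); rewrite -(icompE e (ioneE (dlt_cst_tgt euv)) euv).
  exact: euv.
- move=> g e; have [T [n [t [u [v euv]]]]] := dlt_point P fC g.
  apply: (cst_eq n); rewrite -(icompE e euv (ioneE (dlt_cst_src euv))).
  exact: euv.
- move=> g e; have [T [n [t [u [v euv]]]]] := dlt_point P fC g.
  apply: (cst_eq n); rewrite -(icompE e (iinvE euv) euv).
  exact: ioneE (dlt_cst_src euv).
- move=> g e; have [T [n [t [u [v euv]]]]] := dlt_point P fC g.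
  apply: (cst_eq n); rewrite -(icompE e euv (iinvE euv)).
  exact: ioneE (dlt_cst_tgt euv).
Defined.

Definition aut_presents : presents aut c.
Proof.
refine (@Presents C M aut c P erefl erefl _) => T t u v w n.
have e : src (dlt P v w n : arr aut) = tgt (dlt P u v n : arr aut) := dlt_match u v w n.
by rewrite -(gmE e); exact/esym/icomp_dlt.
Defined.

Section IsoBundle.
Context {N : topologicalType} (y : Ob C N).
Let Q := iso_prod c y.
Hypothesis lQ : local_sections (itgt Q).

Lemma itgt_icomp_sym (p : fprod (isrc Q) (@tgt M aut)) :
  itgt Q (fp1 p) = itgt Q (icomp p).
Proof. by rewrite itgt_icomp. Qed.

(** Two isomorphisms [q] and [q'] from [c] to the same fiber of [y] differ by the
    automorphism [q^-1 q'] of [c], which depends continuously on both. *)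
Lemma iso_shear : homeomorphism (fun p => fpair (itgt_icomp_sym p)).
Proof.
split; first by apply: cont_fpair; [exact: cont_fp1|exact: icomp_cont].
have e1 (p : fprod (itgt Q) (itgt Q)) :
    isrc (iso_prod y c) (iinv (fp1 p)) = itgt Q (fp2 p).
  by rewrite isrc_iinv fpE.
have e2 (p : fprod (itgt Q) (itgt Q)) :
    isrc Q (fp1 p) = @tgt M aut (icomp (fpair (e1 p))).
  by rewrite [RHS]itgt_icomp itgt_iinv.
exists (fun p => fpair (e2 p)); split.
- apply: cont_fpair; first exact: cont_fp1.
  apply: (cont_comp _ (@icomp_cont _ _ _ c y c)); apply: cont_fpair.
    exact: cont_comp (@cont_fp1 _ _ _ _ _) (@iinv_cont _ _ _ _).
  exact: cont_fp2.
- move=> p; apply: fprod_eq => //; rewrite [LHS]fp2_pair.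
  have [T [n [t [v [a eva]]]]] := dlt_point Q fC (fp1 p).
  have [|u euv] := @point_surjl _ _ _ _ _ _ P fC _ _ v (fp2 p).
    by rewrite (dlt_cst_src eva) fpE.
  apply: (cst_eq n); rewrite -euv.
  rewrite -(icompE _ (iinvE eva) (v := a) (u := u)) //.
  by rewrite fp2_pair (icompE (fpE p) eva euv) fpair_eta.
- move=> p; apply: fprod_eq => //; rewrite [LHS]fp2_pair.
  have [T [n [t [u [a eua]]]]] := dlt_point Q fC (fp1 p).
  have [|v eva] := @point_surjl _ _ _ _ _ _ Q fC _ _ a (fp2 p).
    by rewrite (dlt_cst_tgt eua) fpE.
  apply: (cst_eq n); rewrite -eva.
  rewrite -(icompE (e2 p) eua (u := v)) //.
  exact: icompE (iinvE eua) eva.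
Qed.

Definition iso_bundle : principal_bundle aut N.
Proof.
refine (@PrincipalBundle M aut N (iso c y) (isrc Q) (@icomp _ _ _ c c y) (itgt Q)
  (@isrc_cont _ _ _ _ _ _ Q) (@icomp_cont _ _ _ _ _ _)
  (@isrc_icomp _ _ _ _ _ _) _ _ lQ itgt_icomp_sym iso_shear).
- move=> g e; have [T [n [t [u [v euv]]]]] := dlt_point Q fC g.
  apply: (cst_eq n); rewrite -(icompE e euv (ioneE (dlt_cst_src euv))).
  exact: euv.
- move=> p g h e1 e2 e3 e4; apply/esym; exact: icompA.
Defined.

End IsoBundle.

End Aut.

End Isos.

(** * Equivalences of categories over spaces *)

Definition fully_faithful (A D : over_top) (e : functor A D) : Prop :=
  forall (X Y : topologicalType) (x : Ob A X) (y : Ob A Y)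
    (h : Hom (fob e x) (fob e y)), exists! u, fhom e u = h.

Definition ess_surjective (A D : over_top) (e : functor A D) : Prop :=
  forall (X : topologicalType) (z : Ob D X), exists (x : Ob A X)
    (h : Hom (fob e x) z), base h = id /\ invertible h.

Lemma ff_inj (A D : over_top) (e : functor A D) : fully_faithful e ->
  forall X Y (x : Ob A X) (y : Ob A Y) (u v : Hom x y),
    fhom e u = fhom e v -> u = v.
Proof.
by move=> ff X Y x y u v euv; have [w [_ uw]] := ff _ _ _ _ (fhom e v);
  rewrite -(uw u) // -(uw v).
Qed.

Lemma ff_full (A D : over_top) (e : functor A D) : fully_faithful e ->
  forall X Y (x : Ob A X) (y : Ob A Y) (h : Hom (fob e x) (fob e y)),
    exists u, fhom e u = h.
Proof. by move=> ff X Y x y h; have [u [eu _]] := ff _ _ _ _ h; exists u. Qed.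

Lemma inv_base (C : over_top) (X : topologicalType) (x y : Ob C X)
    (h : Hom x y) (k : Hom y x) :
  base h = id -> comp h k = idm y -> base k = id.
Proof. by move=> eh /(congr1 base); rewrite base_comp eh base_id. Qed.

(** ** 2-isomorphisms *)

Lemma iso2_sym (A D : over_top) (F G : functor A D) : iso2 F G -> iso2 G F.
Proof.
move=> [eta [eb en ei]].
exists (fun X x => sval (cid (ei X x))); split.
- move=> X x; have [_ e] := svalP (cid (ei X x)).
  by apply: inv_base e; exact: eb.
- move=> X Y x y u /=.
  have [ey _] := svalP (cid (ei Y y)); have [_ ex] := svalP (cid (ei X x)).
  set ty := sval _ in ey *; set tx := sval _ in ex *.
  by rewrite -[LHS]compm1 -ex -!compA (compA (fhom G u)) -en !compA ey comp1m.
- move=> X x; have [e1 e2] := svalP (cid (ei X x)).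
  by exists (eta X x).
Qed.

Lemma invertible_comp (C : over_top) (X Y Z : topologicalType) (x : Ob C X)
    (y : Ob C Y) (z : Ob C Z) (v : Hom y z) (u : Hom x y) :
  invertible v -> invertible u -> invertible (comp v u).
Proof.
move=> [v' [v1 v2]] [u' [u1 u2]]; exists (comp u' v'); split.
  by rewrite -compA (compA v') v1 comp1m.
by rewrite -compA (compA u) u2 comp1m.
Qed.

Lemma fhom_invertible (C D : over_top) (F : functor C D) (X Y : topologicalType)
    (x : Ob C X) (y : Ob C Y) (u : Hom x y) :
  invertible u -> invertible (fhom F u).
Proof.
by move=> [v [e1 e2]]; exists (fhom F v); rewrite -!fhom_comp e1 e2 !fhom_id.
Qed.

Lemma iso2_trans (A D : over_top) (F G H : functor A D) :
  iso2 F G -> iso2 G H -> iso2 F H.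
Proof.
move=> [a [ab an ai]] [b [bb bn bi]].
exists (fun X x => comp (b X x) (a X x)); split.
- by move=> X x; rewrite base_comp ab bb.
- by move=> X Y x y u; rewrite -compA an compA bn compA.
- by move=> X x; apply: invertible_comp; [exact: bi|exact: ai].
Qed.

Lemma iso2_compl (A C D : over_top) (K : functor C D) (F G : functor A C) :
  iso2 F G -> iso2 (fcomp K F) (fcomp K G).
Proof.
move=> [a [ab an ai]]; exists (fun X x => fhom K (a X x)); split.
- by move=> X x; rewrite /= fhom_base ab.
- by move=> X Y x y u /=; rewrite -!fhom_comp an.
- by move=> X x; exact: (@fhom_invertible _ _ K _ _ _ _ _ (ai X x)).
Qed.

Lemma iso2_compr (A C D : over_top) (K : functor A C) (F G : functor C D) :
  iso2 F G -> iso2 (fcomp F K) (fcomp G K).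
Proof.
move=> [a [ab an ai]]; exists (fun X x => a X (fob K x)); split.
- by move=> X x; exact: ab.
- by move=> X Y x y u; exact: an.
- by move=> X x; exact: ai.
Qed.

(** ** Equivalences are the fully faithful and essentially surjective functors *)

(** One choice of preimages of the objects of [D] yields a quasi-inverse and both
    2-isomorphisms. *)
Lemma ff_es_equivalence (A D : over_top) (e : functor A D) :
  fully_faithful e -> ess_surjective e -> equivalence e.
Proof.
move=> ff es.
pose pre X (z : Ob D X) : Ob A X := sval (cid (es X z)).
have Hh X (z : Ob D X) : exists h : Hom (fob e (pre X z)) z, base h = id /\ invertible h.
  exact: svalP (cid (es X z)).
pose h X (z : Ob D X) := sval (cid (Hh X z)).
have hb X (z : Ob D X) : base (h X z) = id by case: (svalP (cid (Hh X z))).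
have hi X (z : Ob D X) : invertible (h X z) by case: (svalP (cid (Hh X z))).
pose k X (z : Ob D X) := sval (cid (hi X z)).
have kh X (z : Ob D X) : comp (k X z) (h X z) = idm _.
  by case: (svalP (cid (hi X z))).
have hk X (z : Ob D X) : comp (h X z) (k X z) = idm z.
  by case: (svalP (cid (hi X z))).
have kb X (z : Ob D X) : base (k X z) = id by exact: inv_base (hb X z) (hk X z).
have fl X Y x y f := cid (@ff_full _ _ _ ff X Y x y f).
pose l X Y (x : Ob A X) (y : Ob A Y) f : Hom x y := sval (fl X Y x y f).
have lE X Y (x : Ob A X) (y : Ob A Y) f : fhom e (l X Y x y f) = f.
  exact: svalP (fl X Y x y f).
pose gm X Y (z : Ob D X) (z' : Ob D Y) (f : Hom z z') :=
  l X Y (pre X z) (pre Y z') (comp (k Y z') (comp f (h X z))).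
have g_base X Y z z' f : base (gm X Y z z' f) = base f.
  by rewrite -(fhom_base e) lE !base_comp kb hb.
have g_id X z : gm X X z z (idm z) = idm (pre X z).
  by apply: (ff_inj ff); rewrite lE fhom_id comp1m kh.
have g_comp X Y Z z1 z2 z3 v u :
    gm X Z z1 z3 (comp v u) = comp (gm Y Z z2 z3 v) (gm X Y z1 z2 u).
  apply: (ff_inj ff); rewrite fhom_comp !lE -!compA.
  by rewrite (compA (h Y z2)) hk comp1m.
exists (@Functor D A pre gm g_base g_id g_comp); split.
- exists (fun X x => l X X (pre X (fob e x)) x (h X (fob e x))); split => /=.
  + by move=> X x; rewrite -(fhom_base e) lE hb.
  + move=> X Y x y u; apply: (ff_inj ff).
    by rewrite !fhom_comp !lE !compA hk comp1m.
  + move=> X x; exists (l X X x (pre X (fob e x)) (k X (fob e x))).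
    by split; apply: (ff_inj ff); rewrite fhom_comp !lE fhom_id ?kh ?hk.
- exists h; split => /=.
  + exact: hb.
  + by move=> X Y x y u; rewrite lE !compA hk comp1m.
  + exact: hi.
Qed.

Section OfEquivalence.
Variables (A D : over_top) (e : functor A D).
Hypothesis he : equivalence e.

Lemma equivalence_ess_surjective : ess_surjective e.
Proof.
move=> X z; have [g [_ [b [bb bn bi]]]] := he.
by exists (fob g z), (b X z); split; [exact: bb|exact: bi].
Qed.

Lemma iso2_id_faithful (B C : over_top) (F : functor B C) (G : functor C B) :
  iso2 (fcomp G F) (fid B) ->
  forall X Y (x : Ob B X) (y : Ob B Y) (u v : Hom x y), fhom F u = fhom F v -> u = v.
Proof.
move=> [a [ab an ai]] X Y x y u v euv.
have [a' [_ aK]] := ai X x; rewrite -[u]compm1 -[v]compm1 -aK !compA.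
by rewrite -[comp u _]an -[comp v _]an /= euv.
Qed.

(** The candidate preimage of [f] is [g f] conjugated by the 2-isomorphism; its
    image is [f] because [g] is faithful as well. *)
Lemma equivalence_ff : fully_faithful e.
Proof.
move=> X Y x y f; have [g [ge eg]] := he.
have injg := iso2_id_faithful eg.
have [a [ab an ai]] := ge; have [a' [e1 e2]] := ai X x.
exists (comp (a Y y) (comp (fhom g f) a')); split; last first.
  move=> u <-; rewrite compA -[fhom g (fhom e u)]/(fhom (fcomp g e) u) an /=.
  by rewrite -compA e2 compm1.
apply: injg.
have := an _ _ _ _ (comp (a Y y) (comp (fhom g f) a')) => /=.
have [b' [f1 f2]] := ai Y y.
rewrite -!compA e1 => /(congr1 (comp b')).
by rewrite !compA f1 !comp1m compm1.
Qed.

End OfEquivalence.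

(** * Principal bundles *)

Lemma local_sections_pullback (X Y N : topologicalType) (p : X -> N) (f : Y -> N) :
  local_sections p -> continuous f -> local_sections (@fp2 _ _ _ p f).
Proof.
move=> lp cf; apply: local_sectionsP; first exact: cont_fp2.
move=> y; have [V [oV Vy] [s [cs es]]] := local_sections_at (f y) lp.
exists (f @^-1` V); first by split=> //; move/continuousP: cf; exact.
pose fV (w : set_type (f @^-1` V)) : set_type V :=
  exist _ (f (\val w)) (mem_set (set_mem (valP w))).
have e w : p (s (fV w)) = f (\val w) by rewrite es.
exists (fun w => fpair (e w)); split=> //; apply: cont_fpair; last exact: cont_val.
by apply: cont_comp cs; apply: cont_into_sub; exact: cont_comp (@cont_val _ _) cf.
Qed.


Section BundleIso.
Context {M : topologicalType} {G : groupoid M}.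

(** A morphism of principal bundles over the identity is bijective on
    each fiber; its inverse is continuous because it is described by the
    division maps after passing to a map of local sections. *)
Lemma bundle_mor_invertible (N : topologicalType) (P P' : principal_bundle G N)
    (u : bundle_mor P P') :
  bm_base u = id -> @invertible (B G) _ _ _ _ u.
Proof.
move=> ub; have [dv [cdv dv1 dv2]] := division P'.
have up p : proj P' (bm_tot u p) = proj P p by rewrite bm_proj ub.
pose Z := fprod (proj P) (proj P').
have e (z : Z) : proj P' (bm_tot u (fp1 z)) = proj P' (fp2 z) by rewrite up fpE.
pose g (z : Z) := dv (fpair (e z)).
have g1 (z : Z) : anchor P (fp1 z) = tgt (g z) by rewrite -(bm_anchor u) -dv1.
have g2 (z : Z) : bm_tot u (ac (fp1 z) (g z)) = fp2 z.
  by rewrite bm_ac // /g -[RHS](fp2_pair (e z)) -dv2.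
have inj p q : bm_tot u p = bm_tot u q -> p = q.
  move=> epq; have [dv' [_ dv1' dv2']] := division P.
  have epp : proj P p = proj P q by rewrite -!up epq.
  have := dv2' (fpair epp); have := dv1' (fpair epp).
  rewrite !fpairE; set k := dv' _ => k1 k2.
  rewrite -k2 in epq *; rewrite bm_ac // in epq.
  have -> : k = one G (anchor P p); last by rewrite ac1.
  apply: (@ac_inj _ _ _ P' (bm_tot u p)); rewrite ?bm_anchor ?tgt_one //.
  by rewrite -epq ac1 // bm_anchor.
have surj (q : tot P') : exists p, bm_tot u p = q.
  have [V [oV Vy] [s [cs es]]] := local_sections_at (proj P' q) (proj_sections P).
  pose v : set_type V := exist _ (proj P' q) (mem_set Vy).
  have eq : proj P (s v) = proj P' q by rewrite es.
  by exists (ac (fp1 (fpair eq)) (g (fpair eq))); rewrite g2.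
pose k q := sval (cid (surj q)).
have ku q : bm_tot u (k q) = q by exact: svalP (cid (surj q)).
have uk p : k (bm_tot u p) = p by apply: inj; rewrite ku.
have ck : continuous k.
  apply: (@local_sections_descend Z _ _ (@fp2 _ _ _ _ _)).
    apply: local_sections_pullback (proj_sections P) _.
    exact: (proj_sections P').1.
  rewrite (_ : _ \o _ = fun z => ac (fp1 z) (g z)); last first.
    by apply/funext => z; apply: inj; rewrite /= ku g2.
  apply: cont_ac => //; first exact: cont_fp1.
  apply: cont_comp cdv; apply: cont_fpair; last exact: cont_fp2.
  exact: cont_comp (@cont_fp1 _ _ _ _ _) (bm_tot_cont (b := u)).
unshelve eexists.
  refine (@BundleMor M G N N P' P k id ck (@cont_id _) _ _ _).
  - by move=> q; rewrite -up ku.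
  - by move=> q; rewrite -(bm_anchor u) ku.
  - move=> z ez; apply: inj; rewrite ku (acE ez) bm_ac // ku acE'.
    by [].
by split; apply: bundle_mor_eq => //=; rewrite ub.
Qed.

End BundleIso.

(** * A stack is the classifying stack of the automorphisms of an atlas *)

Section Classifying.
Variable C : over_top.
Hypothesis sC : is_stack C.
Let fC := stack_fibered sC.
Variable hp : products C.
Context {M : topologicalType} {c : Ob C M}.
Hypothesis lc : forall (N : topologicalType) (y : Ob C N),
  local_sections (itgt (iso_prod hp c y)).

Let A : groupoid M := aut fC hp c.
Let Ib N (y : Ob C N) : principal_bundle A N := iso_bundle fC (lc y).

Section Mor.
Context {N N' : topologicalType} {y : Ob C N} {y' : Ob C N'} (f : Hom y y').
Let Q := iso_prod hp c y.
Let Q' := iso_prod hp c y'.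

Definition iso_push : iso hp c y -> iso hp c y' := imap (fid C) Q Q' (idm c) f.

Lemma iso_pushE T (t : Ob C T) (u : Hom t c) (v : Hom t y) g :
  dlt Q u v = cst g -> dlt Q' u (comp f v) = cst (iso_push g).
Proof. by move=> e; rewrite -(imap_cst (fid C) Q Q' (idm c) f e) /= comp1m. Qed.

Definition iso_bundle_mor : bundle_mor (Ib y) (Ib y').
Proof.
refine (@BundleMor M A N N' (Ib y) (Ib y') iso_push (base f)
  (imap_cont (fid C) Q Q' (idm c) f) (base_cont (u := f)) _ _ _).
- by move=> g; rewrite [LHS]itgt_imap.
- by move=> g; rewrite [LHS]isrc_imap base_id.
- move=> p e; have [T [n [t [v [a eva]]]]] := dlt_point Q fC (fp1 p).
  have [|u euv] := @point_surjl _ _ _ _ _ _ (iso_prod hp c c) fC _ _ v (fp2 p).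
    by rewrite (dlt_cst_src eva) [isrc _ _](fpE p).
  apply: (cst_eq n); rewrite -[RHS](icompE fC e (iso_pushE eva) euv).
  have := iso_pushE (icompE fC (fpE p) eva euv).
  by rewrite fpair_eta => ->.
Defined.

End Mor.

Definition classify : functor C (B A).
Proof.
refine (@Functor C (B A) Ib (@iso_bundle_mor) _ _ _).
- by [].
- move=> N y; apply: bundle_mor_eq; last exact: base_id.
  move=> g /=; have [T [n [t [u [v euv]]]]] := dlt_point (iso_prod hp c y) fC g.
  by apply: (cst_eq n); rewrite -(iso_pushE (idm y) euv) comp1m.
- move=> N1 N2 N3 y1 y2 y3 h f; apply: bundle_mor_eq; last exact: base_comp.
  move=> g /=; have [T [n [t [u [v euv]]]]] := dlt_point (iso_prod hp c y1) fC g.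
  apply: (cst_eq n); rewrite -(iso_pushE (comp h f) euv).
  by rewrite -(iso_pushE h (iso_pushE f euv)) compA.
Defined.

(** The universal isomorphism over [iso c y] maps to [y] along a map of local
    sections, so arrows out of [y] are arrows out of it that are insensitive
    to the isomorphism with [c]; equivariance says just that. *)
Lemma classify_ff : fully_faithful classify.
Proof.
move=> N N' y y' u.
pose Q := iso_prod hp c y; pose Q' := iso_prod hp c y'.
have uanch g : isrc Q' (bm_tot u g) = isrc Q g by exact: (bm_anchor u).
(* [u] is the base of an arrow [k] between the universal isomorphisms *)
have [|k [ek kp]] := cart fC (v := pr1 Q') (w := pr1 Q) (bm_tot_cont (b := u)).
  by apply/funext => g; exact: uanch.
pose f := comp (pr2 Q') k.
have kE T (t : Ob C T) (a : Hom t c) (b : Hom t y) :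
    dlt Q' a (comp f (pr_pair Q a b)) = bm_tot u \o dlt Q a b.
  rewrite -ek -base_comp; congr base; apply: (pr_uniq (p := Q')).
    by rewrite pr1_pair compA kp pr1_pair.
  by rewrite pr2_pair compA.
have compat T (t : Ob C T) (d d' : Hom t (pr_ob Q)) :
    comp (pr2 Q) d = comp (pr2 Q) d' -> comp f d = comp f d'.
  move=> e2; pose v := comp (pr2 Q) d.
  pose a := comp (pr1 Q) d; pose a' := comp (pr1 Q) d'.
  have ed : d = pr_pair Q a v.
    by apply: (pr_uniq (p := Q)); rewrite ?pr1_pair ?pr2_pair.
  have ed' : d' = pr_pair Q a' v.
    by apply: (pr_uniq (p := Q)); rewrite ?pr1_pair ?pr2_pair /v ?e2.
  apply: (dlt_injr (P := Q') fC (u := a')); apply/esym.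
  rewrite [in LHS]ed' kE; apply/funext => n /=.
  rewrite -(icomp_dlt fC (dlt_match hp a' a v n)).
  rewrite [icomp _ _](acE (P := Ib y)) bm_ac; last exact: dlt_match.
  have eu : bm_tot u (dlt Q a v n) = dlt Q' a (comp f d) n by rewrite ed kE.
  rewrite eu -(acE (P := Ib y') (dlt_match hp a' a (comp f d) n)).
  exact: icomp_dlt.
have [h hf] := descend_arrow sC (lc y) compat.
have hpush : iso_push h =1 bm_tot u.
  move=> g; have [T [n [t [a [b eab]]]]] := dlt_point Q fC g.
  apply: (cst_eq n); rewrite -(iso_pushE h eab).
  have := kE _ _ a b; rewrite -hf -compA pr2_pair eab => ->.
  by [].
exists h; split.
  apply: bundle_mor_eq => //=; apply/funext => m.
  have [V [oV Vm] [s [cs es]]] := local_sections_at m (lc y).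
  pose mV : set_type V := exist _ m (mem_set Vm).
  have <- : itgt Q (s mV) = m by rewrite es.
  have := bm_proj u (s mV) => <-; rewrite -hpush.
  by rewrite [RHS]itgt_imap.
move=> h' eh'; apply: (descend_uniq sC (lc y)).
have : imap (fid C) Q Q' (idm c) h' =1 imap (fid C) Q Q' (idm c) h.
  by move=> g; rewrite -[RHS]/(iso_push h g) hpush -eh'.
by move=> /funext; rewrite /imap /= !comp1m => /(dlt_injr fC).
Qed.

(** A principal bundle [Q] trivialises over its own total space: pulling [c] back
    along the anchor gives an object over [tot Q], and the division
    map of [Q] is a descent datum on it. *)
Lemma classify_es : ess_surjective classify.
Proof.
move=> N Q; have [z [al eal]] := fC.1 _ _ (anchor Q) c (@anchor_cont _ _ _ Q).
have [dv [cdv dv1 dv2]] := division Q.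
have lq := proj_sections Q.
pose P := iso_prod hp c c.
have acx T (t : Ob C T) (a b : Hom t z) n :
    anchor Q (base a n) = @tgt _ A (dlt P (comp al b) (comp al a) n).
  have := itgt_dlt P (comp al b) (comp al a) => /(congr1 (@^~ n)) => /= e.
  by rewrite [RHS]e base_comp eal.
have acs T (t : Ob C T) (a b : Hom t z) n :
    anchor Q (base b n) = @src _ A (dlt P (comp al b) (comp al a) n).
  have := isrc_dlt P (comp al b) (comp al a) => /(congr1 (@^~ n)) => /= e.
  by rewrite [RHS]e base_comp eal.
(* [a] and [b] are to be identified when the automorphism of [c] relating
   them is the one given by the division map of [Q] *)
pose R T (t : Ob C T) (a b : Hom t z) :=
  forall n, base b n = ac (base a n) (dlt P (comp al b) (comp al a) n).
have mulA_ := ps_mul (aut_presents fC hp c).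
have oneA T (t : Ob C T) (a : Hom t z) n :
    dlt P (comp al a) (comp al a) n = one A (anchor Q (base a n)).
  by rewrite [LHS](dlt_one (aut_presents fC hp c)) base_comp eal.
have [||||||y [q [eq Rq]]] := @descend_object _ sC _ _ _ z R lq.
- move=> T t a b Rab n; rewrite Rab acM; [|exact: acx|by rewrite -(acs _ _ a b) (acx _ _ b a)].
  by rewrite -[gm _ _](mulA_ _ t (comp al a) (comp al b) (comp al a) n) oneA ac1.
- move=> T t a b d Rab Rbd n; rewrite Rbd Rab acM; [|exact: acx|by rewrite -(acs _ _ a b) (acx _ _ b d)].
  by rewrite -[gm _ _](mulA_ _ t (comp al d) (comp al b) (comp al a) n).
- move=> T T' t t' k a b Rab n.
  by rewrite !base_comp !compA dlt_comp /= Rab.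
- move=> T t a b Rab; apply/funext => n /=; rewrite Rab proj_ac //; exact: acx.
- move=> T t a b Rab eab; apply: (cart_uniq fC (v := al)) => //.
  apply: (dlt_injl (P := P) fC (v := comp al a)); apply/funext => n.
  rewrite oneA; apply: (@ac_inj _ _ _ Q (base a n)).
  + by rewrite tgt_one.
  + exact: acx.
  by rewrite ac1 // -Rab eab.
- move=> T t a f cf ef.
  have e n : proj Q (base a n) = proj Q (f n) by rewrite -[RHS]/((proj Q \o f) n) ef.
  pose g n : arr A := dv (fpair (e n)).
  have cg : continuous g.
    by apply: cont_comp cdv; apply: cont_fpair => //; exact: base_cont.
  have tg n : anchor Q (base a n) = tgt (g n) by rewrite -dv1.
  have ag n : ac (base a n) (g n) = f n by exact: (dv2 (fpair (e n))).
  have [|v ev] := dlt_surjl (P := P) fC (v := comp al a) cg.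
    by apply/funext => n; rewrite base_comp eal /= [RHS]tg.
  have [|b [eb alb]] := cart fC (v := al) (w := v) cf.
    rewrite -(isrc_dlt P v (comp al a)) ev eal; apply/funext => n /=.
    by rewrite -(ag n) anchor_ac.
  by exists b; split=> // n; rewrite eb alb ev ag.
pose I := iso_prod hp c y.
have tB : itgt I \o dlt I al q = proj Q by rewrite itgt_dlt.
have aB : isrc I \o dlt I al q = anchor Q by rewrite isrc_dlt.
have [b eb] : exists b : bundle_mor Q (Ib y), bm_base b = id.
  refine (ex_intro _ (@BundleMor M A N N Q (Ib y) (dlt I al q) id
    (@dlt_cont _ _ _ _ _ _ I _ _ al q) (@cont_id _) _ _ _) erefl).
  - by move=> p; rewrite -tB.
  - by move=> p; rewrite -aB.
  - move=> p e; have [t [a ea]] := lift_point fC z (fp1 p).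
    have [|u eu] := @point_surjl _ _ _ _ _ _ P fC _ _ (comp al a) (fp2 p).
      by rewrite base_comp eal ea; apply/funext => n; rewrite /= (fpE p).
    have [||b [eb alb]] := @cart _ fC _ _ _ t z _ al u (cst (act Q p)).
    + exact: cont_cst.
    + by rewrite eal (dlt_cst_src eu); apply/funext => n; rewrite /= anchor_act.
    have qab : comp q a = comp q b.
      by apply: Rq => n; rewrite eb alb eu ea /= acE'.
    have e0 : dlt I (comp al a) (comp q a) = cst (dlt I al q (fp1 p)).
      by rewrite dlt_comp ea.
    apply: (cst_eq (the_point (fp1 p))); rewrite -[RHS](icompE fC e e0 eu).
    by rewrite qab -alb dlt_comp eb.
have [k [k1 k2]] := bundle_mor_invertible eb.
exists y, k; split; first exact: inv_base k2.
by exists b.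
Qed.

End Classifying.

(** * Products and the atlas of a classifying stack *)

Section Bundles.
Context {M : topologicalType} {G : groupoid M}.

Lemma proj_surj (N : topologicalType) (P : principal_bundle G N) (n : N) :
  exists p, proj P p = n.
Proof.
have [V [oV Vn] [s [cs es]]] := local_sections_at n (proj_sections P).
by exists (s (exist _ n (mem_set Vn) : set_type V)); rewrite es.
Qed.

Lemma bundle_mor_tot_eq (N N' : topologicalType) (P : principal_bundle G N)
    (P' : principal_bundle G N') (u v : bundle_mor P P') :
  bm_tot u =1 bm_tot v -> u = v.
Proof.
move=> e; apply: bundle_mor_eq => //; apply/funext => n.
by have [p <-] := proj_surj P n; rewrite -!bm_proj e.
Qed.

(** The base map is forced, as the fibers of the quotient map [proj P] are the
    orbits. *)
Lemma bundle_mor_ex (N N' : topologicalType) (P : principal_bundle G N)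
    (P' : principal_bundle G N') (f : tot P -> tot P') :
  continuous f -> (forall p, anchor P' (f p) = anchor P p) ->
  (forall p g, anchor P p = tgt g -> f (ac p g) = ac (f p) g) ->
  exists u : bundle_mor P P', bm_tot u = f.
Proof.
move=> cf fa fac.
have inv p q : proj P p = proj P q -> proj P' (f p) = proj P' (f q).
  move=> epq; have [dv [_ dv1 dv2]] := division P.
  have := dv2 (fpair epq); have := dv1 (fpair epq); rewrite !fpairE => e1 <-.
  by rewrite fac // proj_ac // fa.
pose b n := proj P' (f (sval (cid (proj_surj P n)))).
have bE p : b (proj P p) = proj P' (f p).
  by apply: inv; exact: svalP (cid (proj_surj P (proj P p))).
have cb : continuous b.
  apply: local_sections_descend (proj_sections P) _.
  rewrite (_ : _ \o _ = proj P' \o f); last by apply/funext => p; rewrite /= bE.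
  by apply: cont_comp cf _; case: (proj_sections P').
unshelve eexists.
  refine (@BundleMor M G N N' P P' f b cf cb _ fa _); first by move=> p; rewrite bE.
  by move=> x e; rewrite acE' fac ?fpE // acE.
by [].
Qed.

(** ** The universal bundle *)

Lemma mul_shear : homeomorphism (fun x => fpair (esym (@tgt_mul _ G x))).
Proof.
split; first by apply: cont_fpair; [exact: cont_fp1|exact: mul_cont].
have e1 (p : fprod (@tgt M G) (@tgt M G)) : src (inv (fp1 p)) = tgt (fp2 p).
  by rewrite src_inv fpE.
have e2 (p : fprod (@tgt M G) (@tgt M G)) :
    src (fp1 p) = tgt (gm (inv (fp1 p)) (fp2 p)) by rewrite tgt_gm ?tgt_inv.
exists (fun p => fpair (e2 p)); split.
- apply: cont_fpair; first exact: cont_fp1.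
  apply: cont_gm => //; last exact: cont_fp2.
  exact: cont_comp (@cont_fp1 _ _ _ _ _) (@inv_cont _ G).
- by move=> x; apply: fprod_eq; rewrite !fpairE // gmE' gmK // fpE.
- by move=> p; apply: fprod_eq; rewrite !fpairE // gmE gmKV // fpE.
Qed.

Lemma tgt_sections : local_sections (@tgt M G).
Proof.
apply: local_sectionsP; first exact: tgt_cont.
move=> m; exists setT; first by split=> //; exact: openT.
exists (fun v => one G (\val v)); split; last by move=> v; rewrite tgt_one.
exact: cont_comp (@cont_val _ _) (@one_cont _ G).
Qed.

Definition universal_bundle : principal_bundle G M.
Proof.
refine (@PrincipalBundle M G M (arr G) (@src _ G) (@mul _ G) (@tgt _ G)
  (@src_cont _ G) (@mul_cont _ G) (@src_mul _ G) (@mulg1 _ G) _ tgt_sections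
  (fun x => esym (tgt_mul x)) mul_shear).
by move=> p g h e1 e2 e3 e4; apply/esym; exact: mulA.
Defined.

Lemma univ_ac (p g : arr G) : src p = tgt g -> @ac _ _ _ universal_bundle p g = gm p g.
Proof. by move=> e; rewrite -(acE (P := universal_bundle) e) -gmE. Qed.

(** The image under [u] of a point of [P'] over [n] is [s n . g] for a unique
    arrow [g], and [g] is the image of that point in the universal bundle. *)
Lemma section_to_univ (N N' : topologicalType) (P : principal_bundle G N)
    (P' : principal_bundle G N') (u : bundle_mor P' P) (s : N' -> tot P) :
  continuous s -> proj P \o s = bm_base u ->
  inhabited (bundle_mor P' universal_bundle).
Proof.
move=> cs es; have [dv [cdv dv1 dv2]] := division P.
have e p : proj P (s (proj P' p)) = proj P (bm_tot u p).
  by rewrite bm_proj -es.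
pose f p := dv (fpair (e p)).
have f1 p : anchor P (s (proj P' p)) = tgt (f p) by rewrite -dv1 fpairE.
have f2 p : ac (s (proj P' p)) (f p) = bm_tot u p.
  exact: (dv2 (fpair (e p))).
have f3 p : src (f p) = anchor P' p by rewrite -(anchor_ac (f1 p)) f2 bm_anchor.
have [|||v _] := @bundle_mor_ex _ _ P' universal_bundle f.
- apply: cont_comp cdv; apply: cont_fpair; last exact: bm_tot_cont.
  by apply: cont_comp cs; case: (proj_sections P').
- exact: f3.
- move=> p g epg; rewrite univ_ac; last by rewrite f3.
  apply: (@ac_inj _ _ _ P (s (proj P' p))).
  + by rewrite -f1 proj_ac.
  + by rewrite tgt_gm ?f3.
  rewrite -acM ?f3 // f2 -bm_ac // -f2.
  by rewrite proj_ac.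
by constructor.
Qed.

(** ** Automorphisms of the universal bundle *)

Lemma gm_injr (a b k : arr G) : src a = tgt k -> src b = tgt k ->
  gm a k = gm b k -> a = b.
Proof.
move=> ea eb /(congr1 (fun z => gm z (inv k))).
by rewrite -!gmA ?tgt_inv // gmgV !gmg1.
Qed.

Section UnivDiff.
Context {N : topologicalType} {P : principal_bundle G N}.
Variables u v : bundle_mor P universal_bundle.

(** For [p] in the fiber over [n], the arrow [v p . (u p)^-1] depends only
    on [n]. *)
Definition univ_diff (n : N) : arr G :=
  let p := sval (cid (proj_surj P n)) in gm (bm_tot v p) (inv (bm_tot u p)).

Lemma univ_diffP p : [/\ src (univ_diff (proj P p)) = tgt (bm_tot u p),
  tgt (univ_diff (proj P p)) = tgt (bm_tot v p) &
  gm (univ_diff (proj P p)) (bm_tot u p) = bm_tot v p].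
Proof.
rewrite /univ_diff; have := svalP (cid (proj_surj P (proj P p))).
set q := sval _ => epq.
have [dv [_ dv1 dv2]] := division P.
have := dv2 (fpair epq); have := dv1 (fpair epq); rewrite !fpairE.
set k := dv _ => k1 <-; rewrite !bm_ac //.
have ku : src (bm_tot u q) = tgt k by rewrite [LHS](bm_anchor u).
have kv : src (bm_tot v q) = tgt k by rewrite [LHS](bm_anchor v).
have uv : src (bm_tot v q) = tgt (inv (bm_tot u q)) by rewrite tgt_inv ku kv.
rewrite !univ_ac // !tgt_gm // src_gm // src_inv; split=> //.
rewrite gmA ?src_gm ?src_inv //; congr gm.
by rewrite -gmA ?src_inv // gmVg gmg1 // ku.
Qed.

Lemma univ_diffE p g : src g = tgt (bm_tot u p) ->
  gm g (bm_tot u p) = bm_tot v p -> univ_diff (proj P p) = g.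
Proof.
have [e1 _ e2] := univ_diffP p => eg e.
by apply: gm_injr e1 eg _; rewrite e2 e.
Qed.

Lemma univ_diff_cont : continuous univ_diff.
Proof.
apply: local_sections_descend (proj_sections P) _.
have e p : src (bm_tot v p) = tgt (inv (bm_tot u p)).
  by rewrite tgt_inv [LHS](bm_anchor v) [RHS](bm_anchor u).
rewrite (_ : _ \o _ = fun p => gm (bm_tot v p) (inv (bm_tot u p))).
  apply: cont_gm => //; first exact: (bm_tot_cont (b := v)).
  exact: cont_comp (bm_tot_cont (b := u)) (@inv_cont _ G).
apply/funext => p; apply: univ_diffE; first by rewrite src_gm // src_inv.
rewrite -gmA ?src_inv // gmVg gmg1 //.
by rewrite [RHS](bm_anchor v) [LHS](bm_anchor u).
Qed.

Lemma src_univ_diff : @src _ G \o univ_diff = bm_base u.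
Proof.
apply/funext => n /=; have [p <-] := proj_surj P n.
by have [-> _ _] := univ_diffP p; rewrite [LHS](bm_proj u).
Qed.
Lemma tgt_univ_diff : @tgt _ G \o univ_diff = bm_base v.
Proof.
apply/funext => n /=; have [p <-] := proj_surj P n.
by have [_ -> _] := univ_diffP p; rewrite [LHS](bm_proj v).
Qed.

End UnivDiff.

Lemma univ_diff_comp N N' (P : principal_bundle G N) (P' : principal_bundle G N')
    (u v : bundle_mor P universal_bundle) (k : bundle_mor P' P) :
  univ_diff (bundle_comp u k) (bundle_comp v k) = univ_diff u v \o bm_base k.
Proof.
apply/funext => n /=; have [p <-] := proj_surj P' n.
have [e1 _ e2] := univ_diffP u v (bm_tot k p).
by apply: univ_diffE; rewrite /= -bm_proj.
Qed.

Lemma univ_diff_mul N (P : principal_bundle G N)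
    (u v w : bundle_mor P universal_bundle) n :
  univ_diff u w n = gm (univ_diff v w n) (univ_diff u v n).
Proof.
have [p <-] := proj_surj P n.
have [a1 _ a2] := univ_diffP v w p; have [b1 b2 b3] := univ_diffP u v p.
have e : src (univ_diff v w (proj P p)) = tgt (univ_diff u v (proj P p)).
  by rewrite a1 b2.
apply: univ_diffE; first by rewrite (src_gm e) b1.
by rewrite -gmA // b3 a2.
Qed.

Lemma univ_diff_injl N (P : principal_bundle G N)
    (u u' v : bundle_mor P universal_bundle) :
  univ_diff u v = univ_diff u' v -> u = u'.
Proof.
move=> e; apply: bundle_mor_tot_eq => p.
have [a1 _ a2] := univ_diffP u v p; have [b1 _ b2] := univ_diffP u' v p.
by rewrite -(gmK a1) a2 e -b2 gmK.
Qed.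

Lemma univ_diff_surjl N (P : principal_bundle G N)
    (v : bundle_mor P universal_bundle) (g : N -> arr G) :
  continuous g -> @tgt _ G \o g = bm_base v -> exists u, univ_diff u v = g.
Proof.
move=> cg eg.
have e p : tgt (g (proj P p)) = tgt (bm_tot v p).
  by rewrite [RHS](bm_proj v) -eg.
have e' p : src (inv (g (proj P p))) = tgt (bm_tot v p) by rewrite src_inv e.
have [|||u uE] := @bundle_mor_ex _ _ P universal_bundle
    (fun p => gm (inv (g (proj P p))) (bm_tot v p)).
- apply: cont_gm => //; last exact: (bm_tot_cont (b := v)).
  apply: cont_comp (@inv_cont _ G); apply: cont_comp cg.
  by case: (proj_sections P).
- by move=> p; rewrite [LHS]src_gm // [LHS](bm_anchor v).
- move=> p k k1.
  have k2 : src (bm_tot v p) = tgt k by rewrite [LHS](bm_anchor v).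
  by rewrite proj_ac // bm_ac // !univ_ac ?src_gm // gmA.
exists u; apply/funext => n; have [p <-] := proj_surj P n.
by apply: univ_diffE; rewrite uE ?tgt_gm ?tgt_inv // gmKV.
Qed.

(** The pullback [w] of the universal bundle along [tgt] has, besides its arrow
    [k2] over [tgt], an arrow [k1] over [src] that differs from [k2] by the
    tautological arrow of [G]; with these, [w] is the product. *)
Lemma univ_presents : fibered_in_groupoids (B G) ->
  exists P : @presents (B G) M G universal_bundle,
    forall N (Q : principal_bundle G N) (u v : bundle_mor Q universal_bundle),
      @dlt (B G) _ _ _ _ _ P N Q u v = univ_diff u v.
Proof.
move=> fB.
have [w [k2 ek2]] := fB.1 _ _ _ universal_bundle (@tgt_cont _ G).
have [|k1 ek] := @univ_diff_surjl _ w k2 id (@cont_id _); first by rewrite -ek2.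
have H N (Q : principal_bundle G N) (u v : bundle_mor Q universal_bundle) :
    exists k : bundle_mor Q w,
    [/\ bm_base k = univ_diff u v, bundle_comp k1 k = u & bundle_comp k2 k = v].
  have [|k [eb kv]] := @cart (B G) fB _ _ _ Q w _ k2 v _ (@univ_diff_cont _ _ u v).
    by rewrite ek2 tgt_univ_diff.
  exists k; split=> //; apply: (@univ_diff_injl _ _ _ _ v).
  by rewrite -[v in LHS]kv [LHS]univ_diff_comp ek -[RHS]eb.
pose pair N (Q : principal_bundle G N) u v := sval (cid (H N Q u v)).
have pairb N Q u v : bm_base (pair N Q u v) = univ_diff u v.
  by case: (svalP (cid (H N Q u v))).
have pair1 N Q u v : bundle_comp k1 (pair N Q u v) = u.
  by case: (svalP (cid (H N Q u v))).
have pair2 N Q u v : bundle_comp k2 (pair N Q u v) = v.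
  by case: (svalP (cid (H N Q u v))).
have uniq N (Q : principal_bundle G N) (k k' : bundle_mor Q w) :
    bundle_comp k1 k = bundle_comp k1 k' -> bundle_comp k2 k = bundle_comp k2 k' ->
    k = k'.
  move=> e1 e2; apply: (cart_uniq fB (v := k2)) => //=.
  rewrite -[LHS]/(id \o bm_base k) -[RHS]/(id \o bm_base k') -ek.
  by rewrite -(univ_diff_comp k1 k2 k) -(univ_diff_comp k1 k2 k') e1 e2.
pose P := @Product (B G) M M universal_bundle universal_bundle (arr G) w k1 k2
  pair pair1 pair2 uniq.
have Psrc : isrc P = @src _ G by have := src_univ_diff k1 k2; rewrite ek.
have Pmul N (Q : Ob (B G) N) (u v t : Hom Q universal_bundle) n :
    dlt P u t n = gm (dlt P v t n) (dlt P u v n).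
  by rewrite /dlt /= !pairb; exact: univ_diff_mul.
by exists (@Presents (B G) M G _ P Psrc ek2 Pmul).
Qed.

End Bundles.

(** ** Products of bundles *)

(** The product of two bundles in the total category is the fiber product [Z] of
    their total spaces over the objects of [G], as a bundle over its orbit
    space: a [G]-space with an equivariant map to a principal bundle is itself
    principal over its orbits. *)
Section BundleProduct.
Context {M : topologicalType} {G : groupoid M}.
Context {N1 N2 : topologicalType}.
Variables (X : principal_bundle G N1) (Y : principal_bundle G N2).

Let Z : topologicalType := fprod (anchor X) (anchor Y).
Implicit Types (z : Z) (g : arr G).
Let az z := anchor X (fp1 z).

Let azY z : anchor Y (fp2 z) = az z. Proof. by rewrite /az fpE. Qed.

Lemma pact_mem (p : fprod az (@tgt M G)) :
  anchor X (ac (fp1 (fp1 p)) (fp2 p)) = anchor Y (ac (fp2 (fp1 p)) (fp2 p)).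
Proof. by rewrite !anchor_ac // ?azY -fpE. Qed.

Definition pact (p : fprod az (@tgt M G)) : Z := fpair (pact_mem p).

Definition orbit_rel (z z' : Z) : Prop := exists g, [/\ az z = tgt g,
  fp1 z' = ac (fp1 z) g & fp2 z' = ac (fp2 z) g].

Lemma orbit_refl z : orbit_rel z z.
Proof.
exists (one G (az z)); split; first by rewrite tgt_one.
- by rewrite ac1.
- by rewrite ac1 // azY.
Qed.

Lemma orbit_sym z z' : orbit_rel z z' -> orbit_rel z' z.
Proof.
move=> [g [e e1 e2]]; exists (inv g); split.
- by rewrite /az e1 anchor_ac // tgt_inv.
- by rewrite e1 acK.
- by rewrite e2 acK // azY.
Qed.

Lemma orbit_trans z z' z'' : orbit_rel z z' -> orbit_rel z' z'' -> orbit_rel z z''.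
Proof.
move=> [g [e e1 e2]] [h [f f1 f2]].
have gh : src g = tgt h by rewrite -f /az e1 anchor_ac.
exists (gm g h); split; first by rewrite tgt_gm.
- by rewrite f1 e1 acM.
- by rewrite f2 e2 acM // azY.
Qed.

Let orbit_relb z z' : bool := `[< orbit_rel z z' >].
Let orbit_equiv := EquivRel orbit_relb
  (fun z => asboolT (orbit_refl z))
  (fun z z' => asbool_equiv_eq (conj (@orbit_sym z z') (@orbit_sym z' z)))
  (fun z' z z'' (e : orbit_relb z z') (e' : orbit_relb z' z'') =>
     asboolT (orbit_trans (asboolW e) (asboolW e'))).

Definition orbits : topologicalType :=
  quotient_topology {eq_quot orbit_equiv}%qT.
Definition orbit_pi : Z -> orbits :=
  \pi_(quotient_topology {eq_quot orbit_equiv})%qT.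
Let rp : orbits -> Z := fun w => repr (w : {eq_quot orbit_equiv}%qT).

Let rpK w : orbit_pi (rp w) = w. Proof. exact: reprK. Qed.

Lemma orbit_piP z z' : orbit_pi z = orbit_pi z' <-> orbit_rel z z'.
Proof.
have := @eqmodP _ orbit_equiv z z'.
by move=> h; split => [/h/asboolP//|/asboolP/h].
Qed.

Lemma orbit_pi_cont : continuous orbit_pi.
Proof. exact: pi_continuous. Qed.

Lemma orbit_lift (W : topologicalType) (f : Z -> W) : continuous f ->
  (forall z z', orbit_rel z z' -> f z = f z') ->
  exists h : orbits -> W, continuous h /\ forall z, h (orbit_pi z) = f z.
Proof.
move=> cf fr; have e z : f (rp (orbit_pi z)) = f z.
  by apply/fr/orbit_piP; rewrite rpK.
exists (f \o rp); split=> //; apply/quotient_continuous.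
by rewrite [X in continuous X](_ : _ = f) //; apply/funext => z; exact: e.
Qed.

Lemma pact_cont : continuous pact.
Proof.
have c1 : continuous (fun p : fprod az (@tgt M G) => fp1 (fp1 p)).
  exact: cont_comp (@cont_fp1 _ _ _ _ _) (@cont_fp1 _ _ _ _ _).
have c2 : continuous (fun p : fprod az (@tgt M G) => fp2 (fp1 p)).
  exact: cont_comp (@cont_fp1 _ _ _ _ _) (@cont_fp2 _ _ _ _ _).
apply: cont_fpair; apply: cont_ac => //; try exact: cont_fp2.
- by move=> p; exact: (fpE p).
- by move=> p; rewrite azY; exact: (fpE p).
Qed.

Lemma orbit_pact (p : fprod az (@tgt M G)) : orbit_pi (fp1 p) = orbit_pi (pact p).
Proof. by apply/orbit_piP; exists (fp2 p); split; rewrite ?(fpE p). Qed.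

Lemma fibre_eq z z' : orbit_pi z = orbit_pi z' -> proj X (fp1 z) = proj X (fp1 z').
Proof. by move=> /orbit_piP[g [e -> _]]; rewrite proj_ac. Qed.

Lemma pact_shear : homeomorphism (fun p => fpair (orbit_pact p)).
Proof.
split; first by apply: cont_fpair; [exact: cont_fp1|exact: pact_cont].
have [dv [cdv dv1 dv2]] := division X.
have e (q : fprod orbit_pi orbit_pi) : proj X (fp1 (fp1 q)) = proj X (fp1 (fp2 q)).
  exact: fibre_eq (fpE q).
have e1 q : az (fp1 q) = tgt (dv (fpair (e q))) by rewrite -dv1.
have key (q : fprod orbit_pi orbit_pi) g : az (fp1 q) = tgt g ->
    fp1 (fp2 q) = ac (fp1 (fp1 q)) g -> dv (fpair (e q)) = g.
  move=> eg eq; apply: (@ac_inj _ _ _ X (fp1 (fp1 q))) => //; first exact: e1.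
  by rewrite (dv2 (fpair (e q))).
exists (fun q => fpair (e1 q)); split.
- apply: cont_fpair; first exact: cont_fp1.
  apply: cont_comp cdv; apply: cont_fpair.
    exact: cont_comp (@cont_fp1 _ _ _ _ _) (@cont_fp1 _ _ _ _ _).
  exact: cont_comp (@cont_fp2 _ _ _ _ _) (@cont_fp1 _ _ _ _ _).
- by move=> p; apply: fprod_eq => //; rewrite fpairE; apply: key; rewrite ?(fpE p).
- move=> q; have /orbit_piP[g [g1 g2 g3]] := fpE q.
  have eg := key q g g1 g2.
  by apply: fprod_eq => //; rewrite [LHS]fp2_pair; apply: fprod_eq;
    rewrite !fpairE eg.
Qed.

(** Over an open set where [X] has a section [s], an orbit has exactly one point
    whose first coordinate is on [s]. *)
Lemma orbit_sections : local_sections orbit_pi.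
Proof.
apply: local_sectionsP; first exact: orbit_pi_cont.
have cpX : continuous (fun z : Z => proj X (fp1 z)).
  exact: cont_comp (@cont_fp1 _ _ _ _ _) (proj_sections X).1.
have [b [cb bE]] := orbit_lift cpX (fun z z' r => fibre_eq ((orbit_piP z z').2 r)).
move=> w0; have [V [oV Vw] [s [cs es]]] :=
  local_sections_at (b w0) (proj_sections X).
have [dv [cdv dv1 dv2]] := division X.
have oV' : open (b @^-1` V) by move/continuousP: cb; exact.
exists (b @^-1` V); first by split.
pose D := orbit_pi @^-1` (b @^-1` V).
have vP z (h : z \in D) : proj X (fp1 z) \in V.
  by rewrite -bE; apply/mem_set; exact: set_mem h.
pose v z h : set_type V := exist _ (proj X (fp1 z)) (@vP z h).
have ev z h : proj X (fp1 z) = proj X (s (@v z h)) by rewrite es.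
pose g z h : arr G := dv (fpair (@ev z h)).
have g1 z h : az z = tgt (g z h) by rewrite /g -dv1 fpairE.
have g2 z h : ac (fp1 z) (g z h) = s (@v z h) by exact: (dv2 (fpair (@ev z h))).
pose nf z h : Z := pact (fpair (g1 z h)).
have nf1 z h : fp1 (nf z h) = s (@v z h) by rewrite /nf/pact !fpairE.
have nf2 z h : fp2 (nf z h) = ac (fp2 z) (g z h) by rewrite /nf/pact !fpairE.
have nfE z h : orbit_rel z (nf z h).
  by apply/orbit_piP; exact: (orbit_pact (fpair (g1 z h))).
have nf_rel z z' h h' : orbit_rel z z' -> nf z h = nf z' h'.
  move=> r.
  have vv : v z h = v z' h'.
    by apply: val_inj => /=; apply: fibre_eq; apply/orbit_piP.
  have [k [k1 k2 k3]] : orbit_rel (nf z h) (nf z' h').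
    by apply: orbit_trans (orbit_sym (nfE z h)) (orbit_trans r (nfE z' h')).
  have ek : k = one G (az (nf z h)).
    apply: (@ac_inj _ _ _ X (fp1 (nf z h))); rewrite ?tgt_one // ac1 //.
    by rewrite -k2 !nf1 vv.
  by apply: fprod_eq; rewrite ?k2 ?k3 ek ac1 // azY.
have hr (w : set_type (b @^-1` V)) : rp (\val w) \in D.
  by apply/mem_set; rewrite /D /= rpK; exact: set_mem (valP w).
exists (fun w => nf (rp (\val w)) (hr w)); split; last first.
  by move=> w; rewrite -[RHS]rpK; apply/orbit_piP/orbit_sym.
apply: (@quotient_restrict _ _ _ orbit_pi) => //.
have -> : (fun w : set_type (orbit_pi @^-1` (b @^-1` V)) =>
    nf _ (hr (exist _ (orbit_pi (\val w)) (mem_set (set_mem (valP w)))))) =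
    fun w => nf (\val w) (valP w).
  by apply/funext => w; apply: nf_rel; apply/orbit_piP; rewrite rpK.
have cz : continuous (fun w : set_type D => \val w : Z) by exact: cont_val.
have cv : continuous (fun w : set_type D => v (\val w) (valP w)).
  by apply: cont_into_sub => /=; exact: cont_comp cz cpX.
apply: (cont_comp _ pact_cont); apply: cont_fpair => //.
apply: cont_comp cdv; apply: cont_fpair; last exact: cont_comp cv cs.
exact: cont_comp cz (@cont_fp1 _ _ _ _ _).
Qed.

Lemma fp1_pact p : fp1 (pact p) = ac (fp1 (fp1 p)) (fp2 p). Proof. by []. Qed.
Lemma fp2_pact p : fp2 (pact p) = ac (fp2 (fp1 p)) (fp2 p). Proof. by []. Qed.

Definition product_bundle : principal_bundle G orbits.
Proof.
refine (@PrincipalBundle M G orbits Z az pact orbit_pi _ pact_cont _ _ _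
  orbit_sections orbit_pact pact_shear).
- exact: cont_comp (@cont_fp1 _ _ _ _ _) (@anchor_cont _ _ _ X).
- by move=> p; rewrite /az fp1_pact anchor_ac //; exact: (fpE p).
- move=> z e; apply: fprod_eq; rewrite ?fp1_pact ?fp2_pact !fpairE ac1 //.
- move=> z g h e1 e2 e3 e4.
  by apply: fprod_eq; rewrite !(fp1_pact, fp2_pact, fp1_pair, fp2_pair) acM ?gmE // azY.
Defined.

Lemma product_ac (z : tot product_bundle) g : az z = tgt g ->
  fp1 (ac z g) = ac (fp1 z) g /\ fp2 (ac z g) = ac (fp2 z) g.
Proof. by move=> e; rewrite -(acE (P := product_bundle) e). Qed.

Lemma bundle_product : inhabited {I : topologicalType & @product (B G) _ _ X Y I}.
Proof.
have [||| p1 p1E] := @bundle_mor_ex _ _ _ _ product_bundle X fp1.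
- exact: cont_fp1.
- by [].
- by move=> z g /product_ac[].
have [||| p2 p2E] := @bundle_mor_ex _ _ _ _ product_bundle Y fp2.
- exact: cont_fp2.
- exact: azY.
- by move=> z g /product_ac[].
have H N (P : principal_bundle G N) (u : bundle_mor P X) (v : bundle_mor P Y) :
    exists k : bundle_mor P product_bundle,
    bundle_comp p1 k = u /\ bundle_comp p2 k = v.
  have e p : anchor X (bm_tot u p) = anchor Y (bm_tot v p) by rewrite !bm_anchor.
  have [|||k kE] := @bundle_mor_ex _ _ _ _ P product_bundle (fun p => fpair (e p)).
  - by apply: cont_fpair; exact: bm_tot_cont.
  - by move=> p; rewrite [LHS](bm_anchor u).
  - move=> p g epg.
    have ea : az (fpair (e p)) = tgt g by rewrite /az fpairE bm_anchor.
    have [f1 f2] := product_ac ea.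
    by apply: fprod_eq; rewrite ?f1 ?f2 !fpairE bm_ac.
  by exists k; split; apply: bundle_mor_tot_eq => p /=; rewrite ?p1E ?p2E kE.
constructor; exists orbits.
refine (@Product (B G) _ _ X Y orbits product_bundle p1 p2
  (fun N P u v => sval (cid (H N P u v))) _ _ _).
- by move=> N P u v; case: (svalP (cid (H N P u v))).
- by move=> N P u v; case: (svalP (cid (H N P u v))).
- move=> N P k k' e1 e2; apply: bundle_mor_tot_eq => p; apply: fprod_eq.
  + by have := congr1 (fun u => @bm_tot _ _ _ _ _ _ u p) e1; rewrite /= p1E.
  + by have := congr1 (fun u => @bm_tot _ _ _ _ _ _ u p) e2; rewrite /= p2E.
Qed.

End BundleProduct.

(** * Transport along equivalences *)

Lemma product_iso (C : over_top) (S S' I : topologicalType) (x x' : Ob C S)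
    (y y' : Ob C S') (f : Hom x' x) (g : Hom y' y) (P : product x y I) :
  base f = id -> base g = id -> invertible f -> invertible g ->
  exists P' : product x' y' I, [/\ isrc P' = isrc P, itgt P' = itgt P &
    forall T (t : Ob C T) (u : Hom t x') (v : Hom t y'),
      dlt P' u v = dlt P (comp f u) (comp g v)].
Proof.
move=> fb gb [f' [f1 f2]] [g' [g1 g2]].
have f'b := inv_base fb f2; have g'b := inv_base gb g2.
unshelve eexists.
  apply: (@Product C S S' x' y' I (pr_ob P) (comp f' (pr1 P)) (comp g' (pr2 P))
    (fun T t u v => pr_pair P (comp f u) (comp g v))).
  - by move=> T t u v; rewrite -compA pr1_pair compA f1 comp1m.
  - by move=> T t u v; rewrite -compA pr2_pair compA g1 comp1m.
  - move=> T t k k' e1 e2; apply: (pr_uniq (p := P)).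
      rewrite -[pr1 P](comp1m) -f2 -!compA; congr comp.
      by rewrite !compA.
    rewrite -[pr2 P](comp1m) -g2 -!compA; congr comp.
    by rewrite !compA.
by split=> //; rewrite /isrc /itgt /= base_comp ?f'b ?g'b.
Qed.

Section Transport.
Variables (A D : over_top) (e : functor A D).
Hypotheses (ff : fully_faithful e) (es : ess_surjective e).

Lemma fibered_transport : fibered_in_groupoids D -> fibered_in_groupoids A.
Proof.
move=> fD; split.
  move=> X Y f y cf; have [z [u eu]] := fD.1 _ _ f (fob e y) cf.
  have [x [h [hb _]]] := es z.
  have [v ev] := ff_full ff (comp u h).
  by exists x, v; rewrite -(fhom_base e) ev base_comp hb eu.
move=> X Y Z x y z v w f cf bvf.
have [|u [eu uw]] := cart fD (v := fhom e v) (w := fhom e w) cf.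
  by rewrite !fhom_base.
have [u' eu'] := ff_full ff u.
exists u'; split.
  split; first by rewrite -(fhom_base e) eu'.
  by apply: (ff_inj ff); rewrite fhom_comp eu'.
move=> u'' [b'' c'']; apply: (ff_inj ff); rewrite eu'.
apply: (cart_uniq fD (v := fhom e v)); first by rewrite fhom_base b''.
by rewrite uw -fhom_comp c''.
Qed.

Lemma product_image (S S' I : topologicalType) (x : Ob A S) (y : Ob A S')
    (P : product x y I) :
  exists P' : product (fob e x) (fob e y) I,
    [/\ isrc P' = isrc P, itgt P' = itgt P & forall T (t : Ob A T) (u : Hom t x)
      (v : Hom t y), dlt P' (fhom e u) (fhom e v) = dlt P u v].
Proof.
have uniq T (t : Ob D T) (k k' : Hom t (fob e (pr_ob P))) :
    comp (fhom e (pr1 P)) k = comp (fhom e (pr1 P)) k' ->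
    comp (fhom e (pr2 P)) k = comp (fhom e (pr2 P)) k' -> k = k'.
  move=> e1 e2; have [t' [h [_ [h' [_ hh']]]]] := es t.
  have [a ea] := ff_full ff (comp k h); have [a' ea'] := ff_full ff (comp k' h).
  suff aa : a = a'.
    by rewrite -[k]compm1 -[k']compm1 -hh' !compA -ea -ea' aa.
  by apply: (pr_uniq (p := P)); apply: (ff_inj ff);
    rewrite !fhom_comp ea ea' !compA ?e1 ?e2.
have H T (t : Ob D T) (u : Hom t (fob e x)) (v : Hom t (fob e y)) :
    exists k : Hom t (fob e (pr_ob P)),
    comp (fhom e (pr1 P)) k = u /\ comp (fhom e (pr2 P)) k = v.
  have [t' [h [_ [h' [_ hh']]]]] := es t.
  have [u' eu'] := ff_full ff (comp u h); have [v' ev'] := ff_full ff (comp v h).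
  exists (comp (fhom e (pr_pair P u' v')) h').
  rewrite !compA -!fhom_comp pr1_pair pr2_pair eu' ev' -!compA hh'.
  by rewrite !compm1.
pose pair T t u v := sval (cid (H T t u v)).
have pair1 T t u v : comp (fhom e (pr1 P)) (pair T t u v) = u.
  by case: (svalP (cid (H T t u v))).
have pair2 T t u v : comp (fhom e (pr2 P)) (pair T t u v) = v.
  by case: (svalP (cid (H T t u v))).
exists (@Product D S S' _ _ I _ _ _ pair pair1 pair2 uniq).
split; [exact: fhom_base|exact: fhom_base|].
move=> T t u v; rewrite /dlt -(fhom_base e); congr base.
by apply: (uniq T); rewrite ?pair1 ?pair2 -fhom_comp ?pr1_pair ?pr2_pair.
Qed.

End Transport.

(** * Atlases *)

Definition section_at (X Y : topologicalType) (f : X -> Y) (y : Y) : Prop :=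
  exists2 V : set Y, open V /\ V y &
    exists s : set_type V -> X, continuous s /\ forall v, f (s v) = \val v.

Lemma section_at_comp (X Y Z : topologicalType) (f : X -> Y) (g : Y -> Z) (y : Y)
    (V : set Z) (s : set_type V -> Y) (v : set_type V) :
  open V -> continuous s -> (forall w, g (s w) = \val w) ->
  section_at f (s v) -> section_at (g \o f) (\val v).
Proof.
move=> oV cs gs [W [oW Wy] [r [cr fr]]].
have /continuousP /(_ _ oW) [O oO eO] := cs.
have OW w : O (\val w) <-> W (s w).
  by rewrite -[O _]/((\val @^-1` O) w) -[W _]/((s @^-1` W) w) -eO.
exists (O `&` V); first by split; [exact: openI|split; [apply/OW|exact: set_mem (valP v)]].
pose i (w : set_type (O `&` V)) : set_type V :=
  exist _ (\val w) (mem_set (set_mem (valP w)).2).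
have ci : continuous i by apply: cont_into_sub; exact: cont_val.
have iW w : W (s (i w)) by apply/OW; exact: (set_mem (valP w)).1.
pose j w : set_type W := exist _ (s (i w)) (mem_set (iW w)).
exists (r \o j); split; last by move=> w; rewrite /= fr /= gs.
by apply: cont_comp cr; apply: cont_into_sub; exact: cont_comp ci cs.
Qed.

(** Local lifts are recorded as arrows [r] having a section near [n]: this
    avoids restricting objects to open subsets. *)
Definition atlas (C : over_top) (M : topologicalType) (d : Ob C M) : Prop :=
  forall (N : topologicalType) (y : Ob C N) (n : N),
    exists (T : topologicalType) (t : Ob C T) (r : Hom t y) (a : Hom t d),
      section_at (base r) n.

Lemma atlas_tgt_sections (C : over_top) (M N I : topologicalType) (d : Ob C M)
    (y : Ob C N) (P : product d y I) : atlas d -> local_sections (itgt P).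
Proof.
move=> ad; apply: local_sectionsP; first exact: itgt_cont.
move=> n; have [T [t [r [a [V oV [s [cs es]]]]]]] := ad _ y n.
exists V => //; exists (dlt P a r \o s); split.
  by apply: cont_comp cs _; exact: dlt_cont.
by move=> v; rewrite -es -(itgt_dlt P a r).
Qed.

Lemma atlas_src_sections (C : over_top) (M N I : topologicalType) (d : Ob C M)
    (y : Ob C N) (P : product y d I) : atlas d -> local_sections (isrc P).
Proof.
move=> ad; apply: local_sectionsP; first exact: isrc_cont.
move=> n; have [T [t [r [a [V oV [s [cs es]]]]]]] := ad _ y n.
exists V => //; exists (dlt P r a \o s); split.
  by apply: cont_comp cs _; exact: dlt_cont.
by move=> v; rewrite -es -(isrc_dlt P r a).
Qed.

Lemma atlas_image (A D : over_top) (e : functor A D) (M : topologicalType)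
    (d : Ob A M) : ess_surjective e -> atlas d -> atlas (fob e d).
Proof.
move=> es ad N y n; have [x [h [hb _]]] := es _ y.
have [T [t [r [a sr]]]] := ad _ x n.
exists T, (fob e t), (comp h (fhom e r)), (fhom e a).
by rewrite base_comp hb fhom_base.
Qed.

(** A bundle pulled back to its own total space has a tautological section. *)
Lemma univ_atlas (M : topologicalType) (G : groupoid M) :
  fibered_in_groupoids (B G) -> @atlas (B G) M (universal_bundle (G := G)).
Proof.
move=> fB N P n; have lP := proj_sections P.
have [P' [r er]] := fB.1 _ _ _ P lP.1.
have [|a] := @section_to_univ _ _ _ _ P P' r id (@cont_id _); first exact: esym er.
exists (tot P), P', r, a; rewrite [base r]er; exact: local_sections_at.
Qed.

(** * Epimorphisms and gerbes *)

Section RepFunctor.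
Variable C : over_top.
Hypothesis fC : fibered_in_groupoids C.

(** The 2-Yoneda lemma: an object over [U] is a morphism from [rep U]. *)
Lemma rep_functor (U : topologicalType) (y : Ob C U) :
  exists (q : functor (rep U) C) (k : Hom (fob q (rep_self U)) y), base k = id.
Proof.
pose x X (f : rep_ob U X) : Ob C X := sval (cid (fC.1 _ _ _ y (svalP f))).
have H X (f : rep_ob U X) : exists u : Hom (x X f) y, base u = sval f.
  exact: svalP (cid (fC.1 _ _ _ y (svalP f))).
pose r X f := sval (cid (H X f)).
have er X f : base (r X f) = sval f by exact: svalP (cid (H X f)).
have L X Y (f : rep_ob U X) (g : rep_ob U Y) (h : rep_hom f g) :
    exists u : Hom (x X f) (x Y g), base u = sval h /\ comp (r Y g) u = r X f.
  by case: h => h [ch eh]; apply: (cart fC) => //=; rewrite !er.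
pose l X Y f g h := sval (cid (L X Y f g h)).
have lb X Y f g h : base (l X Y f g h) = sval h by case: (svalP (cid (L X Y f g h))).
have lr X Y f g h : comp (r Y g) (l X Y f g h) = r X f.
  by case: (svalP (cid (L X Y f g h))).
have q1 X Y f g h : base (l X Y f g h) = @base (rep U) X Y f g h by exact: lb.
have q2 X (f : Ob (rep U) X) : l X X f f (idm f) = idm (x X f).
  by apply: (cart_uniq fC (v := r X f)); rewrite ?lb ?base_id ?lr ?compm1.
have q3 X Y Z (f : Ob (rep U) X) (g : Ob (rep U) Y) (h : Ob (rep U) Z)
    (v : Hom g h) (u : Hom f g) :
    l X Z f h (comp v u) = comp (l Y Z g h v) (l X Y f g u).
  by apply: (cart_uniq fC (v := r Z h)); rewrite ?base_comp ?lb ?compA ?lr.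
exists (@Functor (rep U) C x l q1 q2 q3), (r U (rep_self U)).
exact: er.
Qed.

(** The definition of epimorphisms, applied to the morphism classifying [y]. *)
Lemma epi_local (D : over_top) (F : functor D C) : epimorphism F ->
  forall (U : topologicalType) (y : Ob C U), exists c : open_cover U,
    forall i : idx c, exists (x : Ob D (piece i)) (k : Hom (fob F x) y),
      base k = incl (i := i).
Proof.
move=> eF U y; have [q [k ek]] := rep_functor y.
have [c H] := eF U q; exists c => i; have [qi [eta [eb _ _]]] := H i.
have ei : sval (rep_self U) \o incl (i := i) =
    sval (rep_map_ob (@incl_cont U c i) (rep_self (piece i))) by [].
pose h : rep_hom (rep_map_ob (@incl_cont U c i) (rep_self (piece i)))
  (rep_self U) := exist _ (incl (i := i)) (conj (@incl_cont U c i) ei).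
exists (fob qi (rep_self (piece i))).
exists (comp k (comp (@fhom _ _ q _ _ _ _ h) (eta _ (rep_self (piece i))))).
by rewrite !base_comp ek (@fhom_base _ _ q _ _ _ _ h) eb.
Qed.

Lemma epi_atlas (D : over_top) (F : functor D C) (M : topologicalType)
    (d : Ob D M) : epimorphism F -> atlas d -> atlas (fob F d).
Proof.
move=> eF ad N y n; have [c H] := epi_local eF y.
have [i ni] := piece_cover c n; have [x [k ek]] := H i.
pose v : piece i := exist _ n (mem_set ni).
have [T [t [r [a sr]]]] := ad _ x v.
exists T, (fob F t), (comp k (fhom F r)), (fhom F a).
rewrite base_comp ek fhom_base.
apply: (@section_at_comp _ _ _ _ _ v (piece_set i) id v) => //.
  exact: piece_open.
exact: cont_id.
Qed.

End RepFunctor.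

Lemma fibprod_fibered (Y Z X : over_top) (f : functor Y X) (g : functor Z X) :
  fibered_in_groupoids Y -> fibered_in_groupoids Z -> fibered_in_groupoids X ->
  fibered_in_groupoids (fibprod f g).
Proof.
move=> fY fZ fX; split.
  move=> S T h [y z al alb] ch.
  have [y' [u eu]] := fY.1 _ _ h y ch; have [z' [v ev]] := fZ.1 _ _ h z ch.
  have [|al' [ab' e']] := cart fX (v := fhom g v) (w := comp al (fhom f u)) (@cont_id S).
    by rewrite base_comp !fhom_base alb eu ev.
  have ebuv : base u = base v by rewrite eu ev.
  by exists (FibOb ab'), (@FibHom _ _ _ f g _ _ (FibOb ab') (FibOb alb) u v ebuv (esym e')).
move=> R S T x y z v w h ch e.
have e2 : base (fibm2 v) \o h = base (fibm2 w) by rewrite -!fibm_base.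
have [u1 [b1 c1]] := cart fY ch e; have [u2 [b2 c2]] := cart fZ ch e2.
have bu : base u1 = base u2 by rewrite b1 b2.
have cu : comp (fib_arr y) (fhom f u1) = comp (fhom g u2) (fib_arr x).
  apply: (cart_uniq fX (v := fhom g (fibm2 v))).
    by rewrite !base_comp !fib_arr_base !fhom_base bu.
  rewrite !compA -fibm_comm -!fhom_comp c2 -compA -fhom_comp c1.
  exact: fibm_comm.
exists (FibHom bu cu); split.
  by split=> //; apply: fib_hom_eq.
move=> u' [b' c']; apply: fib_hom_eq => /=.
  apply: (cart_uniq fY (v := fibm1 v)); first by rewrite b1.
  by rewrite c1 -c'.
apply: (cart_uniq fZ (v := fibm2 v)); first by rewrite b2 -fibm_base.
by rewrite c2 -c'.
Qed.

(** Since the diagonal is an epimorphism, automorphisms of [F d] lift locally: an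
    automorphism is an object of the fiber product of [D] with itself, and
    lifting that object along the diagonal lifts the automorphism. *)
Lemma gerbe_sections (D C : over_top) (F : functor D C) (M I I' : topologicalType)
    (d : Ob D M) (P : product d d I) (P' : product (fob F d) (fob F d) I') :
  fibered_in_groupoids D -> fibered_in_groupoids C -> epimorphism (diagonal F) ->
  local_sections (imap F P P' (idm _) (idm _)).
Proof.
move=> fD fC eD; split; first exact: imap_cont.
have [d1 [a1 e1]] := fD.1 _ _ _ d (@isrc_cont _ _ _ _ _ _ P').
have [d2 [a2 e2]] := fD.1 _ _ _ d (@itgt_cont _ _ _ _ _ _ P').
have [|j [jb je]] := cart fC (v := pr1 P') (w := fhom F a1) (@cont_id I').
  by rewrite fhom_base e1.
have [|al [alb ale]] := cart fC (v := fhom F a2) (w := comp (pr2 P') j) (@cont_id I').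
  by rewrite base_comp fhom_base e2 jb.
have [c H] := epi_local (fibprod_fibered F F fD fD fC) eD (FibOb alb).
exists c => i; have [x [k ek]] := H i.
exists (dlt P (comp a1 (fibm1 k)) (comp a2 (fibm2 k))); split; first exact: dlt_cont.
rewrite imap_dlt !comp1m !fhom_comp -je.
have := fibm_comm k; rewrite /= compm1 => <-.
rewrite compA ale -!compA dlt_comp dlt_pr base_comp jb fhom_base.
exact: ek.
Qed.

(** * Existence of the extension *)

(** The diagonal of a topological stack is representable, because that of a
    classifying stack is. *)
Lemma topological_stack_products (D : over_top) :
  topological_stack D -> inhabited (products D).
Proof.
move=> [_ [M [G [e he]]]]; have ff := equivalence_ff he.
have es := equivalence_ess_surjective he.
suff H S S' (x : Ob D S) (y : Ob D S') : inhabited {I : topologicalType & product x y I}.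
  by constructor => S S' x y; exact: inhabited_witness (H S S' x y).
have [x' [h [hb [h' [hh' h'h]]]]] := es _ x.
have [y' [g [gb [g' [gg' g'g]]]]] := es _ y.
have [[I P]] := bundle_product x' y'.
have [P' _] := product_image ff es P.
have [||||P'' _] := @product_iso _ _ _ _ _ _ _ _ h' g' P'.
- exact: inv_base h'h.
- exact: inv_base g'g.
- by exists h.
- by exists g.
by constructor; exists I.
Qed.

Lemma topological_stack_atlas (D : over_top) : topological_stack D ->
  exists (M : topologicalType) (d : Ob D M), atlas d.
Proof.
move=> [[fD _ _] [M [G [e he]]]]; have ff := equivalence_ff he.
have es := equivalence_ess_surjective he.
exists M, (fob e universal_bundle); apply: atlas_image => //.
exact: univ_atlas (fibered_transport ff es fD).
Qed.

Section Existence.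
Variables (D C : over_top) (F : functor D C).
Hypotheses (sD : is_stack D) (sC : is_stack C).
Let fD := stack_fibered sD.
Let fC := stack_fibered sC.
Variables (hpD : products D) (hpC : products C).
Context {M : topologicalType} {d : Ob D M}.
Let c := fob F d.
Let G := aut fD hpD d.
Let H := aut fC hpC c.

Definition aut_mor : gmor G H :=
  pmor fD (aut_presents fD hpD d) (aut_presents fC hpC c) (idm c).

Lemma aut_mor_sections : epimorphism (diagonal F) -> local_sections (gm1 aut_mor).
Proof.
exact: (gerbe_sections (F := F) (iso_prod hpD d d) (iso_prod hpC c c) fD fC).
Qed.

Definition aut_extension (eD : epimorphism (diagonal F)) : extension :=
  @Extension M G H aut_mor (base_id c) (aut_mor_sections eD).

Hypotheses (ad : atlas d) (acF : atlas c).

Let lD N (y : Ob D N) : local_sections (itgt (iso_prod hpD d y)).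
Proof. exact: atlas_tgt_sections. Qed.
Let lC N (y : Ob C N) : local_sections (itgt (iso_prod hpC c y)).
Proof. exact: atlas_tgt_sections. Qed.

Let PsiD : functor D (B G) := @classify _ sD hpD _ d lD.
Let PsiC : functor C (B H) := @classify _ sC hpC _ c lC.

Section Compare.
Context {N : topologicalType} (x : Ob D N).
Let Q := iso_prod hpD d x.
Let Q' := iso_prod hpC c (fob F x).

Definition iso_image : iso hpD d x -> iso hpC c (fob F x) :=
  imap F Q Q' (idm c) (idm (fob F x)).

Lemma iso_imageE T (t : Ob D T) (u : Hom t d) (v : Hom t x) g :
  dlt Q u v = cst g -> dlt Q' (fhom F u) (fhom F v) = cst (iso_image g).
Proof. by move=> e; rewrite -(imap_cst F Q Q' _ _ e) !comp1m. Qed.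

Lemma compare_mem (z : assoc_pre aut_mor (fob PsiD x)) :
  isrc Q' (iso_image (fp1 z)) = itgt (iso_prod hpC c c) (dl z).
Proof.
by rewrite isrc_imap -[RHS](esym (tgt_dl z)).
Qed.

Definition compare_pre (z : assoc_pre aut_mor (fob PsiD x)) : iso hpC c (fob F x) :=
  icomp fC (fpair (compare_mem z)).

Lemma compare_preE (z : assoc_pre aut_mor (fob PsiD x)) T (t : Ob D T) (v : Hom t d) (w : Hom t x)
    (s : Hom (fob F t) c) :
  dlt Q v w = cst (fp1 z) -> dlt (iso_prod hpC c c) s (fhom F v) = cst (dl z) ->
  dlt Q' s (fhom F w) = cst (compare_pre z).
Proof. by move=> e1 e2; apply: icompE e2; exact: iso_imageE. Qed.

Lemma compare_point (z : assoc_pre aut_mor (fob PsiD x)) :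
  exists (T : topologicalType) (n : T) (t : Ob D T) (v : Hom t d) (w : Hom t x)
    (s : Hom (fob F t) c), dlt Q v w = cst (fp1 z) /\
    dlt (iso_prod hpC c c) s (fhom F v) = cst (dl z).
Proof.
have [T [n [t [v [w evw]]]]] := dlt_point Q fD (fp1 z).
have [|s es] := @point_surjl _ _ _ _ _ _ (iso_prod hpC c c) fC _ _ (fhom F v) (dl z).
  by rewrite fhom_base (dlt_cst_src evw) -compare_mem isrc_imap base_id.
by exists T, n, t, v, w, s.
Qed.

(** Points of the associated bundle are pairs [(p, h)] modulo [G]; the comparison
    map sends such a pair to [F p . h]. *)
Lemma compare_ex : exists u : bundle_mor (assoc_bundle aut_mor (fob PsiD x))
    (fob PsiC (fob F x)),
  bm_base u = id /\ forall z, bm_tot u (assoc_pi z) = compare_pre z.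
Proof.
have rel z z' : assoc_rel z z' -> compare_pre z = compare_pre z'.
  move=> /relP[g [g1 g2 g3]].
  have [T [n [t [v [w [s [evw _]]]]]]] := compare_point z.
  have [|u euv] := @point_surjl _ _ _ _ _ _ (iso_prod hpD d d) fD _ _ v g.
    by rewrite (dlt_cst_src evw); apply/funext => m; exact: g1.
  have euw : dlt Q u w = cst (fp1 z').
    rewrite g2 -(acE (P := fob PsiD x) g1); exact: (icompE fD g1 evw euv).
  have [|s' es'] := @point_surjl _ _ _ _ _ _ (iso_prod hpC c c) fC _ _ (fhom F u) (dl z').
    by rewrite fhom_base (dlt_cst_src euw) -compare_mem isrc_imap base_id.
  have es : dlt (iso_prod hpC c c) s' (fhom F v) = cst (dl z).
    rewrite g3; apply: (@dlt_cst_mul _ _ _ _ (aut_presents fC hpC c) _ _ _ (fhom F u)) es'.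
    have := imap_cst F (iso_prod hpD d d) (iso_prod hpC c c) (idm c) (idm c) euv.
    by rewrite !comp1m.
  by apply: (cst_eq n); rewrite -(compare_preE evw es) (compare_preE euw es').
pose f := compare_pre \o (@assoc_repr _ _ _ _ aut_mor _ (fob PsiD x)).
have fE z : f (assoc_pi z) = compare_pre z.
  by have := lift_pi rel => /(congr1 (@^~ z)).
have cf : continuous f.
  apply: lift_cont => //; apply: (cont_comp _ (@icomp_cont _ _ _ _ _ _ c c (fob F x))).
  apply: cont_fpair; last exact: cont_dl.
  exact: cont_comp (@cont_fp1 _ _ _ _ _) (imap_cont F Q Q' _ _).
refine (ex_intro _ (@BundleMor M H N N (assoc_bundle aut_mor (fob PsiD x))
  (fob PsiC (fob F x)) f id cf (@cont_id N) _ _ _)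
  (conj erefl fE)).
- move=> p; have [z ->] := assoc_piW p; rewrite fE [RHS]assoc_proj_pi.
  by rewrite [LHS]itgt_icomp fp1_pair itgt_imap base_id.
- move=> p; have [z ->] := assoc_piW p; rewrite fE [RHS]assoc_anchor_pi.
  by rewrite [LHS]isrc_icomp.
- move=> p e; have [z ez] := assoc_piW (fp1 p).
  have e1 : assoc_anchor (assoc_pi z) = tgt (fp2 p) by rewrite -ez; exact: fpE p.
  have e2 : src (dl z) = tgt (fp2 p) by rewrite -assoc_anchor_pi.
  have -> : act (assoc_bundle aut_mor (fob PsiD x)) p = assoc_pi (pre_act e2).
    by rewrite -(assoc_act_pi e1 e2); congr assoc_act; apply: fprod_eq.
  rewrite fE.
  have [T [n [t [v [w [s [evw es]]]]]]] := compare_point z.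
  have [|r er] := @point_surjl _ _ _ _ _ _ (iso_prod hpC c c) fC _ _ s (fp2 p).
    by rewrite (dlt_cst_src es); apply/funext => m; exact: e2.
  have er' : dlt (iso_prod hpC c c) r (fhom F v) = cst (dl (pre_act e2)).
    by rewrite pre_act2; exact: (@dlt_cst_mul _ _ _ _ (aut_presents fC hpC c) _ _ _ s).
  apply: (cst_eq n); rewrite -(compare_preE (z := pre_act e2) evw er').
  apply: (icompE fC e _ er).
  by rewrite ez fE; exact: compare_preE evw es.
Qed.

End Compare.

Lemma compare_iso2 : iso2 (fcomp (assoc_functor aut_mor) PsiD) (fcomp PsiC F).
Proof.
exists (fun N x => sval (cid (@compare_ex N x))); split.
- by move=> N x; case: (svalP (cid (@compare_ex N x))).
- move=> N N' x y u.
  have [_ ux] := svalP (cid (@compare_ex N x)).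
  have [_ uy] := svalP (cid (@compare_ex N' y)).
  apply: bundle_mor_tot_eq => p; have [z ->] := assoc_piW p.
  rewrite [LHS]/= assoc_mor_pi [LHS]uy.
  rewrite [RHS]/= ux.
  have [T [n [t [v [w [s [evw es]]]]]]] := compare_point z.
  apply: (cst_eq n).
  have e1 : dlt (iso_prod hpD d y) v (comp u w) = cst (fp1 (pre_mor (fhom PsiD u) z)).
    exact: iso_pushE.
  rewrite -[LHS](compare_preE (z := pre_mor (fhom PsiD u) z) e1 es).
  by rewrite -[RHS](iso_pushE (fhom F u) (compare_preE evw es)) fhom_comp.
- move=> N x; apply: bundle_mor_invertible.
  by case: (svalP (cid (@compare_ex N x))).
Qed.

Lemma aut_extension_induces (eD : epimorphism (diagonal F)) :
  induces (aut_extension eD) F.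
Proof.
have hD : equivalence PsiD by apply: ff_es_equivalence; [exact: classify_ff|exact: classify_es].
have hC : equivalence PsiC by apply: ff_es_equivalence; [exact: classify_ff|exact: classify_es].
have [eD' [d1 d2]] := hD; have [eC [c1 c2]] := hC.
exists eD', eC; split; [by exists PsiD|by exists PsiC|].
have i1 : iso2 (fcomp F eD') (fcomp eC (fcomp PsiC (fcomp F eD'))).
  exact: iso2_sym (iso2_compr (fcomp F eD') c1).
have i2 : iso2 (fcomp eC (fcomp PsiC (fcomp F eD')))
    (fcomp eC (fcomp (assoc_functor aut_mor) (fcomp PsiD eD'))).
  exact: iso2_compl (iso2_compr eD' (iso2_sym compare_iso2)).
apply: iso2_trans i1 (iso2_trans i2 _).
exact: (iso2_compl (fcomp eC (assoc_functor aut_mor)) d2).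
Qed.

End Existence.

(** * Uniqueness up to Morita equivalence *)

Lemma presents_image (A D : over_top) (e : functor A D) (M : topologicalType)
    (G : groupoid M) (d : Ob A M) (P : presents G d) :
  fully_faithful e -> ess_surjective e ->
  exists P' : presents G (fob e d), forall T (t : Ob A T) (u v : Hom t d),
    dlt P' (fhom e u) (fhom e v) = dlt P u v.
Proof.
move=> ff es; have [P' [ps pt pd]] := product_image ff es P.
have Ps : isrc P' = @src _ G by rewrite ps ps_src.
have Pt : itgt P' = @tgt _ G by rewrite pt ps_tgt.
suff Pm T (t : Ob D T) (u v w : Hom t (fob e d)) n :
    dlt P' u w n = gm (dlt P' v w n) (dlt P' u v n).
  by exists (@Presents D M G _ P' Ps Pt Pm).
have [t' [h [hb _]]] := es _ t.
have [u' eu] := ff_full ff (comp u h); have [v' ev] := ff_full ff (comp v h).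
have [w' ew] := ff_full ff (comp w h).
have pull a b a' b' : fhom e a' = comp a h -> fhom e b' = comp b h ->
    dlt P' a b n = dlt P a' b' n.
  move=> ea eb; rewrite -pd ea eb dlt_comp hb.
  by [].
rewrite (pull _ _ _ _ eu ew) (pull _ _ _ _ ev ew) (pull _ _ _ _ eu ev).
exact: ps_mul.
Qed.

Lemma presents_iso (C : over_top) (M : topologicalType) (G : groupoid M)
    (c c' : Ob C M) (f : Hom c' c) (P : presents G c) :
  base f = id -> invertible f ->
  exists P' : presents G c', forall T (t : Ob C T) (u v : Hom t c'),
    dlt P' u v = dlt P (comp f u) (comp f v).
Proof.
move=> fb fi; have [P' [ps pt pd]] := product_iso P fb fb fi fi.
have Ps : isrc P' = @src _ G by rewrite ps ps_src.
have Pt : itgt P' = @tgt _ G by rewrite pt ps_tgt.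
have Pm T (t : Ob C T) (u v w : Hom t c') n :
    dlt P' u w n = gm (dlt P' v w n) (dlt P' u v n) by rewrite !pd; exact: ps_mul.
by exists (@Presents C M G _ P' Ps Pt Pm).
Qed.

Section AssocUniversal.
Context {M M' : topologicalType} {G : groupoid M} {H : groupoid M'}.
Variable phi : gmor G H.
Let U := universal_bundle (G := G).

Lemma assoc_univ_src (z : assoc_pre phi U) : src (gm1 phi (fp1 z)) = tgt (dl z).
Proof. by rewrite gm_src [RHS]tgt_dl. Qed.

(** The bundle associated with the universal bundle of [G] is the pullback of that
    of [H]: the class of [(g, h)] goes to [phi g . h]. *)
Lemma assoc_univ : exists k : bundle_mor (assoc_bundle phi U)
    (universal_bundle (G := H)),
  bm_base k = gm0 phi /\
  forall z, bm_tot k (assoc_pi z) = gm (gm1 phi (fp1 z)) (dl z).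
Proof.
pose f (z : assoc_pre phi U) := gm (gm1 phi (fp1 z)) (dl z).
have rel z z' : assoc_rel z z' -> f z = f z'.
  move=> /relP[g [e1 e2 e3]]; rewrite /f e3 e2 univ_ac // gm1_gm // gmA //.
    by rewrite gm_src gm_tgt [src (fp1 z)]e1.
  by rewrite gm_src [RHS]tgt_dl e2 anchor_ac.
pose h := f \o (@assoc_repr _ _ _ _ phi _ U).
have hE z : h (assoc_pi z) = f z by have := lift_pi rel => /(congr1 (@^~ z)).
have ch : continuous h.
  apply: lift_cont => //; apply: cont_gm; first exact: assoc_univ_src.
    exact: cont_comp (@cont_fp1 _ _ _ _ _) (@gm1_cont _ _ _ _ phi).
  exact: cont_dl.
have [|||k kE] := @bundle_mor_ex _ _ _ _ (assoc_bundle phi U) universal_bundle h.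
- exact: ch.
- move=> p; have [z ->] := assoc_piW p; rewrite hE [RHS]assoc_anchor_pi.
  by rewrite [LHS]src_gm // assoc_univ_src.
- move=> p g; have [z ->] := assoc_piW p => e.
  have e2 : src (dl z) = tgt g by rewrite -assoc_anchor_pi.
  rewrite -(acE (P := assoc_bundle phi U) e) [act _ _](assoc_act_pi e e2) !hE.
  rewrite /f pre_act2 univ_ac; last first.
    by rewrite [src _](src_gm (assoc_univ_src z)).
  by rewrite (gmA (assoc_univ_src z) e2).
exists k; split; last by move=> z; rewrite kE hE.
apply/funext => n; have [p <-] := proj_surj (assoc_bundle phi U) n.
have [z ->] := assoc_piW p; rewrite -bm_proj kE hE [LHS]tgt_gm ?assoc_univ_src //.
by rewrite gm_tgt [proj _ _]assoc_proj_pi.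
Qed.

(** On the class of [(p, h)] this is the identity
    [(phi (v p) . h) . (phi (u p) . h)^-1 = phi (v p . (u p)^-1)]. *)
Lemma univ_diff_assoc N (Q : principal_bundle G N) (u v : bundle_mor Q U)
    (k : bundle_mor (assoc_bundle phi U) (universal_bundle (G := H))) :
  (forall z, bm_tot k (assoc_pi z) = gm (gm1 phi (fp1 z)) (dl z)) ->
  univ_diff (bundle_comp k (assoc_mor phi u)) (bundle_comp k (assoc_mor phi v)) =
  gm1 phi \o univ_diff u v.
Proof.
move=> kE; apply/funext => n; have [p <-] := proj_surj (assoc_bundle phi Q) n.
have [z ->] := assoc_piW p.
have tE (w : bundle_mor Q U) : bm_tot (bundle_comp k (assoc_mor phi w)) (assoc_pi z) =
    gm (gm1 phi (bm_tot w (fp1 z))) (dl z).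
  by rewrite /= assoc_mor_pi kE.
have sE (w : bundle_mor Q U) : src (gm1 phi (bm_tot w (fp1 z))) = tgt (dl z).
  by rewrite gm_src [src _](bm_anchor w) tgt_dl.
have [a1 _ a3] := univ_diffP u v (fp1 z).
transitivity (gm1 phi (univ_diff u v (proj Q (fp1 z)))); last first.
  by congr (gm1 phi (univ_diff u v _)); apply/esym; exact: assoc_proj_pi.
have e : src (gm1 phi (univ_diff u v (proj Q (fp1 z)))) =
    tgt (gm1 phi (bm_tot u (fp1 z))) by rewrite gm_src gm_tgt a1.
apply: univ_diffE; rewrite tE; first by rewrite (tgt_gm (sE u)).
by rewrite tE (gmA e (sE u)) -gm1_gm // a3.
Qed.

End AssocUniversal.

(** Equivalences preserve products, so [ext_dom E], which consists of the
    automorphisms of the universal bundle, also consists of those of its image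
    [d]. The 2-isomorphism identifies [F d] with the image of the bundle
    associated with the universal one, which is universal for [ext_cod E]. *)
Lemma induces_presents (E : extension) (D C : over_top) (F : functor D C) :
  is_stack D -> is_stack C -> induces E F ->
  exists (d : Ob D (ext_obj E)) (P : presents (ext_dom E) d)
    (P' : presents (ext_cod E) (fob F d)), atlas d /\
    forall T (t : Ob D T) (u v : Hom t d),
      gm1 (ext_mor E) \o dlt P u v = dlt P' (fhom F u) (fhom F v).
Proof.
move=> sD sC; case: E => M G H phi phi0 lphi [eD [eC [/= hD hC [eta [eb en ei]]]]].
have ffD := equivalence_ff hD; have esD := equivalence_ess_surjective hD.
have ffC := equivalence_ff hC; have esC := equivalence_ess_surjective hC.
have fG := fibered_transport ffD esD (stack_fibered sD).
have fH := fibered_transport ffC esC (stack_fibered sC).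
have [PG PGE] := univ_presents fG; have [PH PHE] := univ_presents fH.
have [P PE] := presents_image PG ffD esD.
have [P2 P2E] := presents_image PH ffC esC.
have [k [kb kE]] := assoc_univ phi.
pose U : Ob (B G) M := universal_bundle.
pose k' : @Hom (B H) M M (assoc_bundle phi U) universal_bundle := k.
pose f := comp (fhom eC k') (eta M U).
have kid : bm_base k = id by rewrite kb.
have fb : base f = id by rewrite base_comp eb fhom_base [base k']kid.
have fi : invertible f.
  apply: invertible_comp; last exact: ei.
  by apply: fhom_invertible; exact: bundle_mor_invertible.
have [P' P'E] := presents_iso P2 fb fi.
exists (fob eD U), P, P'; split.
  by apply: atlas_image => //; exact: univ_atlas.
move=> T t u v; have [t' [h [hb _]]] := esD _ t.
have [u' eu] := ff_full ffD (comp u h); have [v' ev] := ff_full ffD (comp v h).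
have fE (w : Hom t' U) : comp f (fhom F (fhom eD w)) =
    comp (fhom eC (comp k' (fhom (assoc_functor phi) w))) (eta T t').
  rewrite /f -compA -[fhom F _]/(fhom (fcomp F eD) w) en compA.
  by rewrite fhom_comp.
have -> : dlt P u v = univ_diff u' v'.
  by rewrite -PGE -PE eu ev dlt_comp hb.
have -> : dlt P' (fhom F u) (fhom F v) =
    dlt P' (fhom F (fhom eD u')) (fhom F (fhom eD v')).
  by rewrite eu ev !fhom_comp dlt_comp fhom_base hb.
rewrite P'E !fE dlt_comp eb P2E PHE.
by rewrite -(univ_diff_assoc u' v' kE).
Qed.

Section Uniqueness.
Variables (D C : over_top) (F : functor D C).
Hypotheses (sD : is_stack D) (sC : is_stack C).
Variables (hpD : products D) (hpC : products C).
Hypothesis eD : epimorphism (diagonal F).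

(** Both components are comparison maps along arrows, namely [p] and [F p]; they
    commute with the extensions because [F] is a functor. *)
Lemma aut_extension_morita (E : extension) (d : Ob D (ext_obj E))
    (P : presents (ext_dom E) d) (P' : presents (ext_cod E) (fob F d))
    (W : topologicalType) (w : Ob D W) (p : Hom w d) :
  (forall T (t : Ob D T) (u v : Hom t d),
    gm1 (ext_mor E) \o dlt P u v = dlt P' (fhom F u) (fhom F v)) ->
  local_sections (base p) ->
  ext_morita_morphism (@aut_extension D C F sD sC hpD hpC W w eD) E.
Proof.
move=> compat lp; have fD := stack_fibered sD.
pose A := aut_presents (stack_fibered sD) hpD w.
pose A' := aut_presents (stack_fibered sC) hpC (fob F w).
exists (pmor_id (stack_fibered sD) A P p), (pmor_id (stack_fibered sC) A' P' (fhom F p)).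
split.
- exact: pmor_id_morita.
- by apply: pmor_id_morita; rewrite fhom_base.
- by rewrite /= fhom_base.
apply/funext => g.
have [T [n [t [u [v euv]]]]] := dlt_point A fD g.
apply: (cst_eq n).
have e1 : dlt P (comp p u) (comp p v) = cst (gm1 (pmor_id (stack_fibered sD) A P p) g).
  exact: (imap_cst (fid D) A P p p euv).
have e2 : dlt A' (fhom F u) (fhom F v) = cst (imap F A A' (idm _) (idm _) g).
  by rewrite -(imap_cst F A A' _ _ euv) !comp1m.
have e3 := imap_cst (fid C) A' P' (fhom F p) (fhom F p) e2.
rewrite -[RHS]e3 /= -!fhom_comp -compat e1.
by [].
Qed.

(** The common refinement lives on the space of isomorphisms between the two
    atlases, which maps to both by maps of local sections. *)
Lemma extension_unique (E E' : extension) :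
  induces E F -> induces E' F -> ext_morita_equivalent E E'.
Proof.
move=> /(induces_presents sD sC)[d [P [Q [ad cP]]]].
move=> /(induces_presents sD sC)[d' [P' [Q' [ad' cP']]]].
pose W := iso_prod hpD d d'.
exists (@aut_extension D C F sD sC hpD hpC _ (pr_ob W) eD); split.
  by apply: (aut_extension_morita (p := pr1 W) cP); exact: (atlas_src_sections W).
by apply: (aut_extension_morita (p := pr2 W) cP'); exact: (atlas_tgt_sections W).
Qed.

End Uniqueness.

Theorem theorem4p2 (D C : over_top) (hD : topological_stack D)
  (hC : topological_stack C) (F : functor D C) (hF : gerbe F)
  (hDelta : representable_local_sections (diagonal F)) :
  (exists E : extension, induces E F) /\
  (forall E E' : extension, induces E F -> induces E' F ->
    ext_morita_equivalent E E').
Proof.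
have [eF eDelta] := hF; have [[sD _] [sC _]] := (hD, hC).
have [[hpD] [hpC]] := (topological_stack_products hD, topological_stack_products hC).
split; last by move=> E E'; exact: extension_unique.
have [M [d ad]] := topological_stack_atlas hD.
exists (@aut_extension D C F sD sC hpD hpC M d eDelta).
apply: aut_extension_induces => //.
exact (epi_atlas (stack_fibered sC) eF ad).
Qed.
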